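(* Let $\Delta\subset M\otimes\mathbb{R}$ be a reflexive polytope of dimension $d$, $\Sigma^*$ the face fan of $\Delta$ and $\Sigma$ the normal fan of $\Delta$, and suppose every cone of $\Sigma^*$ is $\mathbb{Z}_2$ regular. Let $s$ be the rank of the span in $N/2N$ of the images of the primitive generators of the rays of $\Sigma$, and let $h=(h_0,\dots,h_d)$ be the $h$-vector of $\Delta$. Then the ranks of all the spaces $H_{pq}(\Sigma)$, $0\le q\le p\le d$, are determined by the following: (i) $H_{qq}(\Sigma)$ has rank $1$ for $q\le d-2$, and $H_{pq}(\Sigma)=0$ for $q<p\le d-2$; (ii) $\mathrm{rank}\,H_{dq}(\Sigma)=\binom{d-s}{q-s}$ for $0\le q\le d$; (iii) for each $q$ with $0\le q\le d$, $\sum_{p=q}^{d}(-1)^p\,\mathrm{rank}\,H_{pq}(\Sigma)=(-1)^qh_q$ (which, together with (i) and (ii), determines $\mathrm{rank}\,H_{d-1,q}(\Sigma)$).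
   Context: $N\cong\mathbb{Z}^d$ and $M=\mathrm{Hom}(N,\mathbb{Z})$ are dual lattices with pairing $\langle\cdot,\cdot\rangle$; $\mathbb{Z}_2=\mathbb{Z}/2\mathbb{Z}$. Convention: $\binom{n}{k}=0$ if $k<0$. A lattice polytope $\Delta\subset M\otimes\mathbb{R}$ of dimension $d$ is reflexive if $0\in\mathrm{int}\,\Delta$ and the polar polytope $\Delta^*=\{n\in N\otimes\mathbb{R}: \langle m,n\rangle\ge -1 \text{ for all } m\in\Delta\}$ is a lattice polytope (with respect to $N$). The face fan of $\Delta$ consists of $\{0\}$ and the cones over proper nonempty faces of $\Delta$. The normal fan $\Sigma$ of $\Delta$ is the inner normal fan; for $\Delta$ reflexive it equals the face fan of $\Delta^*$. The $h$-vector of $\Delta$ is defined by $\sum_{p=0}^d f_p(t-1)^p=\sum_{q=0}^d h_qt^q$, where $f_p$ is the number of $p$-dimensional faces of $\Delta$ (so $f_d=1$). A cone $\sigma$ of $\Sigma^*$ (in $M\otimes\mathbb{R}$) is $\mathbb{Z}_2$ regular if the images in $M/2M$ of the primitive lattice generators of its rays form a basis of the subspace $(M\cap\mathrm{span}\,\sigma)/(2M\cap\mathrm{span}\,\sigma)$ of $M/2M$. Cosheaf homology: a cosheaf $\mathscr{F}$ of $\mathbb{Z}_2$ vector spaces on $\Sigma$ is a collection of $\mathbb{Z}_2$ vector spaces $F_\sigma$, $\sigma\in\Sigma$, with linear maps $\rho_{\tau,\sigma}:F_\sigma\to F_\tau$ for faces $\sigma<\tau$ satisfying $\rho_{\beta,\tau}\rho_{\tau,\sigma}=\rho_{\beta,\sigma}$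 and $\rho_{\sigma,\sigma}=\mathrm{id}$. Put $C_p(\mathscr{F})=\bigoplus_{\dim\sigma=d-p}F_\sigma$, with boundary $C_p\to C_{p-1}$ the direct sum over $\sigma$ of the maps $\sum_{\sigma<\tau,\ \dim\tau=d-p+1}\rho_{\tau,\sigma}$; $H_p(\mathscr{F})$ is the $p$th homology group. The cosheaf $\mathscr{E}$ on $\Sigma$ has stalks $E_\sigma=N(\sigma):=(N/2N)/N_\sigma$, where $N_\sigma=(N\cap\mathrm{span}\,\sigma)/(2N\cap\mathrm{span}\,\sigma)\subset N/2N$, and the natural quotient maps $N(\sigma)\to N(\tau)$ for $\sigma<\tau$. The $\mathbb{Z}_2$ Hodge spaces are $H_{pq}(\Sigma):=H_p(\wedge^q\mathscr{E})$, $0\le q\le p\le d$. *)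

(* Defs.v *)
From HB Require Import structures.
From mathcomp Require Import all_boot all_order all_algebra finmap finfield.
From mathcomp Require Import boolp classical_sets cardinality reals.
From mathcomp Require Import topology normedtype.

Set Implicit Arguments.
Unset Strict Implicit.
Unset Printing Implicit Defensive.

Import Order.TTheory GRing.Theory Num.Theory.
Import VectorInternalTheory.
Import numFieldNormedType.Exports.

Local Open Scope classical_set_scope.
Local Open Scope ring_scope.

(* The quotient V / W, carried by the complement W^C; quo_pi is the quotient
   map: it is onto (quo_piK) and its kernel is W (lker_quo_pi). *)
Definition quo (K : fieldType) (V : vectType K) (W : {vspace V}) : vectType K :=
  subvs_of (W^C)%VS.

Section Quotient.
Variables (K : fieldType) (V : vectType K) (W : {vspace V}).

Definition quo_repr (x : quo W) : V := vsval x.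

Definition quo_pi : 'Hom(V, quo W) :=
  linfun (@vsproj K V (W^C)%VS \o daddv_pi W^C W).

Lemma quo_piE v : quo_repr (quo_pi v) = daddv_pi W^C W v.
Proof. by rewrite lfunE /quo_repr /= vsprojK // memv_pi. Qed.

Lemma quo_piK : cancel quo_repr quo_pi.
Proof.
move=> x; apply: val_inj; rewrite [LHS]quo_piE.
by rewrite daddv_pi_id ?subvsP // capvC capv_compl.
Qed.

Lemma lker_quo_pi : lker quo_pi = W.
Proof.
have WC0 : (W^C :&: W = 0)%VS by rewrite capvC capv_compl.
have dec v : daddv_pi W^C W v + daddv_pi W W^C v = v.
  by apply: daddv_pi_add => //; rewrite addvC addv_complf memvf.
apply/vspaceP => v; rewrite memv_ker; apply/eqP/idP => [v0 | vW].
  rewrite -[v]dec -quo_piE v0 /quo_repr linear0 add0r; exact: memv_pi.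
apply: val_inj; rewrite [LHS]quo_piE linear0.
have := dec v; rewrite (daddv_pi_id (capv_compl W) vW) => /eqP.
by rewrite -subr_eq0 addrK => /eqP.
Qed.

Lemma quo_pi_eq0 v : (quo_pi v == 0) = (v \in W).
Proof. by rewrite -memv_ker lker_quo_pi. Qed.

Lemma quo_pi_eq u v : (quo_pi u == quo_pi v) = (u - v \in W).
Proof. by rewrite -subr_eq0 -linearB quo_pi_eq0. Qed.

Lemma quo_reprK v : v - quo_repr (quo_pi v) \in W.
Proof. by rewrite -quo_pi_eq quo_piK eqxx. Qed.

End Quotient.

(* The map V / W -> V' / W' induced by f; meaningful when f maps W into W'. *)
Section QuotientMap.
Variables (K : fieldType) (V V' : vectType K).
Variables (W : {vspace V}) (W' : {vspace V'}) (f : 'Hom(V, V')).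

Definition quo_map : 'Hom(quo W, quo W') :=
  (quo_pi W' \o f \o linfun (@vsval K V (W^C)%VS))%VF.

Lemma quo_mapE v : (f @: W <= W')%VS ->
  quo_map (quo_pi W v) = quo_pi W' (f v).
Proof.
move=> fW; rewrite 2!comp_lfunE.
have -> : linfun (@vsval K V (W^C)%VS) (quo_pi W v) = quo_repr (quo_pi W v).
  by rewrite lfunE.
apply/eqP; rewrite eq_sym quo_pi_eq -linearB; apply: subvP fW _ _.
by apply: memv_img; exact: quo_reprK.
Qed.

End QuotientMap.

Lemma quo_map_id (K : fieldType) (V : vectType K) (W : {vspace V}) :
  quo_map W W \1%VF = \1%VF.
Proof.
by apply/lfunP => x; rewrite -[x]quo_piK quo_mapE ?id_lfunE // lim1g subvv.
Qed.

Lemma quo_map_comp (K : fieldType) (V V' V'' : vectType K) (W : {vspace V})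
    (W' : {vspace V'}) (W'' : {vspace V''})
    (g : 'Hom(V', V'')) (f : 'Hom(V, V')) :
  (f @: W <= W')%VS -> (g @: W' <= W'')%VS ->
  (quo_map W' W'' g \o quo_map W W' f)%VF = quo_map W W'' (g \o f)%VF.
Proof.
move=> fW gW; have gfW : ((g \o f)%VF @: W <= W'')%VS.
  by rewrite limg_comp (subv_trans (limgS g fW) gW).
by apply/lfunP => x; rewrite -[x]quo_piK comp_lfunE !quo_mapE // comp_lfunE.
Qed.

Definition dsum (I : finType) (K : fieldType) (V : I -> vectType K) : Type :=
  {dffun forall i : I, V i}.

Section DirectSum.
Variables (I : finType) (K : fieldType) (V : I -> vectType K).
Local Notation S := (dsum V).
Implicit Types (x y z : S) (a b : K).

HB.instance Definition _ := Choice.on S.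

Let add x y : S := [ffun i => x i + y i].
Let opp x : S := [ffun i => - x i].
Let scale a x : S := [ffun i => a *: x i].
Let zero : S := [ffun i => 0].

Fact dsum_addA : associative add.
Proof. by move=> x y z; apply/ffunP => i; rewrite !ffunE addrA. Qed.
Fact dsum_addC : commutative add.
Proof. by move=> x y; apply/ffunP => i; rewrite !ffunE addrC. Qed.
Fact dsum_add0 : left_id zero add.
Proof. by move=> x; apply/ffunP => i; rewrite !ffunE add0r. Qed.
Fact dsum_addN : left_inverse zero opp add.
Proof. by move=> x; apply/ffunP => i; rewrite !ffunE addNr. Qed.

HB.instance Definition _ :=
  GRing.isZmodule.Build S dsum_addA dsum_addC dsum_add0 dsum_addN.

Fact dsum_scaleA a b x : scale a (scale b x) = scale (a * b) x.
Proof. by apply/ffunP => i; rewrite !ffunE scalerA. Qed.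
Fact dsum_scale1 : left_id 1 scale.
Proof. by move=> x; apply/ffunP => i; rewrite !ffunE scale1r. Qed.
Fact dsum_scaleDr : right_distributive scale +%R.
Proof. by move=> a x y; apply/ffunP => i; rewrite !ffunE scalerDr. Qed.
Fact dsum_scaleDl x : {morph scale^~ x : a b / a + b}.
Proof. by move=> a b; apply/ffunP => i; rewrite !ffunE scalerDl. Qed.

HB.instance Definition _ := GRing.Zmodule_isLmodule.Build K S
  dsum_scaleA dsum_scale1 dsum_scaleDr dsum_scaleDl.

Lemma dsum_linE a x y i : (a *: x + y) i = a *: x i + y i.
Proof. by rewrite !ffunE. Qed.

Fact dsum_vect_iso :
  Vector.axiom #|{: {i : I & 'I_(dim (V i))}}| S.
Proof.
pose T := {i : I & 'I_(dim (V i))}.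
pose to (x : S) : 'rV[K]_#|{: T}| :=
  \row_k v2r (x (tag (enum_val k))) 0 (tagged (enum_val k)).
pose from (r : 'rV[K]_#|{: T}|) : S :=
  [ffun i => r2v (\row_j r 0 (enum_rank (Tagged (fun i => 'I_(dim (V i))) j)))].
exists to.
  move=> a x y; apply/rowP => k.
  by rewrite !mxE dsum_linE linearP !mxE.
exists from => [x | r].
  apply/ffunP => i; rewrite ffunE; apply: (canLR v2rK); apply/rowP => j.
  by rewrite !mxE enum_rankK.
apply/rowP => k; rewrite !mxE ffunE r2vK mxE; congr (r 0 _).
by rewrite taggedK enum_valK.
Qed.

HB.instance Definition _ := Lmodule_hasFinDim.Build K S dsum_vect_iso.

End DirectSum.

(* The q-th exterior power of V is the quotient of the vector space with basis
   (wgen t) indexed by the q-tuples t of vectors of V (finitely many, as K is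
   finite) by the subspace spanned by the multilinearity relations and by the
   tuples with a repeated entry.  The class of wgen t is t_0 /\ ... /\ t_(q-1). *)
Section ExteriorPower.
Variables (K : finFieldType) (q : nat).
Implicit Types U V W : vectType K.

(* finvect_type V is V seen as a finite type. *)
Definition wtuple V : finType := {ffun 'I_q -> finvect_type V}.
Definition wfree V : vectType K := {ffun wtuple V -> K^o}.

Definition wgen V (t : wtuple V) : wfree V := [ffun t' => (t' == t)%:R].

Definition wset V (t : wtuple V) (i : 'I_q) (v : V) : wtuple V :=
  [ffun j => if j == i then v else t j].

Definition wlin_rel V (t : wtuple V) (i : 'I_q) (a : K) (u v : V) : wfree V :=
  wgen (wset t i (a *: u + v)) - a *: wgen (wset t i u) - wgen (wset t i v).

Definition wrel V : {vspace wfree V} :=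
  (\sum_(t : wtuple V) \sum_(i < q) \sum_(a : K)
     \sum_(u : finvect_type V) \sum_(v : finvect_type V)
       <[wlin_rel t i a u v]> +
   \sum_(t : wtuple V | ~~ injectiveb t) <[wgen t]>)%VS.

Definition ext_power V : vectType K := quo (wrel V).

Definition ext_prod V (t : 'I_q -> V) : ext_power V :=
  quo_pi (wrel V) (wgen [ffun i => t i]).

Definition wtuple_map V W (f : 'Hom(V, W)) (t : wtuple V) : wtuple W :=
  [ffun i => f (t i)].

Definition wfree_map V W (f : 'Hom(V, W)) : 'Hom(wfree V, wfree W) :=
  linfun (fun x : wfree V => \sum_t x t *: wgen (wtuple_map f t)).

Definition ext_map V W (f : 'Hom(V, W)) : 'Hom(ext_power V, ext_power W) :=
  quo_map (wrel V) (wrel W) (wfree_map f).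

Lemma wfree_mapE V W (f : 'Hom(V, W)) x :
  wfree_map f x = \sum_t x t *: wgen (wtuple_map f t).
Proof.
have lin : linear (fun x : wfree V => \sum_t x t *: wgen (wtuple_map f t)).
  move=> a u v; rewrite scaler_sumr -big_split /=; apply: eq_bigr => t _.
  by rewrite !ffunE scalerDl scalerA.
pose g : {linear wfree V -> wfree W} := HB.pack
  (fun x : wfree V => \sum_t x t *: wgen (wtuple_map f t))
  (GRing.isLinear.Build _ _ _ _ _ lin).
exact: (lfunE g).
Qed.

Lemma wfree_sum V (x : wfree V) : x = \sum_t x t *: wgen t.
Proof.
apply/ffunP => t; rewrite sum_ffunE (bigD1 t) //= !ffunE eqxx.
rewrite [X in _ + X]big1 ?addr0 => [|t' /negPf t'N].
  by rewrite [RHS]mulr1.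
by rewrite !ffunE eq_sym t'N scaler0.
Qed.

Lemma wfree_map_gen V W (f : 'Hom(V, W)) t :
  wfree_map f (wgen t) = wgen (wtuple_map f t).
Proof.
rewrite wfree_mapE (bigD1 t) //= big1 => [|t' /negPf t'N].
  by rewrite addr0 ffunE eqxx scale1r.
by rewrite ffunE t'N scale0r.
Qed.

Lemma wtuple_map_set V W (f : 'Hom(V, W)) t i v :
  wtuple_map f (wset t i v) = wset (wtuple_map f t) i (f v).
Proof. by apply/ffunP => j; rewrite !ffunE; case: ifP. Qed.

Lemma wlin_rel_in V (t : wtuple V) i a u v : wlin_rel t i a u v \in wrel V.
Proof.
apply: subvP (addvSl _ _) _ _; rewrite memvE.
apply: (sumv_sup t) => //; apply: (sumv_sup i) => //; apply: (sumv_sup a) => //.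
by apply: (sumv_sup (u : finvect_type V)) => //; apply: (sumv_sup (v : finvect_type V)).
Qed.

Lemma walt_in V (t : wtuple V) : ~~ injectiveb t -> wgen t \in wrel V.
Proof.
by move=> tN; apply: subvP (addvSr _ _) _ _; rewrite memvE; apply: (sumv_sup t).
Qed.

Lemma wfree_map_rel V W (f : 'Hom(V, W)) : (wfree_map f @: wrel V <= wrel W)%VS.
Proof.
rewrite limgD subv_add !limg_sum; apply/andP; split; apply/subv_sumP => t.
  move=> _; rewrite limg_sum; apply/subv_sumP => i _.
  rewrite limg_sum; apply/subv_sumP => a _.
  rewrite limg_sum; apply/subv_sumP => u _.
  rewrite limg_sum; apply/subv_sumP => v _.
  rewrite limg_line -memvE !linearB linearZ /= !wfree_map_gen !wtuple_map_set.
  by rewrite linearP; apply: wlin_rel_in.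
move=> tN; rewrite limg_line -memvE wfree_map_gen; apply: walt_in.
apply: contra tN => /injectiveP fI; apply/injectiveP => i j tij.
by apply: fI; rewrite !ffunE tij.
Qed.

Lemma ext_map_pi V W (f : 'Hom(V, W)) x :
  ext_map f (quo_pi (wrel V) x) = quo_pi (wrel W) (wfree_map f x).
Proof. exact/quo_mapE/wfree_map_rel. Qed.

Lemma ext_map_prod V W (f : 'Hom(V, W)) t :
  ext_map f (ext_prod t) = ext_prod (f \o t).
Proof.
rewrite ext_map_pi wfree_map_gen; congr (quo_pi (wrel W) (wgen _)).
by apply/ffunP => i; rewrite !ffunE.
Qed.

Lemma ext_map_id V : ext_map \1%VF = \1%VF :> 'End(ext_power V).
Proof.
apply/lfunP => x; rewrite -[x]quo_piK ext_map_pi id_lfunE.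
congr (quo_pi (wrel V) _).
rewrite wfree_mapE [RHS]wfree_sum; apply: eq_bigr => t _.
by congr (_ *: wgen _); apply/ffunP => i; rewrite ffunE id_lfunE.
Qed.

Lemma ext_map_comp U V W (g : 'Hom(V, W)) (f : 'Hom(U, V)) :
  (ext_map g \o ext_map f = ext_map (g \o f))%VF.
Proof.
apply/lfunP => x; rewrite -[x]quo_piK comp_lfunE !ext_map_pi.
congr (quo_pi (wrel W) _); rewrite [quo_repr x]wfree_sum !linear_sum.
apply: eq_bigr => t _; rewrite !linearZ /= !wfree_map_gen; congr (_ *: wgen _).
by apply/ffunP => i; rewrite !ffunE comp_lfunE.
Qed.

End ExteriorPower.

(* face s t means that s is a face of t; corestr s t is the structure map from
   the stalk at s to the stalk at t, and is only meaningful if face s t. *)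
Record cosheaf (I : finType) (face : rel I) := Cosheaf {
  stalk : I -> vectType 'F_2;
  corestr : forall s t, 'Hom(stalk s, stalk t);
  corestr_id : forall s, corestr s s = \1%VF;
  corestr_comp : forall s t u, face s t -> face t u ->
    (corestr t u \o corestr s t)%VF = corestr s u
}.

Section ExteriorCosheaf.
Variables (I : finType) (face : rel I) (q : nat) (F : cosheaf face).

Fact ext_corestr_id s : ext_map q (corestr F s s) = \1%VF.
Proof. by rewrite corestr_id ext_map_id. Qed.

Fact ext_corestr_comp s t u : face s t -> face t u ->
  (ext_map q (corestr F t u) \o ext_map q (corestr F s t))%VF =
  ext_map q (corestr F s u).
Proof. by move=> st tu; rewrite ext_map_comp corestr_comp. Qed.

Definition ext_cosheaf : cosheaf face :=
  Cosheaf ext_corestr_id ext_corestr_comp.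

End ExteriorCosheaf.

Section Homology.
Variables (I : finType) (face : rel I) (cdim : I -> nat) (d : nat).
Variable F : cosheaf face.

Definition cells (p : nat) : finType := {s : I | (cdim s + p == d)%N}.

Definition chains (p : nat) : vectType 'F_2 :=
  dsum (fun s : cells p => stalk F (val s)).

Definition bd_fun p p' (x : chains p) : chains p' :=
  [ffun t : cells p' =>
    \sum_(s : cells p | face (val s) (val t) && (cdim (val t) == (cdim (val s)).+1))
      corestr F (val s) (val t) (x s)].

(* For p = 0 the predecessor is 0 and no pair of cells satisfies the condition
   on dimensions in bd_fun: the boundary vanishes on chains 0 (bd0). *)
Definition bd p : 'Hom(chains p, chains p.-1) := linfun (@bd_fun p p.-1).

Fact bd_fun_linear p p' : linear (@bd_fun p p').
Proof.
move=> a x y; apply/ffunP => t; rewrite dsum_linE !ffunE scaler_sumr.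
by rewrite -big_split /=; apply: eq_bigr => s _; rewrite dsum_linE linearP.
Qed.

HB.instance Definition _ p p' :=
  GRing.isLinear.Build _ _ _ _ (@bd_fun p p') (@bd_fun_linear p p').

Lemma bdE p x : bd p x = bd_fun p.-1 x.
Proof. by rewrite lfunE. Qed.

Lemma bd0 : bd 0 = 0.
Proof.
apply/lfunP => x; rewrite bdE lfunE; apply/ffunP => t; rewrite !ffunE big1 //.
move=> s /andP[_ /eqP ts]; exfalso.
have := eqP (valP t); have := eqP (valP s); rewrite ts !addn0 => -> /eqP.
by rewrite eqn_leq ltnn.
Qed.

Definition cycles p : {vspace chains p} := lker (bd p).
Definition boundaries p : {vspace chains p} := limg (bd p.+1).

Definition homology p : vectType 'F_2 :=
  quo (linfun (@vsval _ _ (cycles p)) @^-1: boundaries p)%VS.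

End Homology.

(* Bases are chosen so that N = Z^d and M = Hom(N, Z) = Z^d, the pairing being
   the dot product: 'rV[int]_d is either lattice, 'rV[R]_d either real space
   and 'rV['F_2]_d either N/2N or M/2M. *)
Section Polytopes.
Variables (R : realType) (d : nat).
Local Notation E := 'rV[R]_d.
Local Notation L := 'rV[int]_d.
Implicit Types (P F C S : set E) (x y u m n : E).

Definition pairing m n : R := \sum_i m 0 i * n 0 i.

Definition lat (v : L) : E := map_mx intr v.
Definition mod2 (v : L) : 'rV['F_2]_d := map_mx intr v.

Definition conv_hull (s : seq E) : set E :=
  [set x | exists a : 'I_(size s) -> R,
    [/\ forall i, 0 <= a i, \sum_i a i = 1 & x = \sum_i a i *: s`_i]].

Definition lattice_polytope P := exists s : seq L, P = conv_hull (map lat s).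

Definition polar P : set E := [set n | forall m, P m -> -1 <= pairing m n].

(* lspanP below shows that such a subspace exists, so that the default value in
   lspan is never used. *)
Definition is_lspan S (W : {vspace E}) :=
  (forall x, S x -> x \in W) /\
  (forall W' : {vspace E}, (forall x, S x -> x \in W') -> (W <= W')%VS).

Definition lspan S : {vspace E} := xget 0%VS (is_lspan S).

(* aff_dim F is the dimension of the affine span of F, for F nonempty. *)
Definition aff_dim F : nat := \dim (lspan [set z | exists x y,
  [/\ F x, F y & z = x - y]]).

Definition reflexive_polytope P :=
  [/\ lattice_polytope P, aff_dim P = d, interior P 0
    & lattice_polytope (polar P)].

(* F is a face of the polytope or polyhedral cone P; this includes P itself and
   the empty set. *)
Definition is_face P F := exists (u : E) (c : R),
  (forall x, P x -> c <= pairing x u) /\ F = P `&` [set x | pairing x u = c].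

Definition f_number P (p : nat) : nat :=
  #|` fset_set [set F | [/\ is_face P F, F !=set0 & aff_dim F = p]]|.

Definition h_poly P : {poly int} :=
  \sum_(p < d.+1) (f_number P p)%:R *: ('X - 1) ^+ p.

Definition h_number P (q : nat) : int := (h_poly P)`_q.

Definition cone_over F : set E :=
  [set z | exists (c : R) (x : E), [/\ 0 <= c, F x & z = c *: x]].

Definition face_fan P : set (set E) :=
  [set C | C = [set 0] \/
    exists F, [/\ is_face P F, F !=set0, F <> P & C = cone_over F]].

(* The linear forms n on M that attain their minimum over P at every point of F. *)
Definition normal_cone P F : set E :=
  [set n | forall m m', F m -> P m' -> pairing m n <= pairing m' n].

Definition normal_fan P : set (set E) :=
  [set C | exists F, [/\ is_face P F, F !=set0 & C = normal_cone P F]].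

Definition cone_dim C : nat := \dim (lspan C).

Definition primitive_vector (v : L) :=
  v != 0 /\ forall (w : L) (k : nat), v = w *+ k -> k = 1%N.

Definition primitive_generator C (v : L) :=
  primitive_vector v /\ C = cone_over [set lat v].

Definition ray_generator C (v : L) := exists rho,
  [/\ is_face C rho, cone_dim rho = 1%N & primitive_generator rho v].

Definition span2 (T : set L) : {vspace 'rV['F_2]_d} :=
  (\sum_(w : 'rV['F_2]_d | `[< exists2 v, T v & w = mod2 v >]) <[w]>)%VS.

(* The image of the lattice points of the linear span of C (lat2P).  It is
   isomorphic to their group modulo 2, as this group is saturated. *)
Definition lat2 C : {vspace 'rV['F_2]_d} := span2 [set v | lat v \in lspan C].

(* The sequence g lists the primitive generators without repetition, so that
   two of them with the same image are not independent. *)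
Definition Z2_regular C := exists g : seq L,
  [/\ uniq g, forall v, v \in g <-> ray_generator C v
    & basis_of (lat2 C) (map mod2 g)].

Definition ray_rank (Sigma : set (set E)) : nat :=
  \dim (span2 [set v | exists rho,
    [/\ Sigma rho, cone_dim rho = 1%N & primitive_generator rho v]]).

Lemma lspanP S : is_lspan S (lspan S).
Proof.
apply: xgetPex.
pose Q k := `[< exists s : seq E, (forall x, x \in s -> S x) /\ \dim <<s>> = k >].
have Q0 : exists k, Q k by exists 0%N; apply/asboolP; exists [::]; rewrite span_nil dimv0.
have Qd k : Q k -> (k <= \dim {: E})%N.
  by move=> /asboolP[s [_ <-]]; rewrite dimvS ?subvf.
have [k /asboolP[s [sS sk]] kmax] := ex_maxnP Q0 Qd.
exists <<s>>%VS; split => [x Sx | W' SW']; last first.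
  by apply/span_subvP => x /sS; apply: SW'.
have sx : (<<s>> <= <<x :: s>>)%VS by rewrite span_cons addvSr.
have : (<<x :: s>> <= <<s>>)%VS.
  rewrite -(geq_leqif (dimv_leqif_sup sx)) sk; apply: kmax; apply/asboolP.
  by exists (x :: s); split=> // y; rewrite inE => /predU1P[-> | /sS].
by move/subvP; apply; rewrite memv_span ?mem_head.
Qed.

Lemma lspanS S S' : S `<=` S' -> (lspan S <= lspan S')%VS.
Proof.
by move=> SS'; apply: (lspanP S).2 => x /SS'; apply: (lspanP S').1.
Qed.

Lemma span2S (T T' : set L) : T `<=` T' -> (span2 T <= span2 T')%VS.
Proof.
move=> TT'; apply/subv_sumP => w /asboolP[v Tv wv].
by apply: (sumv_sup w) => //; apply/asboolP; exists v; first exact: TT'.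
Qed.

Lemma lat2S C C' : C `<=` C' -> (lat2 C <= lat2 C')%VS.
Proof. by move=> CC'; apply: span2S => v /(subvP (lspanS CC')). Qed.

Lemma mod2D v w : mod2 (v + w) = mod2 v + mod2 w.
Proof. exact: map_mxD. Qed.

Lemma lat2P C w : w \in lat2 C <-> exists2 v, lat v \in lspan C & w = mod2 v.
Proof.
split=> [|[v vC wv]]; last first.
  rewrite memvE; apply: (sumv_sup w) => //.
  by apply/asboolP; exists v.
move/memv_sumP => [ws wsP ->].
elim/big_rec: _ => [|w' z w'P [v vC ->]].
  exists 0; last by rewrite /mod2 map_mx0.
  by rewrite /lat map_mx0 mem0v.
have /vlineP[a ->] := wsP _ w'P; have /asboolP[v' v'C ->] := w'P.
have a01 : a = (a : nat)%:R :> 'F_2 by rewrite natr_Zp.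
exists (v' *+ (a : nat) + v); last first.
  by rewrite mod2D a01 scaler_nat /mod2 raddfMn /= natr_Zp.
by rewrite /lat map_mxD raddfMn memvD ?rpredMn.
Qed.

End Polytopes.

Section Hodge.
Variables (R : realType) (d : nat) (Sigma : {fset set 'rV[R]_d}).

Definition fan_face : rel Sigma := fun s t => `[< is_face (val t) (val s) >].

Definition fan_dim (s : Sigma) : nat := cone_dim (val s).

Definition E_stalk (s : Sigma) : vectType 'F_2 := quo (lat2 (val s)).

Definition E_map (s t : Sigma) : 'Hom(E_stalk s, E_stalk t) :=
  quo_map (lat2 (val s)) (lat2 (val t)) \1%VF.

Fact fan_face_lat2 s t : fan_face s t -> (lat2 (val s) <= lat2 (val t))%VS.
Proof. by move=> /asboolP[u [c [_ ->]]]; apply: lat2S; apply: subIsetl. Qed.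

Fact E_map_id s : E_map s s = \1%VF.
Proof. exact: quo_map_id. Qed.

Fact E_map_comp s t u : fan_face s t -> fan_face t u ->
  (E_map t u \o E_map s t)%VF = E_map s u.
Proof.
move=> /fan_face_lat2 st /fan_face_lat2 tu.
by rewrite /E_map quo_map_comp ?lim1g // comp_lfun1l.
Qed.

Definition E_cosheaf : cosheaf fan_face := Cosheaf E_map_id E_map_comp.

Definition hodge_space (p q : nat) : vectType 'F_2 :=
  homology fan_dim d (ext_cosheaf q E_cosheaf) p.

End Hodge.

(* The fan of a polytope is finite, so that fset_set does not alter it. *)
Definition hodge_rank (R : realType) (d : nat) (Sigma : set (set 'rV[R]_d))
  (p q : nat) : nat := dim (hodge_space (fset_set Sigma) p q).

(* Main.v *)
(* A proper face F of Delta is, by regularity, a simplex whose vertex set S has independent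
   classes in M/2M.  Hence N(sigma_F) is F_2^S modulo the all-one vector, and its q-th exterior
   power is the space of functions on the q-subsets of S modulo the image of the simplicial
   coboundary dA of the full simplex on S.  Thus, below degree d - 1, the complex of the exterior
   powers is the quotient by dA of the complex of functions x(A, S), A contained in S, whose
   boundary dS removes from S a point outside A.  For fixed A this is the augmented chain
   complex of the link of A in the boundary of Delta, and it is exact below the top degree:
   a generic linear form orders the facets so that the faces S whose minimal facet is fac j are
   those of an interval [Rs j, fac j] (a line shelling), which is contractible unless it is a
   point.  A zigzag between dS and dA now identifies H_{pq} with H_{p-1,q-1} and reduces (i)
   to q = 0.
   In degree d, an element of the exterior power of N/2N dies in all the stalks at rays iff it is
   divisible by the classes of all the ray generators, which gives (ii); (iii) is the Euler
   characteristic of the complex, the vanishing of bd o bd in degree d being the fact that a ridge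
   lies in exactly two facets. *)

From HB Require Import structures.
Require Import Defs.
From mathcomp Require Import all_boot all_order all_algebra all_fingroup finmap finfield.
From mathcomp Require Import boolp classical_sets cardinality reals topology normedtype.
From mathcomp Require Import ring lra zify fintype finset.

Set Implicit Arguments.
Unset Strict Implicit.
Unset Printing Implicit Defensive.

Import Order.TTheory GRing.Theory Num.Theory.
Import numFieldNormedType.Exports.
Local Open Scope ring_scope.

(** * Pairs of faces and shellings *)

(** The zero cone is normal to Delta itself, which is not a simplex, so the model by functions x(A,
    S) stops at degree d - 1 and the boundary out of degree d has to be treated by itself.
    Reflexivity enters through the vertices of the polar polytope. They are lattice points with
    value -1 on a facet, so a vertex of Delta pairs to -1 with an integral vector and is primitive.
    It is therefore a ray generator of the face fan, and only then does regularity make the vertices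
    of a facet independent mod 2. Independence lifts to R, whence exactly d vertices on each facet.
    The zigzag lowers |A| and |S| together. For p = q it descends to S empty, where the coboundary
    dA is not exact. The obstruction is the sum of all coefficients: in the sum of dS x or of dA x,
    each x(A, S) is weighted by |S \ A|. Hence both maps preserve the sum of functions on pairs with
    |S \ A| = 1 and kill it when |S \ A| = 2. This sum is the functional that makes H_{qq} of rank
    1. *)

Lemma addvv2 (V : lmodType 'F_2) (x : V) : x + x = 0.
Proof.
have e2 : (1 + 1 : 'F_2) = 0 by apply/val_inj.
by rewrite -[x]scale1r -scalerDl e2 scale0r.
Qed.

Lemma addff2 (x : 'F_2) : x + x = 0.
Proof. exact: (@addvv2 ('F_2)^o). Qed.

Lemma oppvv2 (V : lmodType 'F_2) (x : V) : - x = x.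
Proof. by apply/eqP; rewrite eq_sym -addr_eq0 addvv2. Qed.

Lemma oppff2 (x : 'F_2) : - x = x.
Proof. exact: (@oppvv2 ('F_2)^o). Qed.

Lemma eq1f2 (x : 'F_2) : x != 0 -> x = 1.
Proof. by case: x => [[|[|n]] //= ltn] _; apply/val_inj. Qed.

Lemma even_natf2 n : ~~ odd n -> n%:R = 0 :> 'F_2.
Proof.
rewrite -dvdn2 => /dvdnP[m ->]; rewrite natrM mulr_natr.
by rewrite mulr2n addff2.
Qed.

(** The terms at (v, w) and (w, v) cancel in characteristic 2; both [dSS] and [dAA] reduce to
    this. *)
Lemma sum_sym_diff2 (V : lmodType 'F_2) (T : finType) (P : pred T) (f : T -> T -> V) :
  (forall v w, f v w = f w v) ->
  \sum_(v | P v) \sum_(w | P w && (w != v)) f v w = 0.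
Proof.
move=> fC.
have split2 : \sum_(v | P v) \sum_(w | P w && (w != v)) f v w =
  \sum_(v | P v) \sum_(w | P w && (enum_rank w < enum_rank v)%N) f v w +
  \sum_(v | P v) \sum_(w | P w && (enum_rank v < enum_rank w)%N) f v w.
  rewrite -big_split /=; apply: eq_bigr => v _.
  rewrite (bigID (fun w => (enum_rank w < enum_rank v)%N)) /=.
  congr (_ + _); apply: eq_bigl => w.
    rewrite -andbA; congr (_ && _); apply/andP/idP => [[] //|wv]; split=> //.
    by apply: contraTneq wv => ->; rewrite ltnn.
  rewrite -andbA; congr (_ && _); rewrite -leqNgt ltn_neqAle eq_sym.
  congr (~~ _ && _).
  by apply/eqP/eqP => [->|/val_inj/enum_rank_inj ->].
rewrite split2 (exchange_big_dep P) /=; last by move=> ? ? _ /andP[].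
set a := (X in X + _); set b := (X in _ + X).
suff -> : a = b by rewrite addvv2.
rewrite /a /b; apply: eq_bigr => w Pw; apply: eq_big => [v|v _]; last by rewrite fC.
by rewrite Pw.
Qed.

Section Pairs.
Variables (T : finType) (K : {set {set T}}).
Hypothesis K_sub : forall S S' : {set T}, S \in K -> S' \subset S -> S' \in K.

(* x A S is the coefficient of the q-subset A of the vertex set S of a simplex: dS is the
   simplicial boundary, which may remove from S only a point outside A, and dA is the
   coboundary in A. *)
Definition chainfun := {set T} -> {set T} -> 'F_2.
Implicit Types (x y : chainfun) (A S : {set T}).

(* The index a is #|A|.+1, so that psupp k 0 contains only 0. *)
Definition psupp k a x := forall A S, x A S != 0 ->
  [/\ A \subset S, S \in K, #|S| = k & (#|A|.+1 = a)%N].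

Definition dS x : chainfun := fun A S =>
  if A \subset S then \sum_(v | v \notin S) x A (v |: S) else 0.
Definition dA x : chainfun := fun A S =>
  if A \subset S then \sum_(a in A) x (A :\ a) S else 0.

Definition ceq x y := forall A S, x A S = y A S.
Definition cadd x y : chainfun := fun A S => x A S + y A S.

Lemma psupp0 k a x A S : psupp k a x ->
  ~~ [&& A \subset S, S \in K, #|S| == k & #|A|.+1 == a] -> x A S = 0.
Proof.
move=> sx; apply: contraNeq => /sx[-> -> -> ->]; rewrite !eqxx //.
Qed.

Lemma psupp_dS k a x : psupp k.+1 a x -> psupp k a (dS x).
Proof.
move=> sx A S; rewrite /dS; case: ifP => [AS|_]; last by rewrite eqxx.
have [/existsP[v /andP[vS nz]] _|/existsPn no] :=
  boolP [exists v, (v \notin S) && (x A (v |: S) != 0)]; last first.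
  rewrite big1 ?eqxx // => v vS; apply/eqP; move: (no v).
  by rewrite vS /= negbK.
have [_ SK + ->] := sx _ _ nz.
rewrite cardsU1 vS => -[<-]; split=> //; apply: K_sub SK _; exact: subsetUr.
Qed.

Lemma psupp_dA k a x : psupp k a x -> psupp k a.+1 (dA x).
Proof.
move=> sx A S; rewrite /dA; case: ifP => [AS|_]; last by rewrite eqxx.
have [/existsP[v /andP[vA nz]] _|/existsPn no] :=
  boolP [exists v, (v \in A) && (x (A :\ v) S != 0)]; last first.
  rewrite big1 ?eqxx // => v vA; apply/eqP; move: (no v).
  by rewrite vA /= negbK.
have [_ SK Sk <-] := sx _ _ nz.
by split=> //; rewrite [in LHS](cardsD1 v) vA.
Qed.

Lemma psuppD k a x y : psupp k a x -> psupp k a y -> psupp k a (cadd x y).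
Proof.
move=> sx sy A S; rewrite /cadd; have [->|nz _] := eqVneq (x A S) 0; last exact: sx.
by rewrite add0r; exact: sy.
Qed.

Lemma dSD x y : ceq (dS (cadd x y)) (cadd (dS x) (dS y)).
Proof.
move=> A S; rewrite /dS /cadd; case: ifP; rewrite ?addr0 // => _.
by rewrite big_split.
Qed.

Lemma dAD x y : ceq (dA (cadd x y)) (cadd (dA x) (dA y)).
Proof.
move=> A S; rewrite /dA /cadd; case: ifP; rewrite ?addr0 // => _.
by rewrite big_split.
Qed.

Lemma eq_dS x y : ceq x y -> ceq (dS x) (dS y).
Proof. by move=> xy A S; rewrite /dS; case: ifP => // _; apply: eq_bigr. Qed.

Lemma eq_dA x y : ceq x y -> ceq (dA x) (dA y).
Proof. by move=> xy A S; rewrite /dA; case: ifP => // _; apply: eq_bigr. Qed.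

Lemma dSS x : ceq (dS (dS x)) (fun _ _ => 0).
Proof.
move=> A S; rewrite /dS; case: ifP => // AS.
rewrite -[RHS](@sum_sym_diff2 ('F_2)^o T (fun v => v \notin S)
  (fun v w => x A (w |: (v |: S)))); last by move=> v w; rewrite setUCA.
apply: eq_bigr => v vS; rewrite (subset_trans AS (subsetUr _ _)).
by apply: eq_bigl => w; rewrite !inE negb_or andbC.
Qed.

Lemma dAA x : ceq (dA (dA x)) (fun _ _ => 0).
Proof.
move=> A S; rewrite /dA; case: ifP => // AS.
rewrite -[RHS](@sum_sym_diff2 ('F_2)^o T (mem A)
  (fun v w => x (A :\ v :\ w) S)); last first.
  by move=> v w; rewrite !setDDl setUC.
apply: eq_bigr => v vS; rewrite (subset_trans (subsetDl _ _) AS).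
by apply: eq_bigl => w; rewrite !inE andbC.
Qed.

Lemma dSA x : ceq (dS (dA x)) (dA (dS x)).
Proof.
move=> A S; rewrite /dS /dA; case: ifP => // AS.
under eq_bigr => v vS do rewrite (subset_trans AS (subsetUr _ _)).
rewrite exchange_big /=; apply: eq_bigr => a aA.
by rewrite (subset_trans (subsetDl _ _) AS).
Qed.

Lemma dA_eq0 x : ceq x (fun _ _ => 0) -> ceq (dA x) (fun _ _ => 0).
Proof. by move=> x0 A S; rewrite /dA; case: ifP => // _; rewrite big1. Qed.

(* A contracting homotopy for dA, by contraction with a base point c S of S. *)
Definition hA (c : {set T} -> option T) x : chainfun := fun A S =>
  if c S is Some a then (if (a \in S) && (a \notin A) then x (a |: A) S else 0) else 0.

Lemma psupp_hA c k a x : psupp k a.+1 x -> psupp k a (hA c x).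
Proof.
move=> sx A S; rewrite /hA; case: (c S) => [b|]; last by rewrite eqxx.
case: ifP => [/andP[bS bA]|]; last by rewrite eqxx.
case/sx => [AS SK Sk]; rewrite cardsU1 bA => -[<-]; split=> //.
exact: subset_trans (subsetUr _ _) AS.
Qed.

(** Cone homotopy with apex [a]. If [a] lies in [A], only the summand at [a] of the first term
    survives; otherwise the summands at the elements of [A] cancel between the two terms. *)
Lemma hA_dA c x A S a : c S = Some a -> a \in S -> A \subset S ->
  x A S = cadd (dA (hA c x)) (hA c (dA x)) A S.
Proof.
move=> cS aS AS; rewrite /cadd /dA /hA AS cS aS /=.
have [aA|aA] := boolP (a \in A); rewrite /=.
  rewrite addr0 (bigD1 a) //= !inE eqxx /= setD1K // big1 ?addr0 // => b /andP[bA ba].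
  by rewrite !inE aA eq_sym (negPf ba).
rewrite subUset sub1set aS AS /= big_setU1 //= setU1K // addrCA -big_split /=.
rewrite big1 ?addr0 // => b bA; have ba : a != b by apply: contraNneq aA => ->.
rewrite !inE (negPf aA) andbF /=.
suff -> : (a |: A) :\ b = a |: A :\ b by rewrite addff2.
by apply/setP => e; rewrite !inE; case: eqVneq => // ->; rewrite eq_sym (negPf ba) orbF.
Qed.

(** The size [k.+1] keeps [S] nonempty, so that a base point exists; on the empty [S] the pair of
    empty sets carries a class. *)
Lemma dA_exact k a x : psupp k.+1 a.+1 x -> ceq (dA x) (fun _ _ => 0) ->
  exists2 y, psupp k.+1 a y & ceq x (dA y).
Proof.
move=> sx dx0; pose c (S : {set T}) := [pick b in S].
exists (hA c x); first exact: psupp_hA.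
move=> A S; have [AS|nAS] := boolP (A \subset S); last first.
  rewrite /dA (negPf nAS); apply/eqP; apply: contraNT nAS => /sx[] //.
have cP : if c S is Some b then b \in S else #|S| = 0%N.
  by rewrite /c; case: pickP => [b //|/eq_card0].
case cS: (c S) cP => [b|] => [bS|S0]; last first.
  rewrite (psupp0 sx); last by rewrite S0 !andbF.
  rewrite /dA AS big1 // => b; move=> /(subsetP AS) bS.
  by move: S0; rewrite (cardD1 b) bS.
rewrite [LHS](@hA_dA c x A S b) //.
rewrite /cadd [X in _ + X](_ : _ = 0) ?addr0 // /hA cS.
by case: ifP.
Qed.

(** Double counting: [x A S] is reached once for each vertex of [S] outside [A]. With [total_dA]
    this lets the sum of all coefficients be carried along the zigzag, and lets it detect the class
    in degree p = q. *)
Lemma total_dS x : (forall A S, x A S != 0 -> A \subset S) ->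
  \sum_A \sum_S dS x A S = \sum_A \sum_S #|S :\: A|%:R * x A S.
Proof.
move=> sx; apply: eq_bigr => A _.
rewrite /dS -big_mkcond /= (exchange_big_dep predT) //=.
transitivity (\sum_(v : T) \sum_(S | v \in S :\: A) x A S).
  apply: eq_bigr => v _.
  have [vA|vA] := boolP (v \in A).
    rewrite big1; first by rewrite big1 // => S; rewrite inE vA.
    by move=> S /andP[AS]; rewrite (subsetP AS).
  rewrite (reindex_onto (fun S => S :\ v) (fun S => v |: S)) /=; last first.
    by move=> S /andP[_ vS]; rewrite setU1K.
  rewrite [LHS]big_mkcond [RHS]big_mkcond /=; apply: eq_bigr => S _; rewrite !inE eqxx vA /=.
  have [vS|vS] := boolP (v \in S).
    rewrite setD1K // eqxx !andbT subsetD1 vA andbT; case: ifP => // AS.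
    by apply/esym/eqP; apply: contraFT AS => /sx.
  case: ifP => // /andP[_ /eqP e]; by rewrite -e !inE eqxx in vS.
rewrite (exchange_big_dep predT) //=; apply: eq_bigr => S _.
by rewrite big_const iter_addr addr0 mulr_natl.
Qed.

Lemma total_dA x : (forall A S, x A S != 0 -> A \subset S) ->
  \sum_A \sum_S dA x A S = \sum_A \sum_S #|S :\: A|%:R * x A S.
Proof.
move=> sx; rewrite exchange_big [RHS]exchange_big /=; apply: eq_bigr => S _.
rewrite /dA -big_mkcond /= (exchange_big_dep predT) //=.
transitivity (\sum_(v : T) \sum_(A | v \in S :\: A) x A S).
  apply: eq_bigr => v _.
  have [vS|vS] := boolP (v \in S); last first.
    rewrite big1; first by rewrite big1 // => A; rewrite inE (negPf vS) andbF.
    by move=> A /andP[AS] /(subsetP AS); rewrite (negPf vS).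
  rewrite (reindex_onto (fun A => v |: A) (fun A => A :\ v)) /=; last first.
    by move=> A /andP[_ vA]; rewrite setD1K.
  rewrite [LHS]big_mkcond [RHS]big_mkcond /=; apply: eq_bigr => A _.
  rewrite !inE eqxx vS /= !andbT.
  have [vA|vA] := boolP (v \in A).
    case: ifP => // /andP[_ /eqP e]; by rewrite -e !inE eqxx in vA.
  rewrite setU1K // eqxx andbT subUset sub1set vS /=; case: ifP => // AS.
  by apply/esym/eqP; apply: contraFT AS => /sx.
rewrite (exchange_big_dep predT) //=; apply: eq_bigr => A _.
by rewrite big_const iter_addr addr0 mulr_natl.
Qed.


(** * Exactness of links from a shelling, and the zigzag *)

Section Shelling.
(* The faces S with blk S = j form the interval [Rs j, fac j]. *)
Variables (d : nat) (J : finType) (fac Rs : J -> {set T}) (rk : J -> nat).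
Variable blk : {set T} -> J.
Hypothesis rk_inj : injective rk.
Hypothesis card_fac : forall j, #|fac j| = d.
Hypothesis KE : forall S, (S \in K) = [exists j, S \subset fac j].
Hypothesis blkP : forall S j, S \in K ->
  (blk S == j) = (Rs j \subset S) && (S \subset fac j).
Hypothesis rk_blk : forall S S' : {set T}, S \in K -> S' \subset S ->
  (rk (blk S') <= rk (blk S))%N.

Definition ssupp A k (x : {set T} -> 'F_2) := forall S, x S != 0 ->
  [/\ A \subset S, S \in K & #|S| = k].

(** The part of [dS] at a fixed [A]: the augmented boundary of the link of [A], with [S] standing
    for the simplex S \ A. *)
Definition dstar A (x : {set T} -> 'F_2) S :=
  if A \subset S then \sum_(v | v \notin S) x (v |: S) else 0.

Lemma dstar_dstar A (x : {set T} -> 'F_2) S : dstar A (dstar A x) S = 0.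
Proof. exact: (dSS (fun _ => x) A S). Qed.

Lemma ssupp_dstar A k (x : {set T} -> 'F_2) : ssupp A k.+1 x -> ssupp A k (dstar A x).
Proof.
move=> sx S nz.
pose y : chainfun := fun A' => if A' == A then x else fun _ => 0.
have sy : psupp k.+1 #|A|.+1 y.
  move=> A' S'; rewrite /y; case: (A' =P A) => [-> nzS|_]; last by rewrite eqxx.
  by have [? ? ?] := sx _ nzS; split.
by have [|? ? ? _] := @psupp_dS k _ y sy A S; first by rewrite /dS /y eqxx.
Qed.

(** Induction on the ranks of the blocks met by the support. Adding or removing a vertex [c] of
    [fac j] outside [Rs j] preserves the interval of block [j], so a cone with apex [c] clears the
    top block at the cost of blocks of lower rank. *)
Lemma shelling_exact_rk m A k (x : {set T} -> 'F_2) : (k < d)%N -> ssupp A k x ->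
  (forall S, x S != 0 -> (rk (blk S) < m)%N) ->
  (forall S, dstar A x S = 0) ->
  exists2 z, ssupp A k.+1 z & forall S, x S = dstar A z S.
Proof.
move=> kd; elim: m x => [|m IH] x sx xm x0.
  exists (fun _ => 0); first by move=> S; rewrite eqxx.
  move=> S; rewrite /dstar; have /eqP -> : x S == 0 by apply: contraT => /xm.
  by case: ifP => // _; rewrite big1.
have [/existsP[S0 /andP[nz0 /eqP rk0]]|/existsPn no] :=
  boolP [exists S, (x S != 0) && (rk (blk S) == m)]; last first.
  apply: IH => // S nz; have := xm S nz; rewrite ltnS leq_eqVlt => /orP[/eqP e|//].
  by have := no S; rewrite nz e eqxx.
have [AS0 S0K S0k] := sx _ nz0; set j := blk S0 in rk0.
have := blkP j S0K; rewrite eqxx => /esym /andP[RS0 S0j].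
(* Since |S0| = k < d, the facet has a vertex outside [S0]; it is outside [Rs j] and [A] as well,
   both being contained in [S0]. *)
have [c cj cS0] : exists2 c, c \in fac j & c \notin S0.
  apply/subsetPn; apply: contraTN kd => /subset_leq_card.
  by rewrite card_fac S0k leqNgt.
have cR : c \notin Rs j by apply: contra cS0; apply: subsetP.
have cA : c \notin A by apply: contra cS0; apply: subsetP.
(* The cone with apex [c] over the part of [x] in block [j]. *)
pose z1 S := if [&& c \in S, S :\ c \in K & blk (S :\ c) == j] then x (S :\ c) else 0.
have z1P S : z1 S != 0 -> [/\ c \in S, Rs j \subset S, S \subset fac j & x (S :\ c) != 0].
  rewrite /z1; case: ifP => [/and3P[cS SK]|_]; last by rewrite eqxx.
  rewrite blkP // => /andP[RS Sj] nz; split=> //.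
    exact: subset_trans RS (subsetDl _ _).
  by rewrite -(setD1K cS) subUset sub1set cj.
have sz1 : ssupp A k.+1 z1.
  move=> S /z1P[cS RS Sj /sx[AS _ <-]]; split.
  - exact: subset_trans AS (subsetDl _ _).
  - by rewrite KE; apply/existsP; exists j.
  - by rewrite [LHS](cardsD1 c) cS.
have rk1 S : z1 S != 0 -> blk S = j.
  move=> /z1P[cS RS Sj _]; apply/eqP; rewrite blkP ?RS //.
  by rewrite KE; apply/existsP; exists j.
pose x' S := x S + dstar A z1 S.
have sdz := ssupp_dstar sz1.
have sx' : ssupp A k x'.
  move=> S; rewrite /x'; have [->|nz _] := eqVneq (x S) 0; last exact: sx.
  by rewrite add0r => /sdz.
have jm S : S \in K -> S \subset fac j -> Rs j \subset S -> blk S = j.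
  by move=> SK Sj RS; apply/eqP; rewrite blkP // RS.
have [z sz zE] : exists2 z, ssupp A k.+1 z & forall S, x' S = dstar A z S.
  apply: IH => //; last first.
    move=> S; have := dSD (fun _ => x) (fun _ => dstar A z1) A S.
    rewrite [cadd (dS _) _ _ _](_ : _ = dstar A x S + dstar A (dstar A z1) S) //.
    by rewrite x0 add0r dstar_dstar.
  move=> S; rewrite /x' => nz.
  have [AS SK Sk] := sx' _ nz.
  have le : (rk (blk S) <= m)%N.
    have [x0S|] := eqVneq (x S) 0; last by move/xm.
    move: nz; rewrite x0S add0r /dstar AS => nz.
    have [/existsP[v /andP[vS /[dup] /rk1 e nzv]]|/existsPn h] :=
      boolP [exists v, (v \notin S) && (z1 (v |: S) != 0)].
      rewrite -rk0 -/j -e; apply: rk_blk; last exact: subsetUr.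
      by have [] := sz1 _ nzv.
    case/eqP: nz; apply: big1 => v vS; have := h v.
    by rewrite vS /= negbK => /eqP.
  rewrite ltn_neqAle le andbT; apply: contraNneq nz => e.
  have bS : blk S = j by apply: rk_inj; rewrite e.
  have := blkP j SK; rewrite bS eqxx => /esym/andP[RS Sj].
  rewrite /dstar AS; have [cS|cS] := boolP (c \in S); last first.
    rewrite (bigD1 c) //= big1 => [|v /andP[vS vc]]; last first.
      by rewrite /z1 !inE eq_sym (negPf vc) (negPf cS).
    by rewrite addr0 /z1 setU11 setU1K // SK bS eqxx addff2.
  (* When [c] is in [S], the cycle condition at [S :\ c] expresses [x S] by the values of [x] on the
     other sets [v |: S :\ c]; these are the values of [z1] on [v |: S], once the sets lie in block
     [j]. *)
  have := x0 (S :\ c); rewrite /dstar subsetD1 AS cA /=.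
  rewrite (bigD1 c) /=; last by rewrite !inE eqxx.
  rewrite setD1K // => /eqP xE; apply/eqP; rewrite -[RHS](eqP xE); congr (_ + _).
  apply: eq_big => [v|v vS]; first by rewrite !inE; case: eqVneq => [->|] //=; rewrite ?cS ?andbT.
  have vc : v != c by apply: contraNneq vS => ->.
  have -> : v |: S :\ c = (v |: S) :\ c.
    by apply/setP => w; rewrite !inE; case: eqVneq => //= ->; rewrite vc.
  rewrite /z1 !inE cS orbT /=; case: ifP => // /negbT.
  apply: contraNeq => nzv; rewrite eq_sym in nzv; have [_ vK _] := sx _ nzv; rewrite vK /=.
  have RS' : Rs j \subset S :\ c by rewrite subsetD1 RS.
  have ScK : S :\ c \in K by apply: K_sub SK _; apply: subsetDl.
  have bSc : blk (S :\ c) = j.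
    by apply: jm => //; apply: subset_trans (subsetDl _ _) Sj.
  (* The rank is at most [m] on the support of [x], and at least that of the subset [S :\ c], which
     is [m]. *)
  apply/eqP/rk_inj/eqP; rewrite eqn_leq; apply/andP; split.
    by rewrite rk0 -ltnS; apply: xm.
  rewrite -[in X in (X <= _)%N]bSc; apply: rk_blk => //.
  by apply: setSD; apply: subsetUr.
exists (fun S => z S + z1 S).
  move=> S; have [->|nz _] := eqVneq (z S) 0; last exact: sz.
  by rewrite add0r => /sz1.
move=> S; have := zE S; rewrite /x' => /(canRL (addrK _)) ->.
by rewrite oppff2; have := dSD (fun _ => z) (fun _ => z1) A S.
Qed.

Lemma dS_exact k a x : (k < d)%N -> psupp k a x -> ceq (dS x) (fun _ _ => 0) ->
  exists2 z, psupp k.+1 a z & ceq x (dS z).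
Proof.
move=> kd sx x0.
have ex A : exists z, (if #|A|.+1 == a then ssupp A k.+1 z else z = fun _ => 0) /\
    forall S, x A S = dstar A z S.
  case: eqP => Aa; last first.
    exists (fun _ => 0); split=> // S; rewrite /dstar big1 ?if_same //.
    by apply/eqP; apply: contraT => /sx[].
  (* The bound exceeds every rank, so the support condition is void. *)
  have [||||z] := @shelling_exact_rk (\max_j (rk j).+1) A k (x A) => //.
  - by move=> S /sx[].
  - by move=> S _; apply: (leq_bigmax (blk S)).
  - exact: x0.
  by exists z.
have [z zP] := choice ex.
exists z; last by move=> A S; rewrite (zP A).2.
move=> A S; have [] := zP A; case: (#|A|.+1 =P a) => [Aa sz _ nz|_ -> _].
  by have [? ? ?] := sz _ nz; split.
by rewrite eqxx.
Qed.

(** Here [x] is a cycle modulo the image of [dA], with witness [y]. As dA (dS y) = dS (dS x) = 0,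
    the function [y] is again such a cycle, one step lower. If y = dS z' + dA w', then x + dA z' is
    killed by [dS], hence is some dS z. For [q] = 0 the index convention makes [y] vanish. *)
Lemma zigzag q k x y : (k.+1 < d)%N -> (q <= k)%N ->
  psupp k.+1 q.+1 x -> psupp k q y -> ceq (dS x) (dA y) ->
  (q = k -> \sum_A \sum_S x A S = 0) ->
  exists z w, [/\ psupp k.+2 q.+1 z, psupp k.+1 q w &
    ceq x (cadd (dS z) (dA w))].
Proof.
elim: q k x y => [|q IH] k x y kd qk sx sy xy tot.
  have [|z sz zE] := dS_exact kd sx.
    move=> A S; rewrite xy /dA; case: ifP => // _; rewrite big1 // => a _.
    by apply/eqP; apply: contraT => /sy[].
  exists z, (fun _ _ => 0); split=> //.
  move=> A S; rewrite /cadd zE [X in _ = _ + X](_ : _ = 0) ?addr0 //.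
  by rewrite /dA; case: ifP => // _; rewrite big1.
case: k kd qk sx sy tot => [//|k] kd qk sx sy tot.
have sub (f : chainfun) l a : psupp l a f -> forall A S, f A S != 0 -> A \subset S.
  by move=> sf A S /sf[].
(* Both functions live on pairs with |S \ A| = 1, where [dS] and [dA] preserve the total; the
   condition thus passes from [x] to [y]. *)
have tot' : q = k -> \sum_A \sum_S y A S = 0.
  move=> qk'; have e1 := total_dS (sub _ _ _ sx); have e2 := total_dA (sub _ _ _ sy).
  have one (f : chainfun) l a : psupp l.+1 a.+1 f -> l = a ->
      \sum_A \sum_S #|S :\: A|%:R * f A S = \sum_A \sum_S f A S.
    move=> sf la; apply: eq_bigr => A _; apply: eq_bigr => S _.
    have [->|/sf[AS _ Sl [Al]]] := eqVneq (f A S) 0; first by rewrite mulr0.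
    by rewrite cardsD (setIidPr AS) Sl Al la subSnn mul1r.
  rewrite -(one _ _ _ sy) // -e2 -[RHS](tot (congr1 S qk')).
  rewrite -(one _ _ _ sx) ?qk' // -e1.
  by apply: eq_bigr => A _; apply: eq_bigr => S _; rewrite xy.
have [y' sy' yE] : exists2 y', psupp k q y' & ceq (dS y) (dA y').
  have d0 : ceq (dA (dS y)) (fun _ _ => 0).
    move=> A S; rewrite -dSA -(eq_dS xy) dSS //.
  (* At the bottom [S] is empty and [dA] is not exact; but [dS y] has a single possibly nonzero
     value, the total of [y], which is 0 by [tot']. *)
  case: k kd qk sx sy tot tot' => [|k] kd qk sx sy tot tot'.
    exists (fun _ _ => 0); first by move=> A S; rewrite eqxx.
    move=> A S; rewrite [RHS](@dA_eq0 (fun _ _ => 0)) //.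
    move: qk; rewrite ltnS leqn0 => /eqP q0.
    apply/eqP; apply: contraT => nz.
    have [AS _ S0 _] := psupp_dS sy nz.
    case/eqP: nz; rewrite -[RHS](tot' q0).
    move/eqP: S0; rewrite cards_eq0 => /eqP S0; move: AS; rewrite S0 subset0 => /eqP A0.
    rewrite A0 /dS sub0set.
    have big0 A' : A' != set0 -> \sum_S' y A' S' = 0.
      move=> nzA; rewrite big1 // => S' _; apply/eqP.
      apply: contraT => /sy[_ _ _ [/eqP]]; rewrite q0 cards_eq0.
      by rewrite (negPf nzA).
    rewrite (bigD1 set0) //= [X in _ + X]big1 ?addr0; last by move=> A' /big0.
    rewrite [RHS](bigID (fun S' : {set T} => #|S'| == 1%N)) /= [X in _ + X]big1 ?addr0; last first.
      by move=> S' n1; apply/eqP; apply: contraNT n1 => /sy[_ _ -> _].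
    pose u (S' : {set T}) := [pick v in S'].
    rewrite [LHS](eq_bigl predT); last by move=> v; rewrite inE.
    rewrite [RHS](eq_bigl (mem [set [set v] | v in T])); last first.
      move=> S'; apply/cards1P/imsetP => [[v ->]|[v _ ->]]; first by exists v.
      by exists v.
    rewrite big_imset /=; last by move=> v w _ _; apply: set1_inj.
    by apply: eq_bigr => v _; rewrite setU0.
  have [y' sy' y'E] := dA_exact (psupp_dS sy) d0.
  by exists y'.
have [z' [w' [sz' sw' y'E]]] := IH k y y' (ltnW kd) qk sy sy' yE tot'.
have [|z sz zE] := @dS_exact k.+2 q.+2 (cadd x (dA z')) kd (psuppD sx (psupp_dA sz')).
  move=> A S; rewrite dSD /cadd xy dSA (eq_dA y'E) dAD /cadd dAA addr0.
  by rewrite addff2.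
exists z, z'; split=> // A S; have := zE A S; rewrite /cadd => <-.
by rewrite -addrA addff2 addr0.
Qed.

End Shelling.

End Pairs.

(** * Exterior powers over the field with two elements *)

Section ExtSeq.
Variable q : nat.
Implicit Types V W : vectType 'F_2.

Let gen V (t : wtuple q V) : ext_power q V := quo_pi (wrel q V) (wgen t).

Let gen_lin V (t : wtuple q V) i (a : 'F_2) (u v : V) :
  gen (wset t i (a *: u + v)) = a *: gen (wset t i u) + gen (wset t i v).
Proof.
have := wlin_rel_in t i a u v; rewrite -quo_pi_eq0 /wlin_rel !linearB linearZ /=.
by rewrite -addrA -opprD subr_eq0 => /eqP.
Qed.

Let gen_add V (t : wtuple q V) i (u v : V) :
  gen (wset t i (u + v)) = gen (wset t i u) + gen (wset t i v).
Proof. by rewrite -{1}[u]scale1r gen_lin scale1r. Qed.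

Let gen_alt V (t : wtuple q V) i j : i != j -> t i = t j -> gen t = 0.
Proof.
move=> ij tij; apply/eqP; rewrite quo_pi_eq0; apply: walt_in.
by apply/injectiveP => /(_ _ _ tij) /eqP; rewrite (negPf ij).
Qed.

(** Alternation gives antisymmetry, which is symmetry in characteristic 2; a wedge then depends only
    on the multiset of its factors. *)
Let gen_swap V (t : wtuple q V) i j : gen [ffun k => t (tperm i j k)] = gen t.
Proof.
have [->|ij] := eqVneq i j.
  rewrite tperm1; by congr gen; apply/ffunP => k; rewrite ffunE perm1.
pose G (u v : V) := gen (wset (wset t i u) j v).
have wC u v : wset (wset t i u) j v = wset (wset t j v) i u.
  apply/ffunP => k; rewrite !ffunE.
  by case: (eqVneq k j) => [->|//]; rewrite eq_sym (negPf ij).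
have G0 u : G u u = 0.
  by apply: (gen_alt ij); rewrite !ffunE eqxx (negPf ij) eqxx.
have GD u u' v v' : G (u + u') (v + v') = G u v + G u v' + (G u' v + G u' v').
  by rewrite /G gen_add !(wC (u + u')) !gen_add -!wC addrACA.
have GC u v : G u v = G v u.
  have := G0 (u + v); rewrite GD !G0 add0r addr0 => /eqP.
  by rewrite addr_eq0 oppvv2 => /eqP.
have -> : [ffun k => t (tperm i j k)] = wset (wset t i (t j)) j (t i).
  apply/ffunP => k; rewrite !ffunE.
  by case: tpermP => [->|->|/eqP/negPf-> /eqP/negPf->//]; rewrite ?(negPf ij) ?eqxx.
rewrite -/(G _ _) GC /G; congr gen; apply/ffunP => k; rewrite !ffunE.
by case: eqVneq => [->//|_]; case: eqVneq => [->//|].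
Qed.

Let gen_perm V (t : wtuple q V) (s : {perm 'I_q}) : gen [ffun k => t (s k)] = gen t.
Proof.
have [ts -> _] := prod_tpermP s; elim: ts t => [|[i j] ts IH] t /=.
  by rewrite big_nil; congr gen; apply/ffunP => k; rewrite ffunE perm1.
rewrite big_cons /= -[RHS]IH -[RHS](gen_swap _ i j); congr gen; apply/ffunP => k.
by rewrite !ffunE permM.
Qed.

Definition ext_seq V (s : seq V) : ext_power q V := ext_prod (fun i : 'I_q => s`_i).

Lemma ext_seq_perm V (s1 s2 : seq V) : size s1 = q -> perm_eq s1 s2 ->
  ext_seq s1 = ext_seq s2.
Proof.
move=> sz s12; have sz2 := perm_size s12; rewrite sz in sz2.
have sz1' : size s1 == q by apply/eqP.
have sz2' : size s2 == q by apply/eqP.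
have /tuple_permP[p pE] : perm_eq (Tuple sz1') (Tuple sz2') by [].
rewrite /ext_seq /ext_prod -/(gen _) -/(gen _) -(gen_perm [ffun i : 'I_q => s2`_i] p).
congr gen; apply/ffunP => i; rewrite !ffunE.
have -> : s1`_i = tnth (Tuple sz1') i by rewrite (tnth_nth 0).
rewrite (tnth_nth 0) pE (nth_map i); last by rewrite size_enum_ord.
by rewrite nth_ord_enum (tnth_nth 0).
Qed.

Lemma ext_seq_dup V (s : seq V) : size s = q -> ~~ uniq s -> ext_seq s = 0.
Proof.
move=> sz /(uniqPn 0)[i [j [ij jq e]]].
rewrite sz in jq; have iq := ltn_trans ij jq.
apply: (@gen_alt V _ (Ordinal iq) (Ordinal jq)); first by rewrite -val_eqE /= ltn_eqF.
by rewrite !ffunE.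
Qed.

Lemma ext_map_seq V W (f : 'Hom(V, W)) (s : seq V) : size s = q ->
  ext_map q f (ext_seq s) = ext_seq (map f s).
Proof.
move=> sz; rewrite /ext_seq ext_map_prod; congr (quo_pi _ (wgen _)).
by apply/ffunP => i; rewrite !ffunE /= (nth_map 0) ?sz.
Qed.

Lemma ext_seq_span V (P : ext_power q V -> Prop) :
  (forall a x y, P x -> P y -> P (a *: x + y)) -> P 0 ->
  (forall s : seq V, size s = q -> P (ext_seq s)) -> forall x, P x.
Proof.
move=> Plin P0 Ps x; rewrite -[x]quo_piK [quo_repr x]wfree_sum linear_sum.
apply: (big_ind P) => //.
  by move=> y z Py Pz; rewrite -[y]scale1r; apply: Plin.
move=> t _; rewrite linearZ /= -[_ *: _]addr0; apply: Plin => //.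
have := Ps (mkseq (fun i => if insub i is Some i' then t i' else 0) q).
rewrite size_mkseq => /(_ erefl); congr P; rewrite /ext_seq /ext_prod.
by congr (quo_pi _ (wgen _)); apply/ffunP => i; rewrite ffunE nth_mkseq // valK.
Qed.

(** Determinants are multilinear and alternating in the rows, so they vanish on [wrel]. These
    functionals are the means to prove wedges independent. *)
Lemma ext_det V (phi : 'I_q -> 'Hom(V, ('F_2)^o)) :
  exists D : 'Hom(ext_power q V, ('F_2)^o), forall s : seq V, size s = q ->
    D (ext_seq s) = \det (\matrix_(i, j) (phi j s`_i : 'F_2)).
Proof.
pose dm (t : wtuple q V) : 'M['F_2]_q := \matrix_(i, j) (phi j (t i) : 'F_2).
pose f (x : wfree q V) : ('F_2)^o := \sum_t x t *: (\det (dm t) : ('F_2)^o).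
have flin : linear f.
  move=> a u v; rewrite /f scaler_sumr -big_split /=; apply: eq_bigr => t _.
  by rewrite !ffunE scalerDl scalerA.
pose F : {linear wfree q V -> ('F_2)^o} := HB.pack f (GRing.isLinear.Build _ _ _ _ f flin).
have FE x : linfun F x = f x by rewrite lfunE.
have Fgen t : linfun F (wgen t) = \det (dm t).
  rewrite FE /f (bigD1 t) //= big1 => [|t' /negPf t'N].
    by rewrite addr0 ffunE eqxx scale1r.
  by rewrite ffunE t'N scale0r.
have rel : (wrel q V <= lker (linfun F))%VS.
  rewrite subv_add; apply/andP; split; apply/subv_sumP => t.
    move=> _; apply/subv_sumP => i _; apply/subv_sumP => a _.
    apply/subv_sumP => u _; apply/subv_sumP => v _.
    rewrite -memvE memv_ker !linearB linearZ /= !Fgen.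
    rewrite (@determinant_multilinear _ _ (dm (wset t i (a *: u + v)))
      (dm (wset t i u)) (dm (wset t i v)) i a 1); first by rewrite mul1r addrAC addrK subrr.
    - by apply/rowP => j; rewrite !mxE !ffunE eqxx linearP mul1r.
    - by apply/matrixP => k j; rewrite !mxE !ffunE eq_sym (negPf (neq_lift i k)).
    - by apply/matrixP => k j; rewrite !mxE !ffunE eq_sym (negPf (neq_lift i k)).
  move=> tN; rewrite -memvE memv_ker Fgen.
  have [i [j [ij tij]]] : exists i, exists j, i != j /\ t i = t j.
    apply: contrapT => no; case/negP: tN; apply/injectiveP => i j tij.
    by apply/eqP; apply: contrapT => /negP ij; apply: no; exists i, j.
  by rewrite (determinant_alternate ij) // => k; rewrite !mxE tij.
(* The functional is evaluated on the chosen representative; [rel] makes the value independent of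
   that choice. *)
exists (linfun F \o linfun (@vsval _ _ (wrel q V)^C))%VF => s sz.
rewrite comp_lfunE.
have -> : linfun (@vsval _ _ (wrel q V)^C) (ext_seq s) = quo_repr (ext_seq s) by rewrite lfunE.
have := quo_reprK (wrel q V) (wgen [ffun i : 'I_q => s`_i]).
move=> /(subvP rel); rewrite memv_ker linearB subr_eq0 => /eqP e.
by rewrite -[LHS]e [LHS]Fgen; congr (\det _); apply/matrixP => i j; rewrite !mxE ffunE.
Qed.

End ExtSeq.

Lemma ext_seq_lin q (V : vectType 'F_2) (a : 'F_2) (u v : V) (s : seq V) : size s = q ->
  ext_seq q.+1 (a *: u + v :: s) = a *: ext_seq q.+1 (u :: s) + ext_seq q.+1 (v :: s).
Proof.
move=> sz; pose t : wtuple q.+1 V := [ffun i : 'I_q.+1 => (0 :: s)`_i].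
have E w : ext_seq q.+1 (w :: s) = quo_pi (wrel q.+1 V) (wgen (wset t ord0 w)).
  congr (quo_pi _ (wgen _)); apply/ffunP => i; rewrite !ffunE.
  by case: (unliftP ord0 i) => [j|] ->.
rewrite !E.
have := wlin_rel_in t ord0 a u v; rewrite -quo_pi_eq0 /wlin_rel !linearB linearZ /=.
by rewrite -addrA -opprD subr_eq0 => /eqP.
Qed.

Lemma ext_seq_sum q (V : vectType 'F_2) (I : finType) (P : pred I) (F : I -> V) (s : seq V) :
  size s = q ->
  ext_seq q.+1 (\sum_(i | P i) F i :: s) = \sum_(i | P i) ext_seq q.+1 (F i :: s).
Proof.
move=> sz.
have D u v : ext_seq q.+1 (u + v :: s) = ext_seq q.+1 (u :: s) + ext_seq q.+1 (v :: s).
  by rewrite -{1}[u]scale1r ext_seq_lin // scale1r.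
apply: (big_morph (fun u => ext_seq q.+1 (u :: s))) => //.
by have := D 0 0; rewrite addr0 => /esym/(canRL (addrK _)); rewrite subrr.
Qed.

Lemma ext_seq_mem0 q (V : vectType 'F_2) (s : seq V) : size s = q -> 0 \in s -> ext_seq q s = 0.
Proof.
move=> sz s0; rewrite (ext_seq_perm sz (perm_to_rem s0)).
have := perm_size (perm_to_rem s0); rewrite sz.
case: q {sz} => // q [sr].
by have := ext_seq_sum pred0 (fun i : bool => 0 : V) (esym sr); rewrite !big_pred0.
Qed.

(** Passes from families over the positions in [B] (tuples, matrices) to families over [T] (sums
    over [B]). *)
Lemma extend_enum (T : finType) (B : {set T}) (A : Type) (x0 : A) (y : 'I_#|B| -> A) :
  exists c : T -> A, forall j, c (enum_val j) = y j.
Proof.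
exists (fun t => if t \in B =P true is ReflectT tB then y (enum_rank_in tB t) else x0) => j.
by case: eqP => [p|[]]; rewrite ?enum_valK_in ?enum_valP.
Qed.

(** * Dual families and bases of exterior powers *)

Section DualFamily.
Variables (K : fieldType) (V : vectType K) (T : finType).
Implicit Types (B : {set T}) (b : T -> V) (phi : T -> 'Hom(V, K^o)).

Definition dualized B b phi := forall i j, i \in B -> j \in B ->
  phi i (b j) = (i == j)%:R.

Definition coordinatized B b phi := forall x, x = \sum_(i in B) phi i x *: b i.

Definition independent B b := forall c : T -> K, \sum_(i in B) c i *: b i = 0 ->
  forall i, i \in B -> c i = 0.

Lemma dualized_sum B b phi (c : T -> K) i : dualized B b phi -> i \in B ->
  phi i (\sum_(j in B) c j *: b j) = c i.
Proof.
move=> dual iB; rewrite linear_sum (bigD1 i) //= big1 => [|j /andP[jB ji]].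
  by rewrite linearZ /= dual // eqxx addr0 /GRing.scale /= mulr1.
by rewrite linearZ /= dual // eq_sym (negPf ji) scaler0.
Qed.

Lemma dualized_independent B b phi : dualized B b phi -> independent B b.
Proof.
by move=> dual c c0 i iB; rewrite -(dualized_sum c dual iB) c0 linear0.
Qed.

Definition family B b : #|B|.-tuple V := [tuple b (enum_val i) | i < #|B|].

Lemma family_nth B b (i : 'I_#|B|) : (family B b)`_i = b (enum_val i).
Proof. by rewrite -tnth_nth tnth_mktuple. Qed.

Lemma family_sum B b (c : T -> K) :
  \sum_(i < #|B|) c (enum_val i) *: (family B b)`_i = \sum_(i in B) c i *: b i.
Proof.
by rewrite [RHS]big_enum_val; apply: eq_bigr => i _; rewrite family_nth.
Qed.

Lemma independent_free B b : independent B b <-> free (family B b).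
Proof.
split=> [ind|/freeP fr c c0 i iB].
  apply/freeP => k k0 i.
  have [c cE] := extend_enum 0 k.
  rewrite -cE; apply: ind (enum_valP _); rewrite -family_sum -[RHS]k0.
  by apply: eq_bigr => j _; rewrite cE.
rewrite -(enum_rankK_in iB iB); apply: (fr (fun j => c (enum_val j))).
by rewrite family_sum.
Qed.

Lemma independent_dualized B b : independent B b -> exists phi, dualized B b phi /\
   (forall x, x \in <<family B b>>%VS -> x = \sum_(i in B) phi i x *: b i).
Proof.
move=> /independent_free fr.
have [phi phiE'] := extend_enum 0 (fun j => linfun (coord (family B b) j : V -> K^o)).
have phiE j x : phi (enum_val j) x = coord (family B b) j x by rewrite phiE' lfunE.
exists phi; split=> [i j iB jB|x xB].
  rewrite -(enum_rankK_in iB iB) -{1}(enum_rankK_in iB jB) phiE -family_nth.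
  rewrite coord_free // eq_sym -(inj_eq enum_val_inj) !enum_rankK_in //.
rewrite [RHS]big_enum_val [LHS](coord_span xB); apply: eq_bigr => i _.
by rewrite family_nth phiE.
Qed.

Lemma coordinatized_dim B b phi : dualized B b phi -> coordinatized B b phi ->
  dim V = #|B|.
Proof.
move=> dual crd.
suff /size_basis : basis_of fullv (family B b) by move=> <-; rewrite dimvf.
apply/andP; split; last exact/independent_free/dualized_independent/dual.
rewrite eqEsubv subvf; apply/subvP => x _; rewrite (crd x).
rewrite big_enum_val; apply: memv_suml => i _; apply/memvZ.
by rewrite -family_nth; apply/memv_span/mem_nth; rewrite size_tuple.
Qed.

Lemma independent_coordinatized B b : independent B b -> #|B| = dim V ->
  exists phi, dualized B b phi /\ coordinatized B b phi.
Proof.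
move=> ind cB; have [phi [dual crd]] := independent_dualized ind.
exists phi; split=> // x; apply: crd.
suff -> : <<family B b>>%VS = fullv by rewrite memvf.
apply/eqP; rewrite eqEdim subvf.
have := ind; rewrite independent_free /free => /eqP ->.
by rewrite dimvf size_tuple cB leqnn.
Qed.

End DualFamily.

Lemma dual_basis_exists (K : fieldType) (V : vectType K) :
  exists b phi, @dualized K V 'I_(dim V) setT b phi /\ coordinatized setT b phi.
Proof.
pose b (i : 'I_(dim V)) := (vbasis {:V})`_i.
have sz : \dim {:V} = dim V by rewrite dimvf.
suff ind : independent setT b.
  have [|phi pP] := independent_coordinatized ind; first by rewrite cardsT card_ord.
  by exists b, phi.
move=> c c0 i _; have /freeP fr := basis_free (vbasisP {:V}).
have := fr (fun j => c (cast_ord sz j)) _ (cast_ord (esym sz) i).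
rewrite cast_ordKV; apply; rewrite -[RHS]c0.
rewrite [RHS](reindex (cast_ord sz)) /=.
  by rewrite [RHS](eq_bigl predT) // => j; rewrite inE.
by exists (cast_ord (esym sz)) => j _; rewrite ?cast_ordK ?cast_ordKV.
Qed.

Section ExtBasis.
Variables (q : nat) (V : vectType 'F_2) (T : finType).
Implicit Types (B A C : {set T}) (b : T -> V) (phi : T -> 'Hom(V, ('F_2)^o)).

Definition ext_set b A : ext_power q V := ext_seq q (map b (enum A)).

(** The functional at [A] is the determinant of the [phi i], i in A. Its matrix on the wedge of [A]
    is the identity; for another set [C] of the same size, an element of [C] outside [A] gives a
    zero row. *)
Lemma ext_dualized B b phi : dualized B b phi ->
  exists psi : {set T} -> 'Hom(ext_power q V, ('F_2)^o),
    dualized [set A : {set T} | A \subset B & #|A| == q] (ext_set b) psi.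
Proof.
move=> dual.
have ex A : exists D : 'Hom(ext_power q V, ('F_2)^o), forall s : seq V, size s = q ->
    D (ext_seq q s) =
    \det (\matrix_(i < q, j < q) ((map phi (enum A))`_j s`_i : 'F_2)).
  exact: (ext_det (fun j : 'I_q => (map phi (enum A))`_j)).
have [psi psiE] := choice ex.
exists psi => A C; rewrite !inE => /andP[AB /eqP Aq] /andP[CB /eqP Cq].
have szA : size (enum A) = q by rewrite -cardE.
have szC : size (enum C) = q by rewrite -cardE.
rewrite psiE ?size_map //.
have mE (t0 : T) (i j : 'I_q) : ((map phi (enum A))`_j (map b (enum C))`_i : 'F_2) =
    (nth t0 (enum A) j == nth t0 (enum C) i)%:R.
  rewrite !(nth_map t0) ?szA ?szC // dual //.
    by apply: (subsetP AB); rewrite -mem_enum mem_nth ?szA.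
  by apply: (subsetP CB); rewrite -mem_enum mem_nth ?szC.
case: eqVneq => [AC|AC].
  rewrite -AC in mE *; rewrite -[RHS](det1 _ q); congr (\det _); apply/matrixP => i j; rewrite !mxE.
  have [t0 _] : exists t, t \in A.
    by apply/card_gt0P; rewrite Aq; apply: leq_ltn_trans (ltn_ord i).
  by rewrite (mE t0) nth_uniq ?szA ?enum_uniq // eq_sym.
have [c cC cA] : exists2 c, c \in C & c \notin A.
  apply/subsetPn; apply: contraNN AC => CA; rewrite eq_sym eqEcard CA.
  by rewrite Aq Cq leqnn.
have ci : (index c (enum C) < q)%N by rewrite -szC index_mem mem_enum.
rewrite (expand_det_row _ (Ordinal ci)) big1 // => j _.
rewrite mxE (mE c) /= nth_index ?mem_enum //.
case: eqP => [e|_]; last by rewrite mul0r.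
by case/negP: cA; rewrite -e -mem_enum mem_nth ?szA.
Qed.

Lemma ext_set_perm b A (l : seq T) : uniq l -> size l = q -> A = [set t in l] ->
  ext_seq q (map b l) = ext_set b A.
Proof.
move=> ul sl ->; apply: ext_seq_perm; first by rewrite size_map.
apply: perm_map; apply: uniq_perm; rewrite ?enum_uniq // => t.
by rewrite mem_enum inE.
Qed.

End ExtBasis.

Lemma ext_coordinatized q (V : vectType 'F_2) (T : finType) (B : {set T}) b phi :
  dualized B b phi -> @coordinatized _ V _ B b phi ->
  exists psi : {set T} -> 'Hom(ext_power q V, ('F_2)^o),
    let BB := [set A : {set T} | A \subset B & #|A| == q] in
    dualized BB (ext_set q b) psi /\ coordinatized BB (ext_set q b) psi.
Proof.
move=> dual crd; have [psi dpsi] := ext_dualized q dual.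
exists psi; split=> //; set BB := [set A | _].
pose P (x : ext_power q V) := x = \sum_(A in BB) psi A x *: ext_set q b A.
have Plin a x y : P x -> P y -> P (a *: x + y).
  rewrite /P => {1}-> {1}->; rewrite scaler_sumr -big_split /=; apply: eq_bigr => A _.
  by rewrite linearP scalerDl scalerA.
have P0 : P 0 by rewrite /P big1 // => A _; rewrite linear0 scale0r.
apply: (@ext_seq_span q V P) => // s sq.
have Pb l : size l = q -> {subset l <= B} -> P (ext_seq q (map b l)).
  move=> sl lB; have [ul|ul] := boolP (uniq l); last first.
    rewrite ext_seq_dup ?size_map //; apply: contra ul; exact: map_uniq.
  have lBB : [set t in l] \in BB.
    rewrite inE cardsE (card_uniqP ul) sl eqxx andbT.
    by apply/subsetP => t; rewrite inE; apply: lB.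
  rewrite (ext_set_perm b ul sl erefl) /P (bigD1 [set t in l]) //= dpsi // eqxx scale1r.
  rewrite big1 ?addr0 // => A /andP[AB Al].
  by rewrite dpsi // (negPf Al) scale0r.
(* The factors are expanded one by one: [s'] holds those still arbitrary, [l] the indices of those
   already replaced by basis vectors. *)
have : forall s' l, (size s' + size l)%N = q -> {subset l <= B} ->
    P (ext_seq q (s' ++ map b l)).
  elim=> [|x s' IH] l /= sz lB; first exact: Pb.
  have PS (I : Type) (r : seq I) (Q : pred I) (F : I -> V) :
      (forall i, Q i -> P (ext_seq q (F i :: s' ++ map b l))) ->
      P (ext_seq q ((\sum_(i <- r | Q i) F i) :: s' ++ map b l)).
    case: q psi dpsi BB P Plin P0 IH sz {s sq Pb} => [//|q'] psi dpsi BB P Plin P0 IH sz PF.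
    have sz' : size (s' ++ map b l) = q' by rewrite size_cat size_map; case: sz.
    apply: (big_ind (fun v => P (ext_seq q'.+1 (v :: s' ++ map b l)))) => //.
      have := ext_seq_lin 1 (0 : V) 0 sz'.
      by rewrite scale1r addr0 scale1r => /esym/(canRL (addrK _)); rewrite subrr => ->.
    move=> u v Pu Pv; rewrite -[u]scale1r ext_seq_lin //; exact: Plin.
  rewrite (crd x); apply: (PS _ _ _ _) => i iB.
  have PZ (a : 'F_2) u : P (ext_seq q (u :: s' ++ map b l)) ->
      P (ext_seq q (a *: u :: s' ++ map b l)).
    have [->|/eq1f2->] := eqVneq a 0; last by rewrite scale1r.
    by move=> _; rewrite scale0r; have := PS V [::] pred0 id; rewrite big_nil; apply.
  apply: PZ; rewrite (@ext_seq_perm _ _ _ (s' ++ map b (i :: l))).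
  - apply: IH; first by rewrite /= addnS.
    by move=> t; rewrite inE => /predU1P[->//|/lB].
  - by rewrite /= size_cat size_map.
  - by rewrite perm_sym /= perm_catC /= perm_cons perm_catC.
by move=> /(_ s [::]); rewrite cats0 addn0; apply.
Qed.

Lemma card_ext_sets (T : finType) (B : {set T}) q :
  #|[set A : {set T} | A \subset B & #|A| == q]| = 'C(#|B|, q).
Proof. exact: cards_draws. Qed.

Lemma dim_ext_power q (V : vectType 'F_2) : dim (ext_power q V) = 'C(dim V, q).
Proof.
have [b [phi [dual crd]]] := dual_basis_exists V.
have [psi [d c]] := ext_coordinatized q dual crd.
by rewrite (coordinatized_dim d c) card_ext_sets cardsT card_ord.
Qed.

(** * Homology of the exterior cosheaf of a simplicial fan *)

Lemma dim_quo (K : fieldType) (V : vectType K) (W : {vspace V}) :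
  dim (quo W) = (dim V - \dim W)%N.
Proof. by have := dimv_compl W; rewrite dimvf; apply: etrans. Qed.

Lemma big_subtype (R : Type) (idx : R) (op : Monoid.com_law idx) (I : finType)
    (P Q : pred I) (F : I -> R) :
  \big[op/idx]_(x : {x | P x} | Q (val x)) F (val x) = \big[op/idx]_(x | P x && Q x) F x.
Proof.
rewrite [RHS](reindex_omap (val : {x | P x} -> I) insub) => [|i /andP[Pi _]]; last first.
  by rewrite insubT.
by apply: eq_bigl => -[j Pj] /=; rewrite (insubT P Pj) eqxx andbT Pj.
Qed.

(** * Exterior powers of the stalk at a proper face *)

Section SimplexStalk.
Variables (V : vectType 'F_2) (T : finType) (S : {set T}) (e : T -> V) (q : nat).
Hypothesis e_rel : \sum_(a in S) e a = 0.
Hypothesis e_basis : forall a0, a0 \in S -> exists phi,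
  dualized (S :\ a0) e phi /\ coordinatized (S :\ a0) e phi.

Definition stalk_pi (x : chainfun T) : ext_power q V :=
  \sum_(A : {set T} | (A \subset S) && (#|A| == q)) x A S *: ext_set q e A.

Lemma stalk_piD x y : stalk_pi (cadd x y) = stalk_pi x + stalk_pi y.
Proof. by rewrite -big_split /=; apply: eq_bigr => A _; rewrite scalerDl. Qed.

Lemma eq_stalk_pi x y : (forall A : {set T}, A \subset S -> #|A| = q -> x A S = y A S) ->
  stalk_pi x = stalk_pi y.
Proof. by move=> xy; apply: eq_bigr => A /andP[AS /eqP Aq]; rewrite xy. Qed.

(** This is the wedge of the vanishing sum of the [e a] with the factors of [B]: the terms with [a]
    in [B] repeat a factor and drop out. *)
Lemma wedge_rel (B : {set T}) : B \subset S -> #|B|.+1 = q ->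
  \sum_(a in S :\: B) ext_set q e (a |: B) = 0.
Proof.
case: q => // q' BS [Bq]; pose sB := map e (enum B).
have szB : size sB = q' by rewrite size_map -cardE.
have cE a : a \notin B -> ext_set q'.+1 e (a |: B) = ext_seq q'.+1 (e a :: sB).
  move=> aB; rewrite -(ext_set_perm (l := a :: enum B) e) //=.
  - by rewrite mem_enum aB enum_uniq.
  - by rewrite -cardE Bq.
  - by apply/setP => t; rewrite !inE mem_enum.
rewrite (eq_bigr (fun a => ext_seq q'.+1 (e a :: sB))); last first.
  by move=> a; rewrite inE => /andP[aB _]; apply: cE.
rewrite -ext_seq_sum //.
have -> : \sum_(a in S :\: B) e a = \sum_(a in B) e a.
  apply/eqP; rewrite -subr_eq0 oppvv2 -[X in _ == X]e_rel [X in _ == X](big_setID B) /=.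
  by rewrite (setIidPr BS) addrC.
rewrite ext_seq_sum // big1 // => a aB; apply: ext_seq_dup; first by rewrite /= szB.
by rewrite /= map_f // mem_enum.
Qed.

Lemma stalk_pi_dA y : stalk_pi (dA y) = 0.
Proof.
rewrite /stalk_pi.
transitivity (\sum_(A : {set T} | (A \subset S) && (#|A| == q))
    \sum_(a in A) y (A :\ a) S *: ext_set q e A).
  by apply: eq_bigr => A /andP[AS _]; rewrite /dA AS scaler_suml.
rewrite (exchange_big_dep (mem S)) /=; last first.
  by move=> A a /andP[/subsetP AS _]; apply: AS.
transitivity (\sum_(a in S) \sum_(B : {set T} | [&& B \subset S, #|B|.+1 == q & a \notin B])
    y B S *: ext_set q e (a |: B)).
  apply: eq_bigr => a aS.
  rewrite (reindex_onto (fun B => a |: B) (fun A => A :\ a)) /=; last first.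
    by move=> A /andP[_ aA]; rewrite setD1K.
  apply: eq_big => [B|B /andP[_ /eqP->] //].
  have [aB|aB] := boolP (a \in B).
    rewrite !andbF; apply/andP => -[_ /eqP e']; by rewrite -e' !inE eqxx in aB.
  by rewrite setU1K // eqxx setU11 !andbT subUset sub1set aS /= cardsU1 aB.
rewrite (exchange_big_dep (fun B : {set T} => (B \subset S) && (#|B|.+1 == q))) /=; last first.
  by move=> a B _ /and3P[-> ->].
rewrite big1 // => B /andP[BS /eqP Bq].
rewrite -scaler_sumr (eq_bigl (mem (S :\: B))) ?wedge_rel ?scaler0 //.
by move=> a; rewrite !inE BS Bq eqxx andbC.
Qed.

(** Modulo the image of [dA], on which [stalk_pi] vanishes, [x] equals [hA c (dA x)]. The latter is
    supported on sets avoiding [a0], whose wedges are independent. *)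
Lemma stalk_pi_eq0 a0 x : a0 \in S ->
  stalk_pi x = 0 <-> (forall A : {set T}, A \subset S -> #|A| = q.+1 -> dA x A S = 0).
Proof.
move=> a0S; pose c (_ : {set T}) := Some a0.
have xE (A : {set T}) : A \subset S -> x A S = cadd (dA (hA c x)) (hA c (dA x)) A S.
  by move=> AS; rewrite (@hA_dA T c x A S a0).
have pE : stalk_pi x = stalk_pi (hA c (dA x)).
  by rewrite (eq_stalk_pi (fun A AS _ => xE A AS)) stalk_piD stalk_pi_dA add0r.
rewrite pE; split=> [p0|dx0]; last first.
  rewrite /stalk_pi big1 // => A /andP[AS /eqP Aq]; rewrite /hA /=.
  case: ifP => [/andP[_ a0A]|_]; last by rewrite scale0r.
  by rewrite dx0 ?scale0r // ?subUset ?sub1set ?a0S // cardsU1 a0A Aq.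
have [phi [dual crd]] := e_basis a0S.
have [psi dpsi] := ext_dualized q dual.
have h0 (A : {set T}) : A \subset S -> #|A| = q -> hA c (dA x) A S = 0.
  move=> AS Aq; have [a0A|a0A] := boolP (a0 \in A).
    by rewrite /hA /= a0A andbF.
  have AB : A \in [set A : {set T} | A \subset S :\ a0 & #|A| == q].
    by rewrite inE subsetD1 AS a0A Aq eqxx.
  rewrite -(dualized_sum (fun A => hA c (dA x) A S) dpsi AB).
  rewrite [X in psi A X](_ : _ = stalk_pi (hA c (dA x))); first by rewrite p0 linear0.
  rewrite /stalk_pi [RHS](bigID (fun A : {set T} => a0 \in A)) /=.
  rewrite [X in _ = X + _]big1 ?add0r.
    by apply: eq_bigl => C; rewrite inE subsetD1 -!andbA; do !bool_congr.
  by move=> C /andP[_ aC]; rewrite /hA /= aC andbF scale0r.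
move=> A AS Aq.
have -> : dA x A S = dA (dA (hA c x)) A S; last exact: dAA.
rewrite /dA AS; apply: eq_bigr => a aA.
have AaS : A :\ a \subset S by apply: subset_trans (subsetDl _ _) AS.
rewrite xE // /cadd h0 ?addr0 //.
by move: Aq; rewrite (cardsD1 a) aA => -[].
Qed.

Lemma stalk_pi_surj a0 v : a0 \in S -> exists x : {set T} -> 'F_2,
  (forall A, x A != 0 -> A \subset S /\ #|A| = q) /\ v = stalk_pi (fun A _ => x A).
Proof.
move=> a0S; have [phi [dual crd]] := e_basis a0S.
have [psi [dpsi cpsi]] := ext_coordinatized q dual crd.
exists (fun A : {set T} => if (A \subset S :\ a0) && (#|A| == q) then psi A v else 0); split.
  move=> A; case: ifP => [/andP[]|]; rewrite ?eqxx // subsetD1.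
  by move=> /andP[-> _] /eqP->.
rewrite [LHS]cpsi /stalk_pi [RHS](bigID (fun A : {set T} => a0 \in A)) /=.
rewrite [X in _ = X + _]big1 ?add0r.
  apply: eq_big => C; first by rewrite inE subsetD1 -!andbA; do !bool_congr.
  by rewrite inE => ->.
by move=> C /andP[_ aC]; rewrite subsetD1 aC andbF scale0r.
Qed.

End SimplexStalk.

Section AbstractHomology.
Variables (I : finType) (face : rel I) (cdim : I -> nat) (d : nat).
Variable F : cosheaf face.
Local Notation bd := (bd cdim d F).
Local Notation chains := (chains cdim d F).

Lemma dim_chains p : dim (chains p) = (\sum_(s : I | cdim s + p == d) dim (stalk F s))%N.
Proof.
rewrite [LHS]card_tagged sumnE big_map big_enum /=.
under eq_bigr => s _ do rewrite card_ord.
by rewrite (big_subtype _ (fun s => cdim s + p == d)%N predT (fun s => dim (stalk F s))); under eq_bigl => s do rewrite andbT.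
Qed.

(** Only when the boundaries are cycles does their preimage in the space of cycles keep their
    dimension. *)
Lemma dim_homology p : (forall x, bd p (bd p.+1 x) = 0) ->
  (dim (homology cdim d F p) + \dim (boundaries cdim d F p) = \dim (cycles cdim d F p))%N.
Proof.
move=> bb; rewrite /homology dim_quo.
set f := linfun _; set B := boundaries _ _ _ p; set Z := cycles _ _ _ p.
have finj : lker f == 0%VS.
  apply/lker0P => x y; rewrite !lfunE /=; exact: subvs_inj.
have BZ : (B <= Z)%VS.
  by apply/subvP => _ /memv_imgP[x _ ->]; rewrite memv_ker bb.
have Bf : (B <= limg f)%VS.
  apply: subv_trans BZ _; apply/subvP => x xZ.
  have -> : x = f (vsproj Z x) by rewrite lfunE /= vsprojK.
  exact: memv_img (memvf _).
have -> : \dim (f @^-1: B) = \dim B.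
  rewrite -{2}(lpreimK Bf) limg_dim_eq //.
  by rewrite (eqP finj) capv0.
by rewrite (_ : dim _ = \dim Z) // subnK // dimvS.
Qed.

Lemma dim_bd p : (\dim (cycles cdim d F p) + \dim (limg (bd p)) = dim (chains p))%N.
Proof. by rewrite -[dim _]dimvf -(limg_ker_dim (bd p) fullv) capfv. Qed.

Lemma bdP p (x : chains p) (t : cells cdim d p.-1) : bd p x t =
  \sum_(s : cells cdim d p | face (val s) (val t) && (cdim (val t) == (cdim (val s)).+1))
      corestr F (val s) (val t) (x s).
Proof. by rewrite bdE ffunE. Qed.

End AbstractHomology.

(** * The exterior complex of a simplicial fan *)

Section AbstractFan.
Variables (I : finType) (face : rel I) (cdim : I -> nat) (d : nat).
Variable E : cosheaf face.
(** [vs s] stands for the vertices of the face normal to [s], and [e s a] for the class at [s] of a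
    vector dual to the vertex [a]. Hypotheses on simplices and on [e] require [0 < cdim s], which
    excludes the zero cone. *)
Variables (T : finType) (vs : I -> {set T}) (e : forall s, T -> stalk E s).
Hypothesis faceE : forall s t, face s t = (vs t \subset vs s).
Hypothesis vs_inj : injective vs.
Hypothesis vs0 : forall s, vs s != set0.
Hypothesis card_vs : forall s, (0 < cdim s)%N -> (#|vs s| + cdim s = d.+1)%N.
Hypothesis vs_top : forall s, cdim s = 0%N -> vs s = setT.
Hypothesis dim_stalk : forall s, (dim (stalk E s) + cdim s = d)%N.
Hypothesis e_rel : forall s, (0 < cdim s)%N -> \sum_(a in vs s) e s a = 0.
Hypothesis e_basis : forall s, (0 < cdim s)%N -> forall a0, a0 \in vs s ->
  exists phi, dualized (vs s :\ a0) (e s) phi /\ coordinatized (vs s :\ a0) (e s) phi.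
Hypothesis e_corestr : forall s t a, (0 < cdim s)%N -> vs t \subset vs s -> a \in vs s ->
  corestr E s t (e s a) = if a \in vs t then e t a else 0.

Variables (J : finType) (fac Rs : J -> {set T}) (rk : J -> nat) (blk : {set T} -> J).
Let K : {set {set T}} := [set S : {set T} | [exists j, S \subset fac j]].
Hypothesis vs_K : forall s, (0 < cdim s)%N -> vs s \in K.
Hypothesis K_vs : forall S, S \in K -> S != set0 -> exists2 s, (0 < cdim s)%N & vs s = S.
Hypothesis rk_inj : injective rk.
Hypothesis fac_inj : injective fac.
Hypothesis card_fac : forall j, #|fac j| = d.
Hypothesis blkP : forall S j, S \in K ->
  (blk S == j) = (Rs j \subset S) && (S \subset fac j).
Hypothesis rk_blk : forall S S' : {set T}, S \in K -> S' \subset S ->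
  (rk (blk S') <= rk (blk S))%N.
Hypothesis even_ridge : forall S, S \in K -> S != set0 -> #|S|.+1 = d ->
  ~~ odd #|[set j | S \subset fac j]|.

Let K_sub (S S' : {set T}) : S \in K -> S' \subset S -> S' \in K.
Proof.
rewrite !inE => /existsP[j Sj] SS; apply/existsP; exists j.
exact: subset_trans SS Sj.
Qed.

Let KE S : (S \in K) = [exists j, S \subset fac j].
Proof. by rewrite inE. Qed.

Variable q : nat.
Let Q := ext_cosheaf q E.
Local Notation cells := (cells cdim d).
Local Notation bd := (bd cdim d Q).
Local Notation chains := (chains cdim d Q).

Let cell_dim p (s : cells p) : (cdim (val s) + p = d)%N.
Proof. exact/eqP/(valP s). Qed.

Let cell_proper p (s : cells p) : (p < d)%N -> (0 < cdim (val s))%N.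
Proof. by have := cell_dim s; lia. Qed.

Let cell_card p (s : cells p) : (p < d)%N -> #|vs (val s)| = p.+1.
Proof. by move=> pd; have := card_vs (cell_proper s pd); have := cell_dim s; lia. Qed.

Let K_cell S p : S \in K -> #|S| = p.+1 -> (p < d)%N -> exists s : cells p, vs (val s) = S.
Proof.
move=> SK Sp pd; have [|s s0 sS] := K_vs SK; first by rewrite -card_gt0 Sp.
have sp : (cdim s + p == d)%N.
  by have := card_vs s0; rewrite sS Sp addSn => -[<-]; rewrite addnC.
by exists (Sub s sp).
Qed.

Definition total_pi p (x : chainfun T) : chains p :=
  [ffun s : cells p => stalk_pi (vs (val s)) (@e (val s)) q x].

Lemma total_piE p x s : total_pi p x s = stalk_pi (vs (val s)) (@e (val s)) q x.
Proof. by rewrite ffunE. Qed.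

Lemma total_piD p x y : total_pi p (cadd x y) = total_pi p x + total_pi p y.
Proof. by apply/ffunP => s; rewrite !ffunE stalk_piD. Qed.

Lemma eq_total_pi p x y : ceq x y -> total_pi p x = total_pi p y.
Proof. by move=> xy; apply/ffunP => s; rewrite !ffunE; apply: eq_stalk_pi. Qed.

Lemma total_pi_dA p y : (p < d)%N -> total_pi p (dA y) = 0.
Proof.
move=> pd; apply/ffunP => s; rewrite !ffunE; apply: stalk_pi_dA.
exact/e_rel/cell_proper.
Qed.

Lemma total_pi_eq0 p x : (p < d)%N -> psupp K p.+1 q.+1 x ->
  total_pi p x = 0 <-> ceq (dA x) (fun _ _ => 0).
Proof.
move=> pd sx; split=> [p0 A S|dx0]; last first.
  apply/ffunP => s; rewrite !ffunE.
  have /set0Pn[a as_] := vs0 (val s).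
  by apply/(stalk_pi_eq0 _ (e_rel (cell_proper s pd)) (e_basis (cell_proper s pd)) _ as_).
apply/eqP; apply: contraT => nz.
have [AS SK Sp [Aq]] := psupp_dA sx nz.
have [s sS] := K_cell SK Sp pd.
have [a aS] : exists a, a \in S by apply/card_gt0P; rewrite Sp.
have : total_pi p x s = 0 by rewrite p0 ffunE.
rewrite total_piE => s0.
rewrite -sS in aS AS nz; case/eqP: nz.
by apply: (stalk_pi_eq0 q (e_rel (cell_proper s pd)) (e_basis (cell_proper s pd)) _ aS).1 => //.
Qed.

Lemma total_pi_surj p c : (p < d)%N -> exists2 x, psupp K p.+1 q.+1 x & c = total_pi p x.
Proof.
move=> pd.
have ex (s : cells p) : exists x : {set T} -> 'F_2,
  (forall A : {set T}, x A != 0 -> A \subset vs (val s) /\ #|A| = q) /\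
  c s = stalk_pi (vs (val s)) (@e (val s)) q (fun A _ => x A).
  have /set0Pn[a as_] := vs0 (val s).
  exact: (stalk_pi_surj (e_basis (cell_proper s pd)) (c s) as_).
have [xs xsP] := choice ex.
pose x : chainfun T := fun A S =>
  if [pick s : cells p | vs (val s) == S] is Some s then xs s A else 0.
have xE A s : x A (vs (val s)) = xs s A.
  rewrite /x; case: pickP => [s' /eqP/vs_inj/val_inj->//|/(_ s)]; by rewrite eqxx.
exists x; last first.
  apply/ffunP => s; rewrite ffunE (xsP s).2; apply: eq_stalk_pi => A _ _.
  by rewrite xE.
move=> A S; rewrite /x; case: pickP => [s /eqP <- /(xsP s).1[As Aq]|_]; last by rewrite eqxx.
split=> //; [exact/vs_K/cell_proper|exact: cell_card|by rewrite Aq].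
Qed.

Lemma ext_corestr_set s t (A : {set T}) : (0 < cdim s)%N -> vs t \subset vs s -> A \subset vs s ->
  #|A| = q -> corestr Q s t (ext_set q (@e s) A) =
    if A \subset vs t then ext_set q (@e t) A else 0.
Proof.
move=> s0 ts As Aq; rewrite /= ext_map_seq ?size_map -?cardE //.
rewrite -map_comp; case: ifPn => [At|/subsetPn[a aA at_]].
  congr ext_seq; apply/eq_in_map => a; rewrite mem_enum => aA /=.
  by rewrite e_corestr ?(subsetP As) // (subsetP At).
rewrite ext_seq_mem0 ?size_map -?cardE //.
apply/mapP; exists a; first by rewrite mem_enum.
by rewrite /= e_corestr ?(subsetP As) // (negPf at_).
Qed.

(** The map to the stalk at [t] kills [e s a] for [a] outside [vs t], so only the sets [A] inside
    [vs t] survive, as in [dS]. *)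
Lemma bd_total_pi p x : (p.+1 < d)%N -> psupp K p.+2 q.+1 x ->
  bd p.+1 (total_pi p.+1 x) = total_pi p (dS x).
Proof.
move=> pd sx; have pd' := ltnW pd; apply/ffunP => t; rewrite bdP ffunE.
set P := fun s : cells p.+1 => vs (val t) \subset vs (val s).
rewrite (eq_bigl P) => [|s]; last first.
  rewrite /P -faceE; apply/andP/idP => [[]//|st]; split=> //.
  by have := cell_dim s; have := cell_dim t; lia.
pose At := fun A : {set T} => (A \subset vs (val t)) && (#|A| == q).
transitivity (\sum_(s | P s) \sum_(A | At A) x A (vs (val s)) *: ext_set q (@e (val t)) A).
  apply: eq_bigr => s Ps; rewrite total_piE /stalk_pi linear_sum /=.
  rewrite [RHS]big_mkcond [LHS]big_mkcond /=; apply: eq_bigr => A _.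
  have [/andP[As /eqP Aq]|nA] := ifPn.
    transitivity (x A (vs (val s)) *: corestr Q (val s) (val t) (ext_set q (@e (val s)) A)).
      exact: linearZ.
    rewrite (ext_corestr_set (cell_proper s pd) Ps As Aq).
    by rewrite /At Aq eqxx andbT; case: ifP; rewrite ?scaler0.
  case: ifP => // /andP[At' Aq]; case/negP: nA; rewrite Aq andbT.
  exact: subset_trans At' Ps.
rewrite exchange_big /stalk_pi /=; apply: eq_bigr => A /andP[At' Aq].
rewrite -scaler_suml; congr (_ *: _); rewrite /dS At'.
(* [Y] may contain sets that are not faces, but [x] vanishes on them; the two sums agree on the
   support of [x]. *)
pose X := [set vs (val s) | s in P]; pose Y := [set v |: vs (val t) | v in ~: vs (val t)].
transitivity (\sum_(S in X) x A S).
  by rewrite big_imset // => s s' _ _ /vs_inj/val_inj.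
transitivity (\sum_(S in Y) x A S); last first.
  rewrite big_imset /=; first by apply: eq_bigl => v; rewrite inE.
  move=> v w; rewrite !inE => vt wt /setP/(_ v); rewrite !inE eqxx (negPf vt).
  by rewrite !orbF => /esym/eqP.
rewrite [LHS]big_mkcond [RHS]big_mkcond /=; apply: eq_bigr => S _.
have [->|nz] := eqVneq (x A S) 0; first by rewrite !if_same.
have [_ SK Sp _] := sx _ _ nz; congr (if _ then _ else _).
apply/imsetP/imsetP => [[s Ps ->]|[v vt SE]].
  have : #|vs (val s) :\: vs (val t)| = 1%N.
    by rewrite cardsD (setIidPr Ps) !cell_card // subSnn.
  move=> /eqP/cards1P[v vE]; exists v.
    have : v \in vs (val s) :\: vs (val t) by rewrite vE set11.
    by rewrite !inE => /andP[].
  apply/setP => w; have /setP/(_ w) := vE; rewrite !inE.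
  by have [/(subsetP Ps)-> _|_ /= <-] := boolP (w \in vs (val t)); rewrite ?orbT ?orbF.
have [s sS] := K_cell SK Sp pd; exists s => //.
by rewrite -topredE /= /P sS SE subsetUr.
Qed.

(** Below the top this is [dSS]. From degree d to degree d - 2, all composites through the facets
    containing a ridge equal the direct map, and their number is even. *)
Lemma bd_bd p x : bd p (bd p.+1 x) = 0.
Proof.
case: p x => [|p] x; first by rewrite bd0 lfunE.
case: (ltngtP p.+2 d) => [pd|pd|pd].
- have [y sy ->] := total_pi_surj x pd.
  rewrite bd_total_pi // bd_total_pi; last exact: psupp_dS.
    apply/ffunP => s; rewrite !ffunE /stalk_pi big1 // => A _.
    by rewrite dSS scale0r.
  exact: ltnW.
- have -> : x = 0; last by rewrite !linear0.
  by apply/ffunP => s; have := cell_dim s; lia.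
have pd1 : (p.+1 < d)%N by rewrite -pd.
have pd0 : (p < d)%N by apply: ltnW.
apply/ffunP => t; rewrite ffunE bdP.
rewrite (eq_bigr (fun u : cells p.+1 => \sum_(s : cells p.+2) corestr Q (val s) (val t) (x s))).
  rewrite exchange_big big1 //= => s _.
  rewrite big_const iter_addr addr0; apply/eqP.
  rewrite -scaler_nat even_natf2 ?scale0r //.
  have -> : #|[pred u : cells p.+1 | face (val u) (val t) &&
      (cdim (val t) == (cdim (val u)).+1)]| = #|[set j | vs (val t) \subset fac j]|.
    rewrite -(card_imset (mem [set j | _]) fac_inj).
    rewrite -(card_imset _ (inj_comp vs_inj val_inj)); apply: eq_card => S.
    apply/imsetP/imsetP => [[u]|[j]]; rewrite inE.
      move=> /andP[ut _] ->; rewrite faceE in ut.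
      have := vs_K (cell_proper u pd1); rewrite KE => /existsP[j uj].
      exists j; first by rewrite inE (subset_trans ut uj).
      by apply/eqP; rewrite eqEcard uj card_fac cell_card // -pd leqnn.
    move=> tj ->.
    have jK : fac j \in K by rewrite KE; apply/existsP; exists j.
    have [|u uj] := K_cell jK _ pd1; first by rewrite card_fac.
    exists u; last by rewrite /= uj.
    rewrite inE faceE uj tj andTb.
    by have := cell_dim u; have := @cell_dim p t; rewrite /=; lia.
  apply: even_ridge; rewrite ?vs0 //; first exact/vs_K/cell_proper.
  by rewrite cell_card.
move=> u /andP[ut /eqP cu]; have bE := @bdP _ face cdim d Q p.+2 x u.
rewrite [X in corestr _ _ _ X]bE linear_sum; apply: eq_big => [s|s /andP[su _]].
  have s0 : cdim (val s) = 0%N.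
    by have := cell_dim s; lia.
  rewrite faceE (vs_top s0) subsetT s0 /=.
  by apply/eqP; have := cell_dim u; rewrite /=; lia.
by have /lfunP/(_ (x s)) := corestr_comp Q su ut; rewrite comp_lfunE.
Qed.

(** A cycle lifts to some [x] with dS x = dA y. The zigzag gives x = dS z + dA w, and the last term
    dies in the stalks. *)
Lemma homology_rank_lt p : (q < p)%N -> (p.+1 < d)%N -> dim (homology cdim d Q p) = 0%N.
Proof.
case: p => // p qp pd; have pd' := ltnW pd; have := dim_homology (@bd_bd p.+1).
suff /dimvS le : (cycles cdim d Q p.+1 <= boundaries cdim d Q p.+1)%VS.
  move=> h; apply/eqP; rewrite -leqn0 -(leq_add2r (\dim (boundaries cdim d Q p.+1))).
  by rewrite h.
apply/subvP => c; rewrite memv_ker => /eqP c0.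
have [x sx cE] := total_pi_surj c pd'; move: c0; rewrite cE bd_total_pi // => c0.
have dS0 := psupp_dS K_sub sx.
have /(dA_exact dS0)[y sy yE] := (total_pi_eq0 (ltnW pd') dS0).1 c0.
have [|z [w [sz sw xE]]] := zigzag K_sub rk_inj card_fac KE blkP rk_blk pd (ltnW qp) sx sy yE.
  by move=> qp'; move: qp; rewrite qp' ltnn.
rewrite (eq_total_pi _ xE) total_piD total_pi_dA // addr0 -bd_total_pi //.
exact: memv_img (memvf _).
Qed.

Lemma total_pi_boundary x : (q.+1 < d)%N -> psupp K q.+1 q.+1 x ->
  \sum_A \sum_S x A S = 0 -> total_pi q x \in boundaries cdim d Q q.
Proof.
move=> qd sx x0.
have [y sy yE] : exists2 y, psupp K q q y & ceq (dS x) (dA y).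
  have dS0 := psupp_dS K_sub sx.
  have dd0 : ceq (dA (dS x)) (fun _ _ => 0).
    move=> A S; apply/eqP; apply: contraT => /(psupp_dA dS0)[/subset_leq_card + _ Sq [Aq]].
    by rewrite Aq Sq ltnn.
  (* For [q] > 0 exactness of [dA] applies; for [q] = 0 the set [S] is empty and the value of [dS x]
     there is the total of [x], which is 0. *)
  move: (q) qd sx dS0 => [|q'] qd sx dS0; last by have [y sy yE] := dA_exact dS0 dd0; exists y.
  exists (fun _ _ => 0) => [A S|A S]; first by rewrite eqxx.
  rewrite [RHS](@dA_eq0 _ (fun _ _ => 0)) //; apply/eqP; apply: contraT => nz.
  have [AS SK /eqP + [/eqP]] := dS0 _ _ nz; rewrite !cards_eq0 => /eqP S0 /eqP A0.
  have sx' A' S' : x A' S' != 0 -> A' \subset S' by move=> /sx[].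
  have := total_dS sx'.
  have -> : \sum_A' \sum_S' #|S' :\: A'|%:R * x A' S' = \sum_A' \sum_S' x A' S'.
    apply: eq_bigr => A' _; apply: eq_bigr => S' _.
    have [->|/sx[AS' _ Sl [Al]]] := eqVneq (x A' S') 0; first by rewrite mulr0.
    by rewrite cardsD (setIidPr AS') Sl Al mul1r.
  rewrite x0 (bigD1 set0) //= [X in _ + X]big1 ?addr0 => [|A' A0']; last first.
    rewrite big1 // => S' _; apply/eqP; apply: contraNT A0' => /dS0[_ _ _ [/eqP]].
    by rewrite cards_eq0.
  rewrite (bigD1 set0) //= big1 ?addr0 => [|S' S0']; last first.
    by apply/eqP; apply: contraNT S0' => /dS0[_ _ /eqP]; rewrite cards_eq0.
  by move=> h; case/eqP: nz; rewrite S0 A0.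
have [//|z [w [sz sw xE]]] :=
  zigzag K_sub rk_inj card_fac KE blkP rk_blk qd (leqnn q) sx sy yE.
rewrite (eq_total_pi _ xE) total_piD total_pi_dA ?(ltnW qd) // addr0 -bd_total_pi //.
exact: memv_img (memvf _).
Qed.

Lemma bd_total_pi_low p x : p = q -> (p < d)%N -> psupp K p.+1 q.+1 x ->
  bd p (total_pi p x) = 0.
Proof.
case: p => [|p] pq pd sx; first by rewrite bd0 lfunE.
rewrite bd_total_pi //; have dS0 := psupp_dS K_sub sx.
apply/(total_pi_eq0 (ltnW pd) dS0) => A S; apply/eqP; apply: contraT.
move=> /(psupp_dA dS0)[/subset_leq_card + _ Sq [Aq]].
by rewrite Aq Sq pq ltnn.
Qed.

(** Every chain of degree [q] is a cycle. The total of a lift is well defined modulo boundaries,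
    since [dS z] and [dA w] have total 0; total 0 implies being a boundary, and a single pair has
    total 1. *)
Lemma homology_rank_eq : (q.+1 < d)%N -> dim (homology cdim d Q q) = 1%N.
Proof.
move=> qd; have qd' := ltnW qd.
have cyc : cycles cdim d Q q = fullv.
  apply/eqP; rewrite eqEsubv subvf; apply/subvP => c _; rewrite memv_ker.
  by have [x sx ->] := total_pi_surj c qd'; rewrite bd_total_pi_low.
have [S0 S0K S0q] : exists2 S0, S0 \in K & #|S0| = q.+1.
  have [j _] : exists j : J, true by exists (blk set0).
  have : (0 < #|[set A : {set T} | A \subset fac j & #|A| == q.+1]|)%N.
    by rewrite cards_draws card_fac bin_gt0.
  move=> /card_gt0P[S0]; rewrite inE => /andP[S0j /eqP S0q]; exists S0 => //.
  by rewrite KE; apply/existsP; exists j.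
have [A0 A0S A0q] : exists2 A0 : {set T}, A0 \subset S0 & #|A0| = q.
  have : (0 < #|[set A : {set T} | A \subset S0 & #|A| == q]|)%N.
    by rewrite cards_draws S0q bin_gt0.
  by move=> /card_gt0P[A0]; rewrite inE => /andP[? /eqP ?]; exists A0.
pose e0 : chainfun T := fun A S => ((A == A0) && (S == S0))%:R.
have se0 : psupp K q.+1 q.+1 e0.
  move=> A S; rewrite /e0; have [->|_] := eqVneq A A0; last by rewrite eqxx.
  have [-> _|_] := eqVneq S S0; last by rewrite eqxx.
  by rewrite A0q.
have te0 : \sum_A \sum_S e0 A S = 1.
  rewrite (bigD1 A0) //= [X in _ + X]big1 ?addr0 => [|A /negPf AN]; last first.
    by rewrite big1 // => S _; rewrite /e0 AN.
  rewrite (bigD1 S0) //= big1 ?addr0 => [|S /negPf SN]; first by rewrite /e0 !eqxx.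
  by rewrite /e0 SN andbF.
set c0 := total_pi q e0; set B := boundaries cdim d Q q.
have c0B : c0 \notin B.
  apply/negP => /memv_imgP[c' _ c0E].
  have [z sz cE] := total_pi_surj c' qd.
  rewrite cE bd_total_pi // in c0E.
  have s1 : psupp K q.+1 q.+1 (cadd e0 (dS z)).
    by apply: psuppD => //; apply: psupp_dS.
  have p0 : total_pi q (cadd e0 (dS z)) = 0 by rewrite total_piD -c0E addvv2.
  have /(dA_exact s1)[w sw wE] := (total_pi_eq0 qd' s1).1 p0.
  (* For |S| = k + 2 and |A| = k the weight |S \ A| is 2, which is 0 in F_2. *)
  have two (f : chainfun T) k a : psupp K k.+2 a f -> (a = k.+1)%N ->
      \sum_A \sum_S #|S :\: A|%:R * f A S = 0.
    move=> sf ak; rewrite big1 // => A _; rewrite big1 // => S _.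
    have [->|/sf[AS _ Sl]] := eqVneq (f A S) 0; first by rewrite mulr0.
    by rewrite ak => -[Ak]; rewrite cardsD (setIidPr AS) Sl Ak subSn // subSnn even_natf2 ?mul0r.
  have sub k a (f : chainfun T) : psupp K k a f -> forall A S, f A S != 0 -> A \subset S.
    by move=> sf A S /sf[].
  have t1 : \sum_A \sum_S cadd e0 (dS z) A S = 1.
    rewrite /cadd; under eq_bigr do rewrite big_split /=.
    by rewrite big_split /= te0 (total_dS (sub _ _ _ sz)) (two _ _ _ sz) ?addr0.
  have t2 : \sum_A \sum_S dA w A S = 0.
    rewrite (total_dA (sub _ _ _ sw)); move: (q) sw => [|q'] sw; last exact: two sw _.
    rewrite big1 // => A _; rewrite big1 // => S _.
    by have [->|/sw[]//] := eqVneq (w A S) 0; rewrite mulr0.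
  have : \sum_A \sum_S cadd e0 (dS z) A S = \sum_A \sum_S dA w A S.
    by apply: eq_bigr => A _; apply: eq_bigr => S _; rewrite wE.
  by rewrite t1 t2 => /eqP; rewrite oner_eq0.
have full : (B + <[c0]>)%VS = fullv.
  apply/eqP; rewrite eqEsubv subvf; apply/subvP => c _.
  have [x sx ->] := total_pi_surj c qd'.
  have [x0|/eq1f2 x1] := eqVneq (\sum_A \sum_S x A S) 0.
    by apply: subvP (addvSl _ _) _ _; apply: total_pi_boundary.
  have h : total_pi q (cadd x e0) \in B.
    apply: total_pi_boundary => //; first exact: psuppD.
    rewrite /cadd; under eq_bigr do rewrite big_split /=.
    by rewrite big_split /= te0 x1 addff2.
  rewrite -[total_pi q x]addr0 -[X in _ + X](addvv2 c0) addrA -total_piD.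
  by rewrite memv_add ?memv_line.
have := dim_homology (@bd_bd q); rewrite cyc -full dimv_disjoint_sum.
  rewrite dim_vline addnC => /addnI ->.
  by case: eqP c0B => // ->; rewrite mem0v.
apply/eqP; rewrite -subv0; apply/subvP => c; rewrite memv_cap => /andP[cB /vlineP[k ck]].
move: cB; rewrite ck; have [->|/eq1f2->] := eqVneq k 0; first by rewrite scale0r !mem0v.
by rewrite scale1r (negPf c0B).
Qed.

Lemma dim_chains_ext p : dim (chains p) = (#|{: cells p}| * 'C(p, q))%N.
Proof.
rewrite dim_chains (eq_bigr (fun=> 'C(p, q))) => [|s /eqP sp].
  rewrite sum_nat_const; congr (_ * _)%N; rewrite card_sig; exact: eq_card.
rewrite dim_ext_power; congr 'C(_, _).
by apply/(@addnI (cdim s)); rewrite addnC dim_stalk sp.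
Qed.

(** The ranks of the boundary maps telescope. The lower end vanishes because the [q]-th exterior
    power of a space of dimension q - 1 is 0, the upper end because there are no cells in degree d +
    1. *)
Lemma euler_characteristic : (q <= d)%N ->
  \sum_(q <= p < d.+1) (-1) ^+ p * (dim (homology cdim d Q p))%:R =
  \sum_(q <= p < d.+1) (-1) ^+ p * (#|{: cells p}| * 'C(p, q))%:R :> int.
Proof.
move=> qd; pose r p := \dim (limg (bd p)).
have hE p : dim (chains p) = (dim (homology cdim d Q p) + r p.+1 + r p)%N.
  by rewrite -(dim_bd _ _ _ p) -(dim_homology (@bd_bd p)).
have rq : r q = 0%N.
  rewrite /r; case: (posnP q) => [->|q0].
    by rewrite bd0 lim0g dimv0.
  apply/eqP; rewrite -leqn0; apply: leq_trans (dimvS (subvf _)) _.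
  by rewrite dimvf dim_chains_ext bin_small ?muln0 // prednK.
have rd : r d.+1 = 0%N.
  have c0 : #|{: cells d.+1}| = 0%N by apply: eq_card0 => s; have := cell_dim s; lia.
  have /eqP := dim_bd cdim d Q d.+1; rewrite dim_chains_ext c0 mul0n addn_eq0.
  by move=> /andP[_ /eqP].
have tele : forall m, (q <= m)%N ->
  \sum_(q <= p < m) (-1) ^+ p * (dim (homology cdim d Q p))%:R - (-1) ^+ m * (r m)%:R =
  \sum_(q <= p < m) (-1) ^+ p * (dim (chains p))%:R :> int.
  elim=> [|m IH]; first by rewrite leqn0 => /eqP q0; rewrite q0 in rq *; rewrite !big_geq // rq mulr0 subr0.
  rewrite leq_eqVlt => /predU1P[qm|]; first by rewrite -qm rq !big_geq // mulr0 subr0.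
  rewrite ltnS => qm; rewrite !big_nat_recr //= -IH // hE !natrD exprS !mulrDr.
  ring.
have := tele d.+1 (leqW qd); rewrite rd mulr0 subr0 => ->.
by apply: eq_bigr => p _; rewrite dim_chains_ext.
Qed.

End AbstractFan.

(** * Homology in the top degree *)

(** The relation rewrites the factor [b k] as a sum of other factors, each of which then occurs
    twice. *)
Lemma ext_set_dependent q (V : vectType 'F_2) (T : finType) (b : T -> V) (A B : {set T})
    (c : T -> 'F_2) k : #|A| = q -> B \subset A -> \sum_(i in B) c i *: b i = 0 ->
  k \in B -> c k != 0 -> ext_set q b A = 0.
Proof.
case: q => [|q] Aq BA cB kB ck; first by move: (subsetP BA _ kB); rewrite (cards0_eq Aq) inE.
have kA := subsetP BA _ kB.
rewrite -(ext_set_perm (l := k :: enum (A :\ k)) b); first last.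
- by apply/setP => t; rewrite !inE mem_enum !inE; case: eqVneq => [->|].
- by rewrite /= -cardE -[RHS]Aq (cardsD1 k A) kA.
- by rewrite /= mem_enum !inE eqxx enum_uniq.
have sz : size (map b (enum (A :\ k))) = q.
  by rewrite size_map -cardE; apply/eqP; rewrite -eqSS -Aq (cardsD1 k A) kA.
rewrite /=; have -> : b k = \sum_(i in B :\ k) c i *: b i.
  move: cB; rewrite (big_setD1 k) //= (eq1f2 ck) scale1r => /eqP.
  by rewrite addr_eq0 oppvv2 => /eqP.
rewrite ext_seq_sum // big1 // => i; rewrite !inE => /andP[ik iB].
have [->|/eq1f2->] := eqVneq (c i) 0.
  by rewrite scale0r ext_seq_mem0 ?mem_head //= sz.
rewrite scale1r ext_seq_dup //=; first by rewrite sz.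
by rewrite map_f // mem_enum !inE ik (subsetP BA).
Qed.

Lemma independentS (K : fieldType) (V : vectType K) (T : finType) (A B : {set T}) (b : T -> V) :
  A \subset B -> independent B b -> independent A b.
Proof.
move=> AB ind c c0 i iA.
have := ind (fun t => if t \in A then c t else 0); rewrite (big_setID A) /=.
rewrite (setIidPr AB) [X in X + _](eq_bigr (fun t => c t *: b t)); last by move=> t ->.
rewrite c0 add0r big1 => [/(_ erefl i (subsetP AB _ iA))|t]; first by rewrite iA.
by rewrite inE => /andP[/negPf-> _]; rewrite scale0r.
Qed.

Lemma independent_extend (K : fieldType) (V : vectType K) (T : finType) (S0 B : {set T})
    (b : T -> V) : S0 \subset B -> independent S0 b ->
  exists S : {set T}, [/\ S0 \subset S, S \subset B, independent S b &
    forall t, t \in B -> b t \in <<family S b>>%VS].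
Proof.
move=> S0B ind0.
pose P (S : {set T}) := [&& S0 \subset S, S \subset B & `[< independent S b >]].
have P0 : P S0 by rewrite /P subxx S0B; apply/asboolP.
have [S /and3P[S0S SB /asboolP indS] maxS] := arg_maxnP (fun S : {set T} => #|S|) P0.
exists S; split=> // t tB.
have famS i : i \in S -> b i \in <<family S b>>%VS.
  move=> iS; rewrite -(enum_rankK_in iS iS) -family_nth.
  by apply/memv_span/mem_nth; rewrite size_tuple.
have [tS|tS] := boolP (t \in S); first exact: famS.
have : ~ independent (t |: S) b.
  move=> ind; have := maxS (t |: S); rewrite /P (subset_trans S0S (subsetUr _ _)).
  rewrite subUset sub1set tB SB /= => /(_ (asboolT ind)).
  by rewrite /= cardsU1 tS ltnn.
move=> nind; apply: contrapT => /negP nt; apply: nind => c.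
rewrite big_setU1 //= => c0.
have ct : c t = 0.
  apply/eqP; apply: contraT => ct; case/negP: nt.
  have -> : b t = - (c t)^-1 *: \sum_(i in S) c i *: b i.
    move/eqP: c0; rewrite addrC addr_eq0 => /eqP ->.
    by rewrite scalerN scaleNr opprK scalerA mulVf // scale1r.
  by apply/memvZ/memv_suml => i iS; apply/memvZ/famS.
move=> i; rewrite !inE => /predU1P[->//|iS]; apply: indS => //.
by move: c0; rewrite ct scale0r add0r.
Qed.

Section ExtKernel.
Variables (q : nat) (V : vectType 'F_2) (I : finType) (P : pred I).
Variables (W : I -> vectType 'F_2) (f : forall t, 'Hom(V, W t)) (nu : I -> V).
Hypothesis ker_f : forall t, P t -> lker (f t) = <[nu t]>%VS.
Hypothesis nu0 : forall t, P t -> nu t != 0.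

Lemma ext_kernel_dim (Z : {vspace ext_power q V}) :
  (forall x, x \in Z <-> forall t, P t -> ext_map q (f t) x = 0) ->
  let s := \dim (\sum_(t | P t) <[nu t]>)%VS in
  \dim Z = if (s <= q)%N then 'C(dim V - s, q - s) else 0%N.
Proof.
move=> ZP s.
have [b0 [phi0 [dual0 crd0]]] := dual_basis_exists V.
(* The vectors [nu t] and a basis of [V] form one family, from which [S0] and then the basis [S1]
   are extracted. *)
pose T := (I + 'I_(dim V))%type.
pose g (t : T) : V := match t with inl t => nu t | inr i => b0 i end.
have ind0 : independent (set0 : {set T}) g by move=> c _ i; rewrite inE.
have [S0 [_ S0P indS0 spS0]] := independent_extend (sub0set [set t | if t is inl i then P i else false]) ind0.
have [S1 [S01 _ indS1 spS1]] := independent_extend (subsetT S0) indS0.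
have [phi [dual crd']] := independent_dualized indS1.
have crd : coordinatized S1 g phi.
  move=> x; apply: crd'; rewrite (crd0 x).
  apply: memv_suml => i _; apply/memvZ.
  by have := spS1 (inr i); apply; rewrite inE.
have cardS1 : #|S1| = dim V by exact: esym (coordinatized_dim dual crd).
have cardS0 : #|S0| = s.
  have /independent_free := indS0; rewrite /free size_tuple => /eqP <-.
  congr (\dim _); apply/eqP; rewrite eqEsubv; apply/andP; split.
    apply/span_subvP => _ /tnthP[i ->]; rewrite tnth_mktuple.
    have := subsetP S0P _ (enum_valP i); rewrite inE; case: (enum_val i) => // t Pt.
    by rewrite memvE; apply: (sumv_sup t).
  apply/subv_sumP => t Pt; rewrite -memvE.
  by apply: (spS0 (inl t)); rewrite inE.
have [psi [dpsi cpsi]] := ext_coordinatized q dual crd.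
set BB := [set A | _] in dpsi cpsi.
pose BB' := [set A in BB | S0 \subset A].
have BB'B : BB' \subset BB by apply/subsetP => A; rewrite inE => /andP[].
have mapE t (A : {set T}) : #|A| = q -> ext_map q (f t) (ext_set q g A) = ext_set q (f t \o g) A.
  by move=> Aq; rewrite /ext_set ext_map_seq ?size_map -?cardE // -map_comp.
have eZ A : A \in BB' -> ext_set q g A \in Z.
  rewrite !inE => /andP[/andP[AS1 /eqP Aq] S0A]; apply/ZP => t Pt; rewrite mapE //.
  have tS0 : nu t \in <<family S0 g>>%VS by apply: (spS0 (inl t)); rewrite inE.
  have [phi' [_ /(_ _ tS0) nuE]] := independent_dualized indS0.
  have [k kS0 ck] : exists2 k, k \in S0 & phi' k (nu t) != 0.
    apply: contrapT => no; have := nu0 Pt; rewrite nuE big1 ?eqxx // => i iS0.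
    have -> : phi' i (nu t) = 0; last by rewrite scale0r.
    by apply/eqP; apply: contrapT => /negP nz; apply: no; exists i.
  apply: (ext_set_dependent Aq S0A (c := fun i => phi' i (nu t)) _ kS0 ck).
  transitivity (f t (\sum_(i in S0) phi' i (nu t) *: g i)).
    by rewrite linear_sum; apply: eq_bigr => i _; rewrite linearZ.
  by rewrite -nuE; apply/eqP; rewrite -memv_ker ker_f // memv_line.
(* If [A] misses the element [inl t] of [S0], the other basis vectors stay independent under [f t],
   so the coefficient at [A] can be read off the image of [x], which is 0. *)
have Zpsi x A : x \in Z -> A \in BB -> A \notin BB' -> psi A x = 0.
  move=> xZ AB; rewrite inE AB /= => /subsetPn[k kS0 kA].
  have := subsetP S0P _ kS0; rewrite inE; case: k kS0 kA => // t tS0 tA Pt.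
  have indf : independent (S1 :\ inl t) (f t \o g).
    move=> c; set u := \sum_(i in S1 :\ inl t) c i *: g i.
    have -> : \sum_(i in S1 :\ inl t) c i *: (f t \o g) i = f t u.
      by rewrite linear_sum; apply: eq_bigr => i _; rewrite linearZ.
    move=> /eqP; rewrite -memv_ker ker_f // => /vlineP[k uk] i.
    rewrite !inE => /andP[it iS1].
    have := indS1 (fun j => if j == inl t then - k else c j).
    rewrite (big_setD1 (inl t)) ?(subsetP S01) //= eqxx.
    rewrite [X in _ + X](eq_bigr (fun j => c j *: g j)); last first.
      by move=> j; rewrite !inE => /andP[/negPf->].
    rewrite -/u uk scaleNr addNr => /(_ erefl i iS1).
    by rewrite (negPf it).
  have [phi' [dual' _]] := independent_dualized indf.
  have [psi' dpsi'] := ext_dualized q dual'.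
  have AB' : A \in [set A : {set T} | A \subset S1 :\ inl t & #|A| == q].
    by move: AB; rewrite !inE subsetD1 tA andbT.
  rewrite -(dualized_sum (fun A => psi A x) dpsi' AB').
  have /ZP/(_ t Pt) fx := xZ.
  rewrite [X in psi' A X](_ : _ = ext_map q (f t) x); first by rewrite fx linear0.
  rewrite [in RHS](cpsi x) linear_sum /= [RHS](bigID (fun A : {set T} => inl t \in A)) /=.
  rewrite [X in _ = X + _]big1 ?add0r => [|C /andP[]]; last first.
    rewrite inE => /andP[CS1 /eqP Cq] tC; rewrite linearZ /= mapE //.
    rewrite /ext_set ext_seq_mem0 ?scaler0 ?size_map -?cardE //.
    apply/mapP; exists (inl t); rewrite ?mem_enum //=.
    by apply/esym/eqP; rewrite -memv_ker ker_f // memv_line.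
  apply: eq_big => [C|C]; first by rewrite !inE subsetD1 -!andbA; do !bool_congr.
  by rewrite inE => /andP[_ /eqP Cq]; rewrite linearZ /= mapE.
have indB : independent BB' (ext_set q g).
  by apply: independentS BB'B _; apply: dualized_independent dpsi.
have -> : Z = <<family BB' (ext_set q g)>>%VS.
  apply/eqP; rewrite eqEsubv; apply/andP; split; last first.
    by apply/span_subvP => _ /tnthP[i ->]; rewrite tnth_mktuple; apply/eZ/enum_valP.
  apply/subvP => x xZ; rewrite (cpsi x) (big_setID BB') /= (setIidPr BB'B).
  rewrite [X in _ + X]big1 ?addr0 => [|A]; last first.
    by rewrite inE => /andP[AN AB]; rewrite Zpsi // scale0r.
  rewrite big_enum_val; apply: memv_suml => i _; apply/memvZ.
  by rewrite -family_nth; apply/memv_span/mem_nth; rewrite size_tuple.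
have /independent_free := indB; rewrite /free => /eqP ->; rewrite size_tuple.
case: leqP => [sq|qs]; last first.
  apply: eq_card0 => A; rewrite !inE; apply/negP => /andP[/andP[_ /eqP Aq]].
  by move=> /subset_leq_card; rewrite cardS0 Aq leqNgt qs.
have -> : (dim V - s = #|S1 :\: S0|)%N by rewrite cardsD (setIidPr S01) cardS1 cardS0.
rewrite -cards_draws -(card_in_imset (f := fun A => A :\: S0) (D := mem BB')).
  apply: eq_card => C; rewrite inE; apply/imsetP/andP => [[A]|[CS /eqP Cq]].
    rewrite !inE => /andP[/andP[AS1 /eqP Aq] S0A] ->.
    by rewrite setSD // cardsD (setIidPr S0A) cardS0 Aq.
  have CS0 : C :&: S0 = set0.
    apply/setP => t; rewrite !inE; apply/andP => -[tC tS0].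
    by have := subsetP CS _ tC; rewrite inE tS0.
  exists (C :|: S0); last by rewrite setDUl setDv setU0; apply/esym/setDidPl; rewrite -setI_eq0 CS0.
  rewrite !inE subUset S01 subsetUr (subset_trans CS (subsetDl _ _)) /= andbT.
  by rewrite cardsU CS0 cards0 subn0 Cq cardS0 subnK.
move=> A C; rewrite !inE => /andP[_ SA] /andP[_ SC] e.
by rewrite -(setID A S0) -(setID C S0) e (setIidPr SA) (setIidPr SC).
Qed.

End ExtKernel.

(** Degree d has the single cell [s0] and degree d + 1 has none, so the homology is the common
    kernel of the maps to the rays. *)
Lemma top_homology (I : finType) (face : rel I) (cdim : I -> nat) (d : nat)
    (F : cosheaf face) (s0 : I) :
  cdim s0 = 0%N -> (forall s, cdim s = 0%N -> s = s0) -> (forall s, face s0 s) ->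
  (forall s, (cdim s <= d)%N) ->
  exists2 Z : {vspace stalk F s0}, dim (homology cdim d F d) = \dim Z &
    forall x, x \in Z <-> forall t, cdim t = 1%N -> corestr F s0 t x = 0.
Proof.
move=> c0 uniq0 face0 cd.
have sd : (cdim s0 + d == d)%N by rewrite c0.
pose s0' : cells cdim d d := Sub s0 sd.
have all0 (s : cells cdim d d) : s = s0'.
  by apply/val_inj/uniq0; have := valP s; rewrite /=; lia.
have evl : linear (fun x : chains cdim d F d => x s0').
  by move=> a x y; rewrite dsum_linE.
pose ev0 : {linear chains cdim d F d -> stalk F s0} :=
  HB.pack (fun x : chains cdim d F d => x s0') (GRing.isLinear.Build _ _ _ _ _ evl).
pose ev := linfun ev0.
have evE x : ev x = x s0' by rewrite lfunE.
have evi : lker ev = 0%VS.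
  apply/eqP; rewrite -subv0; apply/subvP => x; rewrite memv_ker evE => /eqP x0.
  rewrite memv0; apply/eqP/ffunP => s; rewrite [RHS]ffunE.
  by rewrite (all0 s).
have evs y : exists x, y = ev x.
  have : y \in limg ev.
    suff -> : limg ev = fullv by rewrite memvf.
    apply/eqP; rewrite eqEdim subvf limg_dim_eq ?evi ?capv0 // !dimvf dim_chains.
    rewrite (big_pred1 s0) ?leqnn // => s; rewrite -[X in _ == X]add0n eqn_add2r.
    by apply/eqP/eqP => [/uniq0|->].
  by move=> /memv_imgP[x _ ->]; exists x.
exists (ev @: cycles cdim d F d)%VS.
  rewrite limg_dim_eq ?evi ?capv0 //.
  have z0 : forall x : chains cdim d F d.+1, x = 0.
    by move=> x; apply/ffunP => s; have := valP s; rewrite /=; lia.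
  have bb x : bd cdim d F d (bd cdim d F d.+1 x) = 0 by rewrite (z0 x) !linear0.
  rewrite -(dim_homology bb) [X in (_ + X)%N](_ : _ = 0%N) ?addn0 //.
  apply/eqP; rewrite dimv_eq0 -subv0; apply/subvP => _ /memv_imgP[x _ ->].
  by rewrite (z0 x) linear0 mem0v.
move=> y; have [x ->] := evs y; split.
  move=> /memv_imgP[x' x'Z]; rewrite !evE => -> t t1.
  move: x'Z; rewrite memv_ker => /eqP x'0.
  have d0 : (0 < d)%N by rewrite -t1.
  have td : (cdim t + d.-1 == d)%N by rewrite t1 add1n prednK.
  have := bdP x' (Sub t td); rewrite x'0 ffunE (big_pred1 s0') //= => s.
  by rewrite (all0 s) /= face0 t1 c0 !eqxx.
move=> h; apply: memv_img; rewrite memv_ker; apply/eqP/ffunP => t; rewrite bdP ffunE.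
rewrite big1 // => s; rewrite (all0 s) /= c0 => /andP[_ /eqP t1].
by rewrite -evE h.
Qed.

(** * Lattices and duality *)

Definition dot (K : pzRingType) d (m n : 'rV[K]_d) : K := \sum_i m 0 i * n 0 i.

Section Dot.
Variables (K : comNzRingType) (d : nat).
Implicit Types (m n x y : 'rV[K]_d).

Lemma dotC m n : dot m n = dot n m.
Proof. by apply: eq_bigr => i _; rewrite mulrC. Qed.

Lemma dotDl m x y : dot (x + y) m = dot x m + dot y m.
Proof. by rewrite -big_split /=; apply: eq_bigr => i _; rewrite mxE mulrDl. Qed.

Lemma dotZl m a x : dot (a *: x) m = a * dot x m.
Proof. by rewrite mulr_sumr; apply: eq_bigr => i _; rewrite mxE mulrA. Qed.

Lemma dotDr m x y : dot m (x + y) = dot m x + dot m y.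
Proof. by rewrite dotC dotDl !(dotC m). Qed.

Lemma dotZr m a x : dot m (a *: x) = a * dot m x.
Proof. by rewrite dotC dotZl (dotC m). Qed.

Lemma dotNl m x : dot (- x) m = - dot x m.
Proof. by rewrite -scaleN1r dotZl mulN1r. Qed.

Lemma dotNr m x : dot m (- x) = - dot m x.
Proof. by rewrite dotC dotNl dotC. Qed.

Lemma dotBl m x y : dot (x - y) m = dot x m - dot y m.
Proof. by rewrite dotDl dotNl. Qed.

Lemma dotBr m x y : dot m (x - y) = dot m x - dot m y.
Proof. by rewrite dotDr dotNr. Qed.

Lemma dot0l m : dot 0 m = 0.
Proof. by rewrite -(scale0r 0) dotZl mul0r. Qed.

Lemma dot0r m : dot m 0 = 0.
Proof. by rewrite dotC dot0l. Qed.

Lemma dot_suml (I : Type) (r : seq I) (P : pred I) (F : I -> 'rV[K]_d) m :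
  dot (\sum_(i <- r | P i) F i) m = \sum_(i <- r | P i) dot (F i) m.
Proof. by apply: (big_morph (fun x => dot x m)); [exact: dotDl | exact: dot0l]. Qed.

Lemma dot_sumr (I : Type) (r : seq I) (P : pred I) (F : I -> 'rV[K]_d) m :
  dot m (\sum_(i <- r | P i) F i) = \sum_(i <- r | P i) dot m (F i).
Proof. by rewrite dotC dot_suml; apply: eq_bigr => i _; rewrite dotC. Qed.

Lemma dot_mulmx m n : dot m n = (m *m n^T) 0 0.
Proof. by rewrite mxE; apply: eq_bigr => i _; rewrite mxE. Qed.

End Dot.

Lemma dot_map (A B : comNzRingType) (f : {rmorphism A -> B}) d (m n : 'rV[A]_d) :
  dot (map_mx f m) (map_mx f n) = f (dot m n).
Proof. by rewrite rmorph_sum; apply: eq_bigr => i _; rewrite !mxE rmorphM. Qed.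

Lemma dot_sq_gt0 (R : realDomainType) d (x : 'rV[R]_d) : x != 0 -> 0 < dot x x.
Proof.
move=> x0; rewrite lt_def sumr_ge0 ?andbT => [|i _]; last exact: sqr_ge0.
apply: contra x0 => /eqP e; apply/eqP/rowP => i; rewrite mxE.
have /eqP := psumr_eq0P (fun j _ => sqr_ge0 (x 0 j)) e (i := i) isT.
by rewrite sqrf_eq0 => /eqP.
Qed.

(** * Annihilators under the dot product *)

Section Perp.
Variables (K : fieldType) (d : nat) (T : finType) (b : T -> 'rV[K]_d).

Lemma dot_dual (B : {set T}) (c : T -> K) : independent B b ->
  exists x, forall i, i \in B -> dot (b i) x = c i.
Proof.
move=> ind; pose M := \matrix_(i < #|B|, j < d) b (enum_val i) 0 j.
have Mrow i : row i M = b (enum_val i) by apply/rowP => j; rewrite !mxE.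
have /row_freeP[C MC] : row_free M.
  apply: inj_row_free => v v0; apply/rowP => i; rewrite mxE.
  have [c' cE] := extend_enum 0 (fun j => v 0 j).
  rewrite -cE; apply: ind (enum_valP _); rewrite big_enum_val -[RHS]v0 mulmx_sum_row.
  by apply: eq_bigr => j _; rewrite cE Mrow.
exists (C *m \col_i c (enum_val i))^T => t tB.
rewrite -(enum_rankK_in tB tB) -Mrow; set i := enum_rank_in _ _.
by rewrite dot_mulmx trmxK -row_mul mulmxA MC mul1mx !mxE.
Qed.

Lemma dot_row (B : {set T}) : exists f : 'Hom('rV[K]_d, 'rV[K]_#|B|),
  forall x, f x = \row_i dot (b (enum_val i)) x.
Proof.
have fl : linear (fun x : 'rV[K]_d => \row_(i < #|B|) dot (b (enum_val i)) x).
  by move=> a x y; apply/rowP => i; rewrite !mxE dotDr dotZr.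
pose f : {linear 'rV[K]_d -> 'rV[K]_#|B|} :=
  HB.pack (fun x : 'rV[K]_d => \row_(i < #|B|) dot (b (enum_val i)) x)
   (GRing.isLinear.Build _ _ _ _ _ fl).
by exists (linfun f) => x; rewrite lfunE.
Qed.

Lemma dot_row_eq0 (B : {set T}) x :
  \row_(i < #|B|) dot (b (enum_val i)) x = 0 <-> forall i, i \in B -> dot (b i) x = 0.
Proof.
split=> [x0 i iB|x0]; last by apply/rowP => i; rewrite !mxE x0 // enum_valP.
by have /rowP/(_ (enum_rank_in iB i)) := x0; rewrite !mxE enum_rankK_in.
Qed.

Lemma perp_exists (B : {set T}) : exists X : {vspace 'rV[K]_d},
  forall x, x \in X <-> forall i, i \in B -> dot (b i) x = 0.
Proof.
have [f fE] := dot_row B; exists (lker f) => x.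
by rewrite memv_ker fE -dot_row_eq0; split=> /eqP.
Qed.

Lemma perp_dim (B : {set T}) (X : {vspace 'rV[K]_d}) : independent B b ->
  (forall x, x \in X <-> forall i, i \in B -> dot (b i) x = 0) ->
  (\dim X + #|B| = d)%N.
Proof.
move=> ind XP.
have [f fE] := dot_row B.
have dimrV n : \dim {: 'rV[K]_n} = n by rewrite dimvf /dim /= mul1n.
have -> : X = lker f.
  apply/vspaceP => x; rewrite memv_ker fE.
  by apply/idP/eqP => [/XP/dot_row_eq0|/dot_row_eq0/XP].
rewrite -[RHS]dimrV -(limg_ker_dim f fullv) capfv; congr (_ + _)%N.
suff -> : limg f = fullv by rewrite dimrV.
apply/vspaceP => y; rewrite memvf.
have [c cE] := extend_enum 0 (fun j => y 0 j).
have [x xP] := dot_dual c ind.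
suff -> : y = f x by apply: memv_img; rewrite memvf.
by rewrite fE; apply/rowP => i; rewrite mxE xP ?cE // enum_valP.
Qed.

Lemma perp_dim_span (B : {set T}) (X W : {vspace 'rV[K]_d}) :
  (forall i, i \in B -> b i \in W) ->
  (forall W' : {vspace 'rV[K]_d}, (forall i, i \in B -> b i \in W') -> (W <= W')%VS) ->
  (forall x, x \in X <-> forall i, i \in B -> dot (b i) x = 0) ->
  (\dim X + \dim W = d)%N.
Proof.
move=> BW Wmin XP.
have ind0 : independent (set0 : {set T}) b by move=> c _ i; rewrite inE.
have [S [_ SB ind sp]] := independent_extend (sub0set B) ind0.
have -> : W = <<family S b>>%VS.
  apply/eqP; rewrite eqEsubv; apply/andP; split; first exact: Wmin.
  apply/span_subvP => _ /tnthP[i ->]; rewrite tnth_mktuple.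
  exact/BW/(subsetP SB)/enum_valP.
have /independent_free := ind; rewrite /free size_tuple => /eqP ->.
apply: (perp_dim ind) => x; rewrite XP; split=> h i iS; first exact/h/(subsetP SB).
have [phi [_ crd]] := independent_dualized ind.
by rewrite (crd _ (sp _ iS)) dot_suml big1 // => j jS; rewrite dotZl h // mulr0.
Qed.

End Perp.

Lemma unitmx_independent (K : fieldType) d (A : 'M[K]_d) (B : {set 'I_d}) :
  A \in unitmx -> independent B (fun i => row i A).
Proof.
move=> Au; apply: (independentS (subsetT B)) => c c0 i _.
have : (\row_j c j) *m A = 0.
  by rewrite mulmx_sum_row -[RHS]c0; apply: eq_big => [j|j _]; rewrite ?inE // mxE.
move=> /(congr1 (mulmx^~ (invmx A))); rewrite mulmxK // mul0mx => /rowP/(_ i).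
by rewrite !mxE.
Qed.

Lemma map_unitmx_int (K : fieldType) d (A : 'M[int]_d) :
  A \in unitmx -> (map_mx intr A : 'M[K]_d) \in unitmx.
Proof.
move=> Au; have : (map_mx intr A : 'M[K]_d) *m map_mx intr (invmx A) = 1%:M.
  by rewrite -map_mxM mulmxV // map_mx1.
by case/mulmx1_unit.
Qed.

Lemma intr_natF2 (a : 'F_2) : ((a : nat)%:Z)%:~R = a.
Proof. by rewrite -pmulrn natr_Zp. Qed.

(* Smith normal form: over a field, the integral kernel is cut out by the rows of a unimodular
   matrix that carry a nonzero elementary divisor. *)
Lemma int_kernel_dim (R : realFieldType) k d (A : 'M[int]_(k, d))
    (X : {vspace 'rV[R]_d}) (Y : {vspace 'rV['F_2]_d}) :
  (forall x, x \in X <-> map_mx intr A *m x^T = 0) ->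
  (forall y, y \in Y <-> exists2 v : 'rV[int]_d, A *m v^T = 0 & y = map_mx intr v) ->
  \dim X = \dim Y.
Proof.
move=> XP YP; have [L Lu [Q Qu [dd _ AE]]] := int_Smith_normal_form A.
set D := \matrix_(i, j) _ in AE.
pose J := [set j : 'I_d | (j < k)%N && (dd`_j != 0)].
have kerD (K : numDomainType) (y : 'cV[K]_d) : map_mx intr D *m y = 0 <->
    forall j, j \in J -> y j 0 = 0.
  have DE i : (map_mx intr D *m y) i 0 = \sum_(j < d | i == j :> nat) (dd`_i)%:~R * y j 0.
    rewrite mxE [RHS]big_mkcond; apply: eq_bigr => j _; rewrite !mxE.
    by case: eqP; rewrite ?mulr1n // mulr0n mul0r.
  split=> [y0 j|y0].
    rewrite inE => /andP[jk dj]; have := DE (Ordinal jk); rewrite y0 mxE (big_pred1 j) //=.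
    by move=> /esym/eqP; rewrite mulf_eq0 intr_eq0 (negPf dj) => /eqP.
  apply/colP => i; rewrite DE mxE big1 // => j /eqP ij.
  have [->|di] := eqVneq dd`_i 0; first by rewrite mul0r.
  by rewrite y0 ?mulr0 // inE -ij ltn_ord di.
have kerA (K : numDomainType) (x : 'rV[K]_d) : map_mx intr A *m x^T = 0 <->
    forall j, j \in J -> dot (row j (map_mx intr Q)) x = 0.
  have rowE j : dot (row j (map_mx intr Q)) x = (map_mx intr Q *m x^T) j 0.
    by rewrite dot_mulmx -row_mul mxE.
  rewrite AE !map_mxM -!mulmxA.
  split=> [x0 j jJ|x0].
    rewrite rowE; move: j jJ; apply/kerD.
    rewrite -[LHS]mul1mx -(map_mx1 intr) -(mulVmx Lu) map_mxM -mulmxA x0.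
    by rewrite mulmx0.
  have -> : map_mx intr D *m (map_mx intr Q *m x^T) = 0 :> 'cV[K]_k.
    by apply/kerD => j jJ; rewrite -rowE x0.
  by rewrite mulmx0.
have dX := perp_dim (unitmx_independent (B := J) (map_unitmx_int R Qu)) (X := X).
have dY := perp_dim (unitmx_independent (B := J) (map_unitmx_int 'F_2 Qu)) (X := Y).
apply/(@addIn #|J|); rewrite dX => [|x]; last by rewrite XP kerA.
rewrite dY // => y; rewrite YP; split=> [[v v0 ->] j jJ|y0].
  have /kerA/(_ j jJ) : map_mx intr A *m v^T = 0 :> 'cV[int]_k.
    by rewrite (_ : map_mx intr A = A) //; apply/matrixP => a b; rewrite mxE intz.
  rewrite (_ : map_mx intr Q = Q); last by apply/matrixP => a b; rewrite mxE intz.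
  move=> v1; rewrite -map_row dot_map.
  by rewrite v1.
(* An integral lift of Q y with entries 0 and 1. Its entries at [J] are exactly 0, so its preimage
   under [Q] is an integral kernel vector reducing to [y]. *)
pose z : 'cV[int]_d := \col_j ((dot (row j (map_mx intr Q)) y : 'F_2) : nat)%:Z.
exists (invmx Q *m z)^T.
  rewrite trmxK AE -!mulmxA mulKVmx //.
  have -> : D *m z = 0; last by rewrite mulmx0.
  rewrite -[D](_ : map_mx intr D = D); last by apply/matrixP => a b; rewrite !mxE intz.
  by apply/kerD => j jJ; rewrite mxE y0.
have zE : map_mx intr z = map_mx intr Q *m y^T :> 'cV['F_2]_d.
  apply/colP => j; rewrite [LHS]mxE mxE.
  rewrite intr_natF2.
  by rewrite dot_mulmx -row_mul mxE.
apply: trmx_inj; rewrite map_trmx trmxK map_mxM zE mulmxA -map_mxM mulVmx //.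
by rewrite map_mx1 mul1mx.
Qed.

(** Integral lifts [x i] of vectors dual mod 2 give a matrix [G] of pairings that is the identity
    mod 2; its determinant is odd, hence nonzero in R. *)
Lemma int_independent (R : realFieldType) d (T : finType) (B : {set T}) (w : T -> 'rV[int]_d) :
  independent B (fun i => map_mx intr (w i) : 'rV['F_2]_d) ->
  independent B (fun i => map_mx intr (w i) : 'rV[R]_d).
Proof.
move=> ind2.
have ex (i : T) : exists x : 'rV[int]_d, forall j, j \in B ->
   (dot (w j) x)%:~R = (j == i)%:R :> 'F_2.
  have [x xP] := dot_dual (fun j => (j == i)%:R : 'F_2) ind2.
  exists (map_mx (fun a : 'F_2 => (a : nat)%:Z) x) => j jB; rewrite -[RHS]xP //.
  rewrite -dot_map; congr dot; apply/rowP => t; rewrite !mxE.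
  exact: intr_natF2.
have [x xP] := choice ex.
pose G : 'M[int]_#|B| := \matrix_(i, j) dot (w (enum_val i)) (x (enum_val j)).
have G0 : \det G != 0.
  apply: contraTneq (oner_neq0 'F_2) => G0.
  suff <- : (\det G)%:~R = 1 :> 'F_2 by rewrite G0 eqxx.
  rewrite -det_map_mx -[RHS](det1 _ #|B|); congr (\det _); apply/matrixP => i j.
  rewrite !mxE -(inj_eq enum_val_inj); exact: xP (enum_valP _).
move=> c c0 i iB; rewrite -(enum_rankK_in iB iB); set i' := enum_rank_in _ _.
have Gu : (map_mx intr G : 'M[R]_#|B|) \in unitmx.
  by rewrite unitmxE det_map_mx unitfE intr_eq0.
have : (\row_i c (enum_val i)) *m (map_mx intr G : 'M[R]_#|B|) = 0.
  apply/rowP => j; rewrite !mxE.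
  transitivity (dot (\sum_(i in B) c i *: (map_mx intr (w i) : 'rV[R]_d))
      (map_mx intr (x (enum_val j)))); last by rewrite c0 dot0l.
  rewrite dot_suml [RHS]big_enum_val; apply: eq_bigr => a _.
  by rewrite !mxE dotZl dot_map.
move=> /(congr1 (mulmx^~ (invmx (map_mx intr G)))); rewrite mulmxK // mul0mx.
by move=> /rowP/(_ i'); rewrite !mxE.
Qed.

(** * Convex hulls *)

Section Farkas.
Variables (R : realFieldType) (n : nat).
Implicit Types (s : seq 'rV[R]_n) (a b u v : 'rV[R]_n).

Fixpoint in_cone s b : Prop :=
  if s is a :: s' then exists2 t : R, 0 <= t & in_cone s' (b - t *: a) else b = 0.

Lemma in_coneP s b : in_cone s b ->
  exists2 c : nat -> R, (forall i, 0 <= c i) & b = \sum_(i < size s) c i *: s`_i.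
Proof.
elim: s b => [|a s IH] b /=; first by exists (fun=> 0); rewrite ?big_ord0.
case=> t t0 /IH[c c0 bE]; exists (fun i => if i is i'.+1 then c i' else t).
  by case.
by rewrite big_ord_recl /= -bE addrC subrK.
Qed.

Lemma in_cone_map s (f : 'rV[R]_n -> R) a b : (forall v, v \in s -> 0 <= f v) ->
  in_cone (map (fun v => v + f v *: a) s) b -> in_cone (a :: s) b.
Proof.
elim: s b => [|v s IH] b f0 /=; first by move=> ->; exists 0; rewrite // scale0r subr0.
case=> t t0 /IH /=.
case=> [w ws|t' t'0 h]; first by apply: f0; rewrite inE ws orbT.
exists (t' + t * f v).
  by rewrite addr_ge0 // mulr_ge0 // f0 ?mem_head.
exists t => //; suff -> : b - (t' + t * f v) *: a - t *: v = b - t *: (v + f v *: a) - t' *: a by [].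
by rewrite scalerDl scalerDr scalerA !opprD !addrA; apply/rowP => i; rewrite !mxE; ring.
Qed.

(** Induction on the generators. If [u] separates [b] from the cone of [s] but is negative at [a],
    everything is projected along [a] onto the hyperplane orthogonal to [u], which moves the vectors
    of [s] by nonnegative multiples of [a]. *)
Lemma farkas s b : in_cone s b \/
  exists2 u, (forall v, v \in s -> 0 <= dot v u) & dot b u < 0.
Proof.
move: {2}(size s) (erefl (size s)) => m; elim: m s b => [|m IH] s b.
  move=> /size0nil ->; have [->|b0] := eqVneq b 0; first by left.
  by right; exists (- b) => //; rewrite dotNr oppr_lt0 dot_sq_gt0.
case: s => // a s [sm].
have [bs|[u us ub]] := IH s b sm.
  by left; exists 0; rewrite // scale0r subr0.
have [au|au] := leP 0 (dot a u).
  by right; exists u => // v; rewrite inE => /predU1P[->|/us].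
pose f v := - (dot v u / dot a u).
pose b' := b + f b *: a.
have fE v : dot (v + f v *: a) u = 0.
  by rewrite dotDl dotZl /f mulNr divfK ?subrr // lt_eqF.
have [|bs|[u' us' ub']] := IH (map (fun v => v + f v *: a) s) b'; first by rewrite size_map.
  left; have /in_cone_map : forall v, v \in s -> 0 <= f v.
    move=> v /us vu; rewrite /f -mulrN mulr_ge0 // -invrN invr_ge0 oppr_ge0; exact: ltW.
  move=> /(_ a b' bs) [t t0 h]; exists (t - f b); last first.
    suff -> : b - (t - f b) *: a = b' - t *: a by [].
    by rewrite /b' scalerBl; apply/rowP => i; rewrite !mxE; ring.
  rewrite /f opprK addr_ge0 // ltW // nmulr_rgt0 // invr_lt0 //.
(* Corrected by a multiple of [u] to vanish at [a]; its value at [v] is that of [u'] at the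
   projection of [v]. *)
pose u2 := u' - (dot a u' / dot a u) *: u.
have au2 : dot a u2 = 0 by rewrite /u2 dotBr dotZr divfK ?subrr // lt_eqF.
have vE v : dot v u2 = dot (v + f v *: a) u'.
  rewrite -[LHS]addr0 -[X in _ + X](mulr0 (f v)) -au2 -dotZl -dotDl.
  by rewrite /u2 dotBr dotZr fE mulr0 subr0.
right; exists u2; last by rewrite vE.
move=> v; rewrite inE => /predU1P[->|vs]; first by rewrite au2.
by rewrite vE; apply: us'; apply: map_f.
Qed.

End Farkas.

Section ConvHull.
Variables (R : realType) (d : nat).
Implicit Types (s : seq 'rV[R]_d) (x u : 'rV[R]_d) (V : seq 'rV[int]_d).

Local Notation latR := (@lat R d).

Lemma conv_hullP V x : conv_hull (map latR V) x <->
  exists a : 'I_(size V) -> R,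
   [/\ forall i, 0 <= a i, \sum_i a i = 1 & x = \sum_i a i *: latR V`_i].
Proof.
have sz := size_map latR V.
split=> -[a [a0 a1 xE]].
  exists (fun i => a (cast_ord (esym sz) i)); split=> //.
    rewrite -a1 (reindex (cast_ord (esym sz))) //.
    by exists (cast_ord sz) => i _; rewrite ?cast_ordK ?cast_ordKV.
  rewrite xE (reindex (cast_ord (esym sz))) /=.
    by apply: eq_bigr => i _; rewrite (nth_map 0).
  by exists (cast_ord sz) => i _; rewrite ?cast_ordK ?cast_ordKV.
exists (fun i => a (cast_ord sz i)); split=> //.
  rewrite -a1 (reindex (cast_ord sz)) //.
  by exists (cast_ord (esym sz)) => i _; rewrite ?cast_ordK ?cast_ordKV.
rewrite xE (reindex (cast_ord sz)) /=.
  by apply: eq_bigr => i _; rewrite (nth_map 0) // -sz.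
by exists (cast_ord (esym sz)) => i _; rewrite ?cast_ordK ?cast_ordKV.
Qed.

Lemma conv_hull_ge V x u c : conv_hull (map latR V) x ->
  (forall v, v \in V -> c <= dot (latR v) u) -> c <= dot x u.
Proof.
move=> /conv_hullP[a [a0 a1 ->]] h; rewrite dot_suml -[c]mul1r -a1 mulr_suml.
by apply: ler_sum => i _; rewrite dotZl ler_wpM2l // h // mem_nth.
Qed.

(** Points are placed at height 1 and Farkas is applied to the cone over them; the last coordinate
    forces the coefficients to sum to 1. *)
Lemma conv_hull_sep V x :
  (forall u c, (forall v, v \in V -> c <= dot (latR v) u) -> c <= dot x u) ->
  conv_hull (map latR V) x.
Proof.
move=> h; pose hv (y : 'rV[R]_d) : 'rV[R]_(d + 1) := row_mx y (const_mx 1).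
have dE y (u : 'rV[R]_(d + 1)) : dot (hv y) u = dot y (lsubmx u) + rsubmx u 0 0.
  rewrite /dot big_split_ord /= big_ord1; congr (_ + _).
    by apply: eq_bigr => i _; rewrite row_mxEl !mxE.
  by rewrite row_mxEr !mxE mul1r.
have [/in_coneP[c c0]|[u us]] := farkas (map (hv \o latR) V) (hv x); last first.
  rewrite dE => lt0; have := h (lsubmx u) (- rsubmx u 0 0).
  rewrite leNgt => /(_ _)/negP[] => [v vV|]; last by rewrite -subr_gt0; lra.
  have := us _ (map_f (hv \o latR) vV); rewrite /= dE; lra.
rewrite size_map => xE; apply/conv_hullP; exists (fun i => c i); split=> //.
  move/(congr1 (fun y : 'rV_(d + 1) => rsubmx y 0 0)): xE; rewrite row_mxKr mxE => ->.
  rewrite linear_sum summxE; apply: eq_bigr => i _.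
  by rewrite (nth_map 0) //= linearZ /= row_mxKr !mxE mulr1.
move/(congr1 (fun y : 'rV_(d + 1) => lsubmx y)): xE; rewrite row_mxKl => ->.
rewrite linear_sum; apply: eq_bigr => i _.
by rewrite (nth_map 0) //= linearZ /= row_mxKl.
Qed.

Lemma conv_hull_mem V v : v \in V -> conv_hull (map latR V) (latR v).
Proof. by move=> vV; apply: conv_hull_sep => u c /(_ v vV). Qed.

(** Each point is a vertex of the hull, in dual form: some functional is smaller there than at all
    the other points. *)
Definition irredundant V := forall v, v \in V -> exists u c,
  dot (latR v) u < c /\ forall w, w \in V -> w != v -> c <= dot (latR w) u.

(** A generating list of minimal length works: a point that cannot be separated from the others
    could be removed. *)
Lemma conv_hull_irredundant V0 : exists V, [/\ uniq V, irredundant V &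
  conv_hull (map latR V) = conv_hull (map latR V0)].
Proof.
pose P m := `[< exists2 V, size V = m &
  conv_hull (map latR V) = conv_hull (map latR V0)>].
have exP : exists m, P m by exists (size V0); apply/asboolP; exists V0.
have [m /asboolP[V Vm VE] mmin] := ex_minnP exP.
have hullE V' : (forall u c, (forall v, v \in V -> c <= dot (latR v) u) <->
    (forall v, v \in V' -> c <= dot (latR v) u)) ->
    conv_hull (map latR V') = conv_hull (map latR V0).
  move=> h; rewrite -VE; apply/funext => x; apply/propext; split=> hx;
    by apply: conv_hull_sep => u c /h; apply: conv_hull_ge.
have Vuniq : uniq V.
  apply: contraT; rewrite -ltn_size_undup Vm ltnNge mmin //.
  apply/asboolP; exists (undup V) => //.
  by apply: hullE => u c; split=> h v; have := h v; rewrite mem_undup.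
exists V; split=> // v vV; apply: contrapT => nsep.
have : P m.-1.
  apply/asboolP; exists (rem v V); first by rewrite size_rem // Vm.
  apply: hullE => u c; split=> h w; first by move/mem_rem/h.
  move=> wV; have [->|wv] := eqVneq w v; last first.
    by apply: h; rewrite mem_rem_uniq // inE wv.
  rewrite leNgt; apply/negP => lt; apply: nsep; exists u, c; split=> // w' w'V w'v.
  by apply: h; rewrite mem_rem_uniq // inE w'v.
move=> /mmin; have : (0 < m)%N by rewrite -Vm; case: (V) vV.
by case: (m) => // k _; rewrite /= ltnn.
Qed.

Lemma conv_comb_eq (I : finType) (a t : I -> R) c : (forall i, 0 <= a i) -> \sum_i a i = 1 ->
  (forall i, c <= t i) -> \sum_i a i * t i <= c -> forall i, a i != 0 -> t i = c.
Proof.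
move=> a0 a1 ct h i ai.
have s0 : \sum_i a i * (t i - c) = 0.
  apply/eqP; rewrite eq_le; apply/andP; split; last first.
    by apply: sumr_ge0 => j _; rewrite mulr_ge0 // subr_ge0.
  under eq_bigr do rewrite mulrBr.
  by rewrite sumrB -mulr_suml a1 mul1r subr_le0.
have := psumr_eq0P (fun j _ => mulr_ge0 (a0 j) (eq_ind_r is_true (ct j) (subr_ge0 c (t j)))) s0 (i := i) isT.
by move=> /eqP; rewrite mulf_eq0 (negPf ai) /= subr_eq0 => /eqP.
Qed.

Lemma small_step (I : finType) (a b : I -> R) : (forall i, 0 <= a i) ->
  (forall i, a i = 0 -> 0 <= b i) ->
  exists2 e : R, 0 < e & forall i, 0 <= a i + e * b i /\ (0 < a i -> 0 < a i + e * b i).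
Proof.
(* [M] exceeds every |b i| / a i, so a step of 1/M keeps positive entries positive; entries with
   [a i] = 0 contribute 0 to the sum. *)
move=> a0 ab; pose M := 1 + \sum_i `|b i| / a i.
have s0 : 0 <= \sum_i `|b i| / a i by apply: sumr_ge0 => i _; rewrite divr_ge0.
have M0 : 0 < M by rewrite /M; lra.
exists M^-1; first by rewrite invr_gt0.
move=> i; have [ai|ai] := eqVneq (a i) 0.
  by split; [rewrite ai add0r mulr_ge0 ?ab // invr_ge0 ltW|rewrite ai ltxx].
have ai0 : 0 < a i by rewrite lt_def ai a0.
suff h : 0 < a i + M^-1 * b i by split=> //; exact: ltW.
have : `|b i| / a i < M.
  rewrite /M (bigD1 i) //=.
  have : 0 <= \sum_(j | j != i) `|b j| / a j by apply: sumr_ge0 => j _; rewrite divr_ge0.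
  by move: (\sum_(_ | _) _) (_ / _) => x y; lra.
rewrite ltr_pdivrMr // => lt; have lt2 : M^-1 * `|b i| < a i by rewrite ltr_pdivrMl.
have : - `|b i| <= b i by rewrite lerNnormlW.
have Mi : 0 < M^-1 by rewrite invr_gt0.
move=> /(ler_wpM2l (ltW Mi)); rewrite mulrN; lra.
Qed.

(** Moment curve: the pairing with (1, t, t^2, ...) evaluates at t the polynomial with coefficients
    [w i], and a product of nonzero polynomials has finitely many roots. *)
Lemma generic_direction (I : finType) (w : I -> 'rV[R]_d) : (forall i, w i != 0) ->
  exists xi, forall i, dot xi (w i) != 0.
Proof.
move=> w0; pose P := \prod_i rVpoly (w i).
have P0 : P != 0.
  rewrite /P; apply/prodf_neq0 => i _; apply: contra (w0 i) => /eqP e.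
  by rewrite -[w i]rVpolyK e linear0.
have [t tP] : exists t, ~~ root P t.
  apply: contrapT => no; pose rs := [seq k%:R : R | k <- iota 0 (size P)].
  have := max_poly_roots P0 (rs := rs); rewrite size_map size_iota ltnn => h.
  suff : false by []. apply: h.
    by apply/allP => t _; apply: contrapT => /negP nt; apply: no; exists t.
  rewrite map_inj_uniq ?iota_uniq // => a b /eqP.
  by rewrite eqr_nat => /eqP.
exists (\row_k t ^+ k) => i; apply: contra tP => /eqP e.
rewrite /root /P horner_prod (bigD1 i) //= [X in X * _](_ : _ = 0) ?mul0r //.
rewrite horner_poly -[RHS]e; apply: eq_bigr => k _.
by rewrite valK mxE mulrC.
Qed.

End ConvHull.

(** * Reflexive polytopes *)

Lemma independent_sub (K : fieldType) (W : vectType K) (T : finType) (B : {set T}) (b : T -> W) (i0 : T) :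
  i0 \in B -> independent B b -> independent (B :\ i0) (fun i => b i - b i0).
Proof.
move=> i0B ind c c0 i iB; pose c' k := if k == i0 then - \sum_(j in B :\ i0) c j else c k.
have := ind c'; rewrite (big_setD1 i0) //= /c' eqxx.
rewrite [X in _ + X](eq_bigr (fun k => c k *: b k)); last first.
  by move=> k; rewrite !inE => /andP[/negPf->].
have -> : \sum_(j in B :\ i0) c j *: b j = (\sum_(j in B :\ i0) c j) *: b i0.
  apply/eqP; rewrite -subr_eq0 scaler_suml -sumrB -[X in _ == X]c0; apply/eqP.
  by apply: eq_bigr => j _; rewrite scalerBr.
rewrite scaleNr addNr => /(_ erefl i).
by move: iB; rewrite !inE => /andP[/negPf-> iB]; apply.
Qed.

Lemma family_seq (K : fieldType) (W : vectType K) (T : finType) (B : {set T}) (b : T -> W) :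
  family B b = map b (enum B) :> seq W.
Proof.
apply: (@eq_from_nth _ 0); first by rewrite size_tuple size_map -cardE.
move=> k; rewrite size_tuple => kB; rewrite -[k]/(val (Ordinal kB)) family_nth.
rewrite (nth_map (enum_val (Ordinal kB))) -?cardE //; congr b.
exact: (enum_val_nth _ (Ordinal kB)).
Qed.

Lemma unimodular_primitive d (v w : 'rV[int]_d) : dot v w = -1 -> primitive_vector v.
Proof.
move=> vw; split; first by apply/eqP => v0; move: vw; rewrite v0 dot0l.
move=> x k vE; move: vw; rewrite vE -scaler_nat dotZl => /(congr1 absz).
by rewrite abszM natz absz_nat => /eqP; rewrite muln_eq1 => /andP[/eqP].
Qed.

Section Polytope.
Variables (R : realType) (d : nat) (Delta : set 'rV[R]_d) (V : seq 'rV[int]_d).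
Hypothesis V_irr : irredundant R V.
Hypothesis DV : conv_hull (map (@lat R d) V) = Delta.
Hypothesis D_int : interior Delta 0.

Local Notation n := (size V).
Implicit Types (i j k : 'I_(size V)) (F G : set 'rV[R]_d) (x u : 'rV[R]_d).

Definition vint i : 'rV[int]_d := V`_i.
Definition vx i : 'rV[R]_d := lat R (vint i).

Lemma Delta0 : Delta 0.
Proof. exact: interior_subset D_int. Qed.

Lemma Delta_neg u : u != 0 -> exists2 x, Delta x & dot x u < 0.
Proof.
move=> u0; have /nbhs_ballP[e /= e0 he] := D_int.
have nu : 0 < `|u| by rewrite normr_gt0.
pose c := e / (2 * `|u|); have c0 : 0 < c by rewrite divr_gt0 // mulr_gt0.
exists (- (c *: u)); last by rewrite dotNl dotZl oppr_lt0 mulr_gt0 // dot_sq_gt0.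
apply: he; rewrite -ball_normE /= sub0r opprK normrZ gtr0_norm // /c.
have -> : e / (2 * `|u|) * `|u| = e / 2 by field; rewrite gt_eqF.
by lra.
Qed.

Lemma Delta_vx i : Delta (vx i).
Proof. by rewrite -DV; apply: conv_hull_mem; apply: mem_nth. Qed.

Lemma DeltaP x : Delta x <-> exists a : 'I_n -> R,
  [/\ forall i, 0 <= a i, \sum_i a i = 1 & x = \sum_i a i *: vx i].
Proof. by rewrite -DV; exact: conv_hullP. Qed.

Lemma Delta_ge x u c : Delta x -> (forall i, c <= dot (vx i) u) -> c <= dot x u.
Proof.
move=> /DeltaP[a [a0 a1 ->]] h; rewrite dot_suml -[c]mul1r -a1 mulr_suml.
by apply: ler_sum => i _; rewrite dotZl ler_wpM2l.
Qed.

Lemma polarP m : polar Delta m <-> forall i, -1 <= dot (vx i) m.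
Proof.
by split=> [h i|h x Dx]; [apply/h/Delta_vx | apply: (Delta_ge Dx)].
Qed.

Definition nface F := is_face Delta F /\ (F !=set0)%classic.
Definition vset F : {set 'I_n} := [set i | `[< F (vx i) >]].

Lemma vsetP F i : i \in vset F <-> F (vx i).
Proof. by rewrite inE; split=> [/asboolP|h]; last exact/asboolP. Qed.

Lemma nface_sub F x : nface F -> F x -> Delta x.
Proof. by move=> [[u [c [_ ->]]] _] []. Qed.

Lemma nfaceP F x : nface F -> F x <-> exists a : 'I_n -> R,
  [/\ forall i, 0 <= a i, \sum_i a i = 1, x = \sum_i a i *: vx i &
      forall i, a i != 0 -> i \in vset F].
Proof.
move=> [[u [c [cu FE]]] _]; split=> [|[a [a0 a1 xE aF]]].
  rewrite {1}FE => -[/DeltaP[a [a0 a1 xE]] xc]; exists a; split=> // i ai.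
  apply/vsetP; rewrite FE; split; first exact: Delta_vx.
  apply: (@conv_comb_eq R _ a (fun i => dot (vx i) u) c) => //.
    by move=> j; apply/cu/Delta_vx.
  have <- : dot x u = c by [].
  by rewrite xE dot_suml; apply: ler_sum => j _; rewrite dotZl.
rewrite FE; split=> /=; first by apply/DeltaP; exists a.
have -> : pairing x u = dot x u by [].
rewrite xE dot_suml -[RHS]mul1r -a1 mulr_suml; apply: eq_bigr => i _; rewrite dotZl.
have [->|/aF/vsetP] := eqVneq (a i) 0; first by rewrite !mul0r.
by rewrite FE => -[_ ic]; congr (_ * _).
Qed.

Lemma nface_subset F G : nface F -> nface G ->
  (F `<=` G)%classic <-> vset F \subset vset G.
Proof.
move=> nF nG; split=> [FG|FG x /(nfaceP x nF)[a [a0 a1 xE aF]]].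
  by apply/subsetP => i /vsetP/FG/vsetP.
by apply/(nfaceP x nG); exists a; split=> // i /aF/(subsetP FG).
Qed.

Lemma vset_inj F G : nface F -> nface G -> vset F = vset G -> F = G.
Proof.
by move=> nF nG e; apply/seteqP; split; apply/nface_subset => //; rewrite e.
Qed.

Lemma vset_neq0 F : nface F -> exists i, i \in vset F.
Proof.
move=> nF; have [_ [x /(nfaceP x nF)[a [a0 a1 _ aF]]]] := nF.
apply: contrapT => no; suff : (1 : R) = 0 by move/eqP; rewrite oner_eq0.
rewrite -a1 big1 // => i _; apply/eqP; apply: contrapT => /negP/aF iF.
by apply: no; exists i.
Qed.

Lemma nface_Delta : nface Delta.
Proof.
split; last by exists 0; exact: Delta0.
exists 0, 0; split=> [x _|]; first by rewrite [pairing _ _]dot0r.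
by apply/seteqP; split=> [x Dx|x []//]; split=> //=; exact: dot0r.
Qed.

Lemma vset_Delta : vset Delta = [set: 'I_n].
Proof. by apply/setP => i; rewrite !inE; apply/asboolP/Delta_vx. Qed.

(** With equal positive weights on the vertices, a lower bound reached at the barycenter is reached
    at every vertex: it serves as a relative interior point. *)
Lemma barycenter F : nface F -> exists2 x, F x & forall u c,
  (forall i, i \in vset F -> c <= dot (vx i) u) -> dot x u <= c ->
  forall i, i \in vset F -> dot (vx i) u = c.
Proof.
move=> nF; have [i0 i0F] := vset_neq0 nF.
have card0 : (#|vset F|%:R : R) != 0.
  by rewrite pnatr_eq0 -lt0n; apply/card_gt0P; exists i0.
pose a i : R := if i \in vset F then (#|vset F|%:R)^-1 else 0.
have a0 i : 0 <= a i by rewrite /a; case: ifP; rewrite ?invr_ge0 ?ler0n.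
have a1 : \sum_i a i = 1.
  by rewrite -big_mkcond sumr_const -[LHS]mulr_natr mulVf.
exists (\sum_i a i *: vx i).
  apply/(nfaceP _ nF); exists a; split=> // i; rewrite /a.
  by case: ifP => //; rewrite eqxx.
move=> u c h le i iF.
pose t i := if i \in vset F then dot (vx i) u else c.
have := @conv_comb_eq R _ a t c a0 a1; rewrite /t; move=> /(_ _ _ i).
rewrite iF; apply; rewrite /a ?iF ?invr_eq0 //.
  by move=> j; case: ifP => // /h.
apply: le_trans le; rewrite dot_suml; apply: ler_sum => j _; rewrite dotZl.
by rewrite /a; case: (j \in vset F) => //; rewrite !mul0r.
Qed.

Local Notation nc := (normal_cone Delta).

Lemma ncP F m : nface F -> nc F m <-> forall i j, i \in vset F -> dot (vx i) m <= dot (vx j) m.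
Proof.
move=> nF; split=> [h i j /vsetP iF|h x y /(nfaceP x nF)[a [a0 a1 -> aF]] Dy].
  by apply: h => //; exact: Delta_vx.
apply: (Delta_ge Dy) => j; rewrite [pairing _ _]dot_suml -[leRHS]mul1r -a1 mulr_suml.
apply: ler_sum => i _; rewrite dotZl.
have [->|/aF iF] := eqVneq (a i) 0; first by rewrite !mul0r.
by rewrite ler_wpM2l // h.
Qed.

Lemma face_direction F : nface F -> exists2 u, nc F u &
  forall i j, i \in vset F -> j \notin vset F -> dot (vx i) u < dot (vx j) u.
Proof.
move=> [[u [c [cu FE]]] Fne]; exists u.
  move=> x y; rewrite FE => -[_ /= ->] Dy; exact: cu.
move=> i j /vsetP; rewrite {1}FE => -[_ ic] jF.
have <- : c = dot (vx i) u by [].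
rewrite lt_neqAle (cu _ (Delta_vx j)) andbT; apply: contraNneq jF => e.
by apply/vsetP; rewrite FE; split; [exact: Delta_vx | exact: esym e].
Qed.

(** For [x] the barycenter of [F] and [y] in [G], the form [x - y] is nonnegative on the cone of
    [G]; where it vanishes, the minimum is reached at [x], hence on all of [F]. *)
Lemma nc_face F G : nface F -> nface G -> is_face (nc G) (nc F) <-> (G `<=` F)%classic.
Proof.
move=> nF nG; split=> [[u0 [c0 [_ FG]]]|GF].
  apply/nface_subset => //; apply/subsetP => i iG.
  have [u uF uS] := face_direction nF.
  have : nc G u by move: uF; rewrite FG => -[].
  move=> /(ncP _ nG) uG; apply/negPn/negP => iF.
  have [k kF] := vset_neq0 nF.
  by have := uS k i kF iF; rewrite ltNge uG.
have [x Fx xP] := barycenter nF; have [_ [y Gy]] := nG.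
exists (x - y), 0; split=> [m Gm|].
  have -> : pairing m (x - y) = dot x m - dot y m by rewrite -dotBl dotC.
  by rewrite subr_ge0; apply: Gm Gy _; apply: nface_sub nF Fx.
apply/seteqP; split=> [m mF|m [mG /= e]].
  have mG : nc G m by move=> z w /GF; exact: mF.
  split=> //=; have -> : pairing m (x - y) = dot x m - dot y m by rewrite -dotBl dotC.
  apply/eqP; rewrite subr_eq0 eq_le; apply/andP; split.
    by apply: mF Fx _; apply: nface_sub nG Gy.
  by apply: mF (GF _ Gy) _; apply: nface_sub nF Fx.
have {}e : dot x m = dot y m.
  by apply/eqP; rewrite -subr_eq0 -dotBl dotC; exact/eqP.
apply/ncP => // i j iF.
have yl k : dot y m <= dot (vx k) m by apply: mG Gy _; exact: Delta_vx.
by rewrite (xP m (dot y m)) ?e.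
Qed.

Lemma nc_inj F G : nface F -> nface G -> nc F = nc G -> F = G.
Proof.
move=> nF nG e; apply/seteqP; split; apply/nc_face => //; rewrite e; exact/nc_face.
Qed.

Lemma lspan_mem (S : set 'rV[R]_d) x : S x -> x \in lspan S.
Proof. exact: (lspanP S).1. Qed.

(** A direction [u] minimal exactly on [F] is interior to the cone: adding a small multiple of a
    form constant on [F] stays in the cone, and the form is a multiple of the difference. *)
Lemma lspan_nc F i0 x : nface F -> i0 \in vset F ->
  x \in lspan (nc F) <-> forall i, i \in vset F -> dot (vx i - vx i0) x = 0.
Proof.
move=> nF i0F; have [X XP] := perp_exists (fun i => vx i - vx i0) (vset F); split.
  move=> xF; apply/XP; move: x xF; apply/subvP; apply: (lspanP _).2 => x xF.
  apply/XP => i iF; rewrite dotBl; apply/eqP; rewrite subr_eq0 eq_le.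
  by rewrite !(ncP _ nF).1.
move=> x0; have [u uF uS] := face_direction nF.
have [||e e0 eP] := @small_step R _
    (fun i => dot (vx i - vx i0) u) (fun i => dot (vx i - vx i0) x).
- by move=> i; rewrite dotBl subr_ge0; apply: (ncP _ nF).1.
- move=> i /eqP; rewrite dotBl subr_eq0 => /eqP iE.
  have [iF|/(uS _ _ i0F)] := boolP (i \in vset F); first by rewrite x0.
  by rewrite iE ltxx.
have uex : nc F (u + e *: x).
  apply/(ncP _ nF) => i j iF; rewrite -subr_ge0 -dotBl.
  have -> : vx j - vx i = (vx j - vx i0) - (vx i - vx i0).
    by rewrite opprB addrA subrK.
  rewrite dotBl dotDr dotZr [X in _ - X]dotDr dotZr (x0 i iF) mulr0 addr0.
  have -> : dot (vx i - vx i0) u = 0.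
    by rewrite dotBl; apply/eqP; rewrite subr_eq0 eq_le !(ncP _ nF).1.
  by rewrite subr0 (eP j).1.
have -> : x = e^-1 *: ((u + e *: x) - u).
  by rewrite addrAC subrr add0r scalerA mulVf ?scale1r // gt_eqF.
by apply/memvZ/rpredB; apply: lspan_mem.
Qed.

Lemma cone_dim_nc F : nface F -> (cone_dim (nc F) + aff_dim F = d)%N.
Proof.
move=> nF; have [i0 i0F] := vset_neq0 nF.
apply: (perp_dim_span (b := fun i => vx i - vx i0) (B := vset F)) => [i iF|W' hW|x].
- by apply: lspan_mem; exists (vx i), (vx i0); split=> //; apply/vsetP.
- apply: (lspanP _).2 => _ [x [y [Fx Fy ->]]].
  have sub z : F z -> z - vx i0 \in W'.
    move=> /(nfaceP z nF)[a [a0 a1 -> aF]].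
    rewrite -[vx i0]scale1r -a1 scaler_suml -sumrB; apply: memv_suml => i _.
    rewrite -scalerBr; have [->|/aF/hW] := eqVneq (a i) 0; first by rewrite scale0r mem0v.
    by move=> h; apply: memvZ.
  by have := rpredB (sub x Fx) (sub y Fy); rewrite opprB addrA subrK.
- exact: lspan_nc.
Qed.

Lemma lat2_nc_dim F : nface F -> \dim (lat2 (nc F)) = cone_dim (nc F).
Proof.
move=> nF; have [i0 i0F] := vset_neq0 nF; apply/esym.
(* The span of the normal cone is the real kernel of this integral matrix, so [int_kernel_dim]
   compares it with the reduction of its lattice points. *)
pose A : 'M[int]_(n, d) :=
  \matrix_(i, j) if i \in vset F then (vint i - vint i0) 0 j else 0.
have AE (K : comNzRingType) (x : 'rV[K]_d) : map_mx intr A *m x^T = 0 <->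
    forall i, i \in vset F -> dot (map_mx intr (vint i) - map_mx intr (vint i0)) x = 0.
  have rE i : i \in vset F ->
      (map_mx intr A *m x^T) i 0 = dot (map_mx intr (vint i) - map_mx intr (vint i0)) x.
    move=> iF; rewrite mxE; apply: eq_bigr => j _; rewrite !mxE iF.
    by rewrite rmorphB.
  split=> [A0 i iF|h]; first by rewrite -rE // A0 mxE.
  apply/colP => i; have [iF|iF] := boolP (i \in vset F).
    by rewrite rE // h // mxE.
  by rewrite !mxE big1 // => j _; rewrite !mxE (negPf iF) mul0r.
apply: (int_kernel_dim (A := A)) => [x|y]; first by rewrite AE; exact: lspan_nc.
rewrite lat2P; split=> -[v hv ->]; exists v => //.
  apply/matrixP => a b; apply/eqP; rewrite [X in _ == X]mxE -(intr_eq0 R); apply/eqP.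
  have /matrixP/(_ a b) : map_mx intr A *m (lat R v)^T = 0.
    by apply/AE; apply/lspan_nc.
  by rewrite map_trmx -map_mxM !mxE.
apply/(lspan_nc _ nF i0F)/AE.
by rewrite map_trmx -map_mxM hv map_mx0.
Qed.

Variable U : seq 'rV[int]_d.
Hypothesis V_uniq : uniq V.
Hypothesis U_uniq : uniq U.
Hypothesis U_irr : irredundant R U.
Hypothesis DU : conv_hull (map (@lat R d) U) = polar Delta.
Implicit Types (r t : 'I_(size U)).

Definition uint r : 'rV[int]_d := U`_r.
Definition ux r : 'rV[R]_d := lat R (uint r).

Lemma ux_polar r : polar Delta (ux r).
Proof. by rewrite -DU; apply: conv_hull_mem; apply: mem_nth. Qed.

Lemma ux_ge i r : -1 <= dot (vx i) (ux r).
Proof. by have /polarP := ux_polar r; apply. Qed.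

Lemma polar_hull y : polar Delta y -> exists a : 'I_(size U) -> R,
  [/\ forall r, 0 <= a r, \sum_r a r = 1 & y = \sum_r a r *: ux r].
Proof. by rewrite -DU => /conv_hullP. Qed.

Definition fac r : {set 'I_n} := [set i | dot (vx i) (ux r) == -1].

Lemma facP r i : i \in fac r <-> dot (vx i) (ux r) = -1.
Proof. by rewrite inE; split=> /eqP. Qed.

(** The functional defining [F], scaled to the value -1 on it, lies in the polar polytope. Every
    vertex of the polar with nonzero weight in it must then take the value -1 on [F] too. *)
Lemma facet_functional F : nface F -> F <> Delta ->
  exists r, forall x, F x -> dot x (ux r) = -1.
Proof.
move=> nF FD; have [[u [c [cu FE]]] [x0 Fx0]] := nF.
have u0 : u != 0.
  apply/eqP => u0; apply: FD; rewrite FE; apply/seteqP; split=> [x []//|x Dx].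
  split=> //; move: Fx0; rewrite FE u0 => -[_ /= <-].
  by rewrite ![pairing _ _]dot0r.
have c0 : c < 0.
  by have [x Dx xu] := Delta_neg u0; apply: le_lt_trans xu; apply: cu.
have cN : 0 < - c by rewrite oppr_gt0.
have pol : polar Delta ((- c)^-1 *: u).
  move=> x Dx; have -> : pairing x ((- c)^-1 *: u) = (- c)^-1 * dot x u by rewrite -dotZr.
  rewrite -(ler_pM2l cN) mulrA divff ?gt_eqF // mul1r mulrN1 opprK; exact: cu.
have [a [a0 a1 yE]] := polar_hull pol.
have [r ar] : exists r, a r != 0.
  apply: contrapT => no; suff : (1 : R) = 0 by move/eqP; rewrite oner_eq0.
  rewrite -a1 big1 // => r _; apply/eqP; apply: contrapT => /negP ar.
  by apply: no; exists r.
exists r => x Fx; have Dx := nface_sub nF Fx.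
apply: (@conv_comb_eq R _ a (fun r => dot x (ux r)) (-1)) => //.
  by move=> t; apply: ux_polar.
rewrite (eq_bigr (fun t => dot x (a t *: ux t))); last by move=> t _; rewrite dotZr.
rewrite -dot_sumr -yE dotZr.
have -> : dot x u = c by move: Fx; rewrite FE => -[].
by rewrite invrN mulNr mulVf // lt_eqF.
Qed.

Lemma vset_fac F : nface F -> F <> Delta -> exists r, vset F \subset fac r.
Proof.
move=> nF FD; have [r rP] := facet_functional nF FD.
by exists r; apply/subsetP => i /vsetP/rP/facP.
Qed.

Lemma nface_at m : polar Delta m -> (exists i, dot (vx i) m = -1) ->
  exists F, [/\ nface F, F <> Delta & vset F = [set i | dot (vx i) m == -1]].
Proof.
move=> pm [i im]; exists (Delta `&` [set x | pairing x m = -1])%classic; split.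
- split; first by exists m, (-1); split=> // x; exact: pm.
  by exists (vx i); split=> //; exact: Delta_vx.
- move=> /seteqP[_ /(_ 0 Delta0)[_ /=]].
  by rewrite [pairing _ _]dot0l => /esym/eqP; rewrite oppr_eq0 oner_eq0.
apply/setP => k; rewrite [RHS]inE; apply/idP/eqP => [/vsetP[]//|km].
by apply/vsetP; split=> //; exact: Delta_vx.
Qed.

Lemma vx_inj : injective vx.
Proof.
move=> i k /matrixP e; apply/val_inj/eqP; rewrite -(nth_uniq 0 _ _ V_uniq) ?ltn_ord //.
apply/eqP/matrixP => a b; apply/eqP; rewrite -(eqr_int R); apply/eqP.
by have := e a b; rewrite !mxE; apply.
Qed.

Lemma vertex_functional i : exists u, forall k, k != i -> dot (vx i) u < dot (vx k) u.
Proof.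
have [u [c [ic h]]] := V_irr (mem_nth 0 (ltn_ord i)).
exists u => k ki; apply: lt_le_trans ic _; apply: h; first exact: mem_nth.
by rewrite nth_uniq.
Qed.

Lemma vint_uint i r : i \in fac r -> dot (vint i) (uint r) = -1.
Proof.
move=> /facP e; apply/eqP; rewrite -(eqr_int R) rmorphN1 -e; apply/eqP.
by rewrite -(dot_map (intr : int -> R)).
Qed.

Lemma primitive_vint i r : i \in fac r -> primitive_vector (vint i).
Proof. by move=> /vint_uint/unimodular_primitive. Qed.

Lemma primitive_uint i r : i \in fac r -> primitive_vector (uint r).
Proof. by move=> /vint_uint; rewrite dotC; exact: unimodular_primitive. Qed.

Lemma vertex_ray_generator F i : nface F -> F <> Delta -> i \in vset F ->
  ray_generator (cone_over F) (vint i).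
Proof.
move=> nF FD iF; have [r rP] := facet_functional nF FD.
have iv : dot (vx i) (ux r) = -1 by apply/rP/vsetP.
have [u uP] := vertex_functional i.
(* Since [ux r] is -1 on [F], this turns the affine condition that [vx i] minimizes [u] into a
   linear form vanishing at [vx i] and positive elsewhere on [F]; it cuts out the ray. *)
pose u' := u + dot (vx i) u *: ux r.
have u'E x : F x -> dot x u' = dot x u - dot (vx i) u.
  by move=> Fx; rewrite dotDr dotZr rP // mulrN1.
have u'0 x : F x -> 0 <= dot x u'.
  move=> Fx; rewrite u'E // subr_ge0; apply: (Delta_ge (nface_sub nF Fx)) => k.
  by have [->//|/uP/ltW] := eqVneq k i.
have u'i x : F x -> dot x u' = 0 -> x = vx i.
  move=> Fx; rewrite u'E // => /eqP; rewrite subr_eq0 => /eqP xe.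
  have /DeltaP[a [a0 a1 xE]] := nface_sub nF Fx.
  have ai k : k != i -> a k = 0.
    move=> ki; apply/eqP; apply: contrapT => /negP ak; have := uP k ki.
    rewrite (@conv_comb_eq R _ a (fun k => dot (vx k) u) (dot (vx i) u) a0 a1 _ _ k ak) ?ltxx //.
      by move=> l; have [->//|/uP/ltW] := eqVneq l i.
    by rewrite -xe xE dot_suml; apply: ler_sum => l _; rewrite dotZl.
  rewrite (bigD1 i) //= big1 // addr0 in a1.
  by rewrite xE (bigD1 i) //= a1 scale1r big1 ?addr0 // => k /ai ->; rewrite scale0r.
have Fi : F (vx i) by apply/vsetP.
exists (cone_over [set lat R (vint i)]%classic); split.
- exists u', 0; split=> [_ [c [x [c0 Fx ->]]]|].
    by have -> : pairing (c *: x) u' = c * dot x u'; [rewrite -dotZl|rewrite mulr_ge0 ?u'0].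
  apply/seteqP; split=> [_ [c [_ [c0 -> ->]]]|_ [[c [x [c0 Fx ->]]] /= e]].
    split=> /=; first by exists c, (vx i).
    have -> : pairing (c *: lat R (vint i)) u' = c * dot (vx i) u' by rewrite -dotZl.
    by rewrite u'E // subrr mulr0.
  move: e; have -> : pairing (c *: x) u' = c * dot x u' by rewrite -dotZl.
  move=> /eqP; rewrite mulf_eq0 => /orP[/eqP->|/eqP/(u'i x Fx)->].
    by exists 0, (vx i); split=> //; rewrite !scale0r.
  by exists c, (vx i).
- rewrite /cone_dim; have -> : lspan (cone_over [set lat R (vint i)]%classic) = <[vx i]>%VS.
    apply/eqP; rewrite eqEsubv; apply/andP; split.
      by apply: (lspanP _).2 => _ [c [_ [_ -> ->]]]; apply/memvZ/memv_line.
    rewrite -memvE; apply: lspan_mem; exists 1, (vx i); split=> //.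
    by rewrite scale1r.
  rewrite dim_vline; case: eqP => // v0; move: iv; rewrite v0 dot0l => /esym/eqP.
  by rewrite oppr_eq0 oner_eq0.
- split=> //; apply: (@primitive_vint i r); exact/facP.
Qed.

Hypothesis reg : forall C, face_fan Delta C -> Z2_regular C.

(** The vertices of [F] are among the ray generators listed by regularity, so their classes are part
    of a basis. *)
Lemma regular_independent F : nface F -> F <> Delta ->
  independent (vset F) (fun i => mod2 (vint i)).
Proof.
move=> nF FD; have [|g [gu gP gb]] := reg (C := cone_over F).
  by right; exists F; split=> //; case: nF.
apply/independent_free; rewrite family_seq.
pose s := map vint (enum (vset F)).
have su : uniq s.
  by rewrite map_inj_uniq ?enum_uniq // => i k e; apply: vx_inj; rewrite /vx e.
have sg : {subset s <= g}.
  by move=> _ /mapP[i iF ->]; apply/gP/vertex_ray_generator => //; rewrite -mem_enum.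
have pg : perm_eq g (s ++ [seq x <- g | x \notin s]).
  rewrite -(perm_filterC (mem s)) perm_cat2r; apply: uniq_perm => //.
    exact: filter_uniq.
  by move=> x; rewrite mem_filter /= andb_idr // => /sg.
have := basis_free gb; rewrite (perm_free (perm_map _ pg)) map_cat => /catl_free.
by rewrite -map_comp.
Qed.

Lemma regular_independentR F : nface F -> F <> Delta -> independent (vset F) vx.
Proof. by move=> nF FD; apply/int_independent/regular_independent. Qed.

Lemma fac_face r : (exists i, i \in fac r) -> exists F, [/\ nface F, F <> Delta & vset F = fac r].
Proof.
by move=> [i /facP ir]; apply: nface_at; [exact: ux_polar | exists i].
Qed.

Lemma fac_independent2 r : independent (fac r) (fun i => mod2 (vint i)).
Proof.
have [->|/set0Pn/fac_face[F [nF FD <-]]] := eqVneq (fac r) set0; first by move=> c _ i; rewrite inE.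
exact: regular_independent.
Qed.

Lemma fac_independent r : independent (fac r) vx.
Proof. exact/int_independent/fac_independent2. Qed.

(** The inequalities that are tight at [ux r] are those of [fac r]; the others are strict and
    survive a small step. *)
Lemma polar_step r m : (forall i, i \in fac r -> 0 <= dot (vx i) m) ->
  exists2 e : R, 0 < e & forall i, -1 <= dot (vx i) (ux r + e *: m) /\
    (i \notin fac r -> -1 < dot (vx i) (ux r + e *: m)).
Proof.
move=> h; have [||e e0 eP] := @small_step R _ (fun i => dot (vx i) (ux r) + 1) (fun i => dot (vx i) m).
- by move=> i; have := ux_ge i r; lra.
- by move=> i e; apply/h/facP; lra.
exists e => // i; rewrite dotDr dotZr; have [e1 e2] := eP i; split; first by lra.
move=> ir; suff : 0 < dot (vx i) (ux r) + 1 by move/e2; lra.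
have := ux_ge i r; rewrite le_eqVlt => /orP[/eqP e'|]; last by lra.
by case/negP: ir; apply/facP.
Qed.

Lemma fac_perp r m : (forall i, i \in fac r -> dot (vx i) m = 0) -> m = 0.
Proof.
have [xi [c [xc h]]] := U_irr (mem_nth 0 (ltn_ord r)).
have min y : polar Delta y -> dot y xi <= dot (ux r) xi -> y = ux r.
  move=> /polar_hull[a [a0 a1 yE]] le.
  have hr t : t != r -> dot (ux r) xi < dot (ux t) xi.
    move=> tr; apply: lt_le_trans xc _; apply: h; first exact: mem_nth.
    by rewrite nth_uniq.
  have ar t : t != r -> a t = 0.
    move=> tr; apply/eqP; apply: contrapT => /negP ak; have := hr t tr.
    rewrite (@conv_comb_eq R _ a (fun t => dot (ux t) xi) (dot (ux r) xi) a0 a1 _ _ t ak) ?ltxx //.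
      by move=> l; have [->//|/hr/ltW] := eqVneq l r.
    apply: le_trans le; rewrite yE dot_suml; apply: ler_sum => l _; by rewrite dotZl.
  rewrite (bigD1 r) //= big1 // addr0 in a1.
  by rewrite yE (bigD1 r) //= a1 scale1r big1 ?addr0 // => k /ar ->; rewrite scale0r.
(* Some ux r + e *: m with e != 0 stays in the polar polytope, of which ux r is a vertex. *)
wlog mxi : m / dot m xi <= 0 => [wl m0|m0].
  have [|/ltW mxi] := leP (dot m xi) 0; first by move=> ?; apply: wl.
  suff : - m = 0 by move/eqP; rewrite oppr_eq0 => /eqP.
  apply: wl; first by rewrite dotNl oppr_le0.
  by move=> i ir; rewrite dotNr m0 // oppr0.
have [|e e0 eP] := @polar_step r m; first by move=> i /m0 ->.
have pe : polar Delta (ux r + e *: m) by apply/polarP => i; exact: (eP i).1.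
have := min _ pe; rewrite dotDl dotZl => /(_ _)/eqP.
rewrite -subr_eq0 addrAC subrr add0r scaler_eq0 (gt_eqF e0) /= => /(_ _)/eqP; apply.
by rewrite gerDl; apply: mulr_ge0_le0 => //; exact: ltW.
Qed.

(** The vertices on the facet are independent by regularity, and nothing nonzero is orthogonal to
    all of them by [fac_perp]. *)
Lemma fac_card r : #|fac r| = d.
Proof.
have := perp_dim (X := 0%VS) (@fac_independent r); rewrite dimv0 add0n; apply=> x.
rewrite memv0; split=> [/eqP-> i _|x0]; first exact: dot0r.
by apply/eqP/(@fac_perp r).
Qed.

Lemma fac_dual r : exists N : 'I_n -> 'rV[R]_d,
  (forall i k, i \in fac r -> k \in fac r -> dot (vx k) (N i) = (k == i)%:R) /\
  (forall m, m = \sum_(i in fac r) dot (vx i) m *: N i).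
Proof.
have ex i : exists x, forall k, k \in fac r -> dot (vx k) x = (k == i)%:R.
  exact: dot_dual (@fac_independent r).
have [N NP] := choice ex; exists N; split=> [i k _|m]; first exact: NP.
apply/eqP; rewrite -subr_eq0; apply/eqP/(@fac_perp r) => k kr.
rewrite dotBr dot_sumr (bigD1 k) //= big1 => [|i /andP[ir ik]].
  by rewrite dotZr NP // eqxx mulr1 addr0 subrr.
by rewrite dotZr NP // eq_sym (negPf ik) mulr0.
Qed.

(** Tilting [ux r] by a form that is 0 on [S] and 1 on the rest of the facet leaves the value -1
    exactly on [S]. *)
Lemma simplicial (S : {set 'I_n}) r : S \subset fac r -> S != set0 ->
  exists F, [/\ nface F, F <> Delta & vset F = S].
Proof.
move=> Sr /set0Pn[i0 i0S].
have [m mP] := dot_dual (fun i => (i \notin S)%:R : R) (@fac_independent r).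
have [|e e0 eP] := @polar_step r m; first by move=> i /mP ->; rewrite ler0n.
have eE i : dot (vx i) (ux r + e *: m) == -1 = (i \in S).
  have [ir|ir] := boolP (i \in fac r); last first.
    have := (eP i).2 ir; case: (boolP (i \in S)) => [/(subsetP Sr)|_]; first by rewrite (negPf ir).
    by move=> lt; rewrite gt_eqF.
  rewrite dotDr dotZr mP // (facP _ _).1 //; case: (i \in S) => /=.
    by rewrite mulr0 addr0 eqxx.
  by rewrite mulr1 -subr_eq0 addrAC subrr add0r gt_eqF.
have [||F [nF FD FE]] := @nface_at (ux r + e *: m).
- by apply/polarP => i; exact: (eP i).1.
- by exists i0; apply/eqP; rewrite eE.
by exists F; split=> //; rewrite FE; apply/setP => i; rewrite inE eE.
Qed.

Lemma card_vset F : nface F -> F <> Delta -> (#|vset F| + cone_dim (nc F) = d.+1)%N.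
Proof.
move=> nF FD; have [i0 i0F] := vset_neq0 nF.
have ind := independent_sub i0F (regular_independentR nF FD).
have XP x : x \in lspan (nc F) <->
    forall i, i \in vset F :\ i0 -> dot (vx i - vx i0) x = 0.
  rewrite (lspan_nc x nF i0F); split=> h i.
    by rewrite !inE => /andP[_ iF]; apply: h; rewrite inE.
  have [->|ii0] := eqVneq i i0; first by rewrite subrr dot0l.
  by move=> iF; apply: h; rewrite in_setD1 ii0.
by rewrite (cardsD1 i0 (vset F)) i0F addSn addnC; congr _.+1; exact: perp_dim ind XP.
Qed.

Lemma ux_inj : injective ux.
Proof.
move=> r t /matrixP e; apply/val_inj/eqP; rewrite -(nth_uniq 0 _ _ U_uniq) ?ltn_ord //.
apply/eqP/matrixP => a b; apply/eqP; rewrite -(eqr_int R); apply/eqP.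
by have := e a b; rewrite !mxE; apply.
Qed.

Lemma fac_inj : injective fac.
Proof.
move=> r t e; apply: ux_inj; apply/eqP; rewrite -subr_eq0; apply/eqP.
apply: (@fac_perp r) => i ir; rewrite dotBr (facP r i).1 // (facP t i).1 ?subrr //.
by rewrite -e.
Qed.

(** The basis dual to the vertices on [fac r]; [fnormal r i] directs the edge of the polar polytope
    that leaves [ux r] by relaxing the constraint of [i] alone. *)
Definition fnormal r : 'I_n -> 'rV[R]_d := sval (cid (fac_dual r)).

Lemma fnormal_dual r i k : i \in fac r -> k \in fac r -> dot (vx k) (fnormal r i) = (k == i)%:R.
Proof. exact: (svalP (cid (fac_dual r))).1. Qed.

Lemma fnormal_sum r m : m = \sum_(i in fac r) dot (vx i) m *: fnormal r i.
Proof. exact: (svalP (cid (fac_dual r))).2. Qed.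

(* Among the vertices of the face of the polar polytope dual to S, the one dual to fac r
   minimizes xi exactly when xi lies in cone (fac r) + span S. *)
Lemma argmin_facP xi r (S : {set 'I_n}) : S \subset fac r ->
  (forall t, S \subset fac t -> dot xi (ux r) <= dot xi (ux t)) <->
  (forall i, i \in fac r -> i \notin S -> 0 <= dot xi (fnormal r i)).
Proof.
move=> Sr; split=> [h i ir iS|h t St]; last first.
  rewrite -subr_ge0 -dotBr (fnormal_sum r (ux t - ux r)) dot_sumr.
  apply: sumr_ge0 => i ir; rewrite dotZr dotBr (facP r i).1 //.
  have [iS|iS] := boolP (i \in S).
    by rewrite (facP t i).1 ?subrr ?mul0r // (subsetP St).
  by rewrite mulr_ge0 ?h // opprK; have := ux_ge i t; lra.
(* Otherwise a step along this edge lowers [xi]; the point reached is a convex combination of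
   vertices [ux t] with [S] inside [fac t], none of which is lower than [ux r]. *)
rewrite leNgt; apply/negP => lt0.
have [|e e0 eP] := @polar_step r (fnormal r i).
  by move=> k kr; rewrite fnormal_dual // ler0n.
have pe : polar Delta (ux r + e *: fnormal r i) by apply/polarP => k; exact: (eP k).1.
have [a [a0 a1 yE]] := polar_hull pe.
have aS t : a t != 0 -> S \subset fac t.
  move=> at0; apply/subsetP => k kS; have kr := subsetP Sr k kS; apply/facP.
  apply: (@conv_comb_eq R _ a (fun t => dot (vx k) (ux t)) (-1) a0 a1 _ _ t at0).
    by move=> l; exact: ux_ge.
  rewrite (eq_bigr (fun t => dot (vx k) (a t *: ux t))); last by move=> l _; rewrite dotZr.
  rewrite -dot_sumr -yE dotDr dotZr fnormal_dual // (facP r k).1 //.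
  by case: eqVneq kS iS => [->->//|_ _ _]; rewrite mulr0 addr0.
have : dot xi (ux r) <= dot xi (ux r + e *: fnormal r i).
  rewrite yE dot_sumr -[leLHS]mul1r -a1 mulr_suml; apply: ler_sum => t _.
  rewrite dotZr; have [->|/aS/h le] := eqVneq (a t) 0; first by rewrite !mul0r.
  exact: ler_wpM2l.
by rewrite dotDr dotZr lerDl leNgt pmulr_rlt0 // lt0.
Qed.

Lemma generic_xi : exists xi, injective (fun r => dot xi (ux r)).
Proof.
pose w (p : {p : 'I_(size U) * 'I_(size U) | p.1 != p.2}) := ux (val p).1 - ux (val p).2.
have [p|xi xiP] := @generic_direction R d _ w.
  by rewrite /w subr_eq0 (inj_eq ux_inj); exact: (valP p).
exists xi => r t e; apply/eqP; apply: contraT => rt.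
by have := xiP (Sub (r, t) rt); rewrite /w /= dotBr e subrr eqxx.
Qed.

Lemma argmin_exists xi (S : {set 'I_n}) r0 : S \subset fac r0 ->
  exists2 r, S \subset fac r & forall t, S \subset fac t -> dot xi (ux r) <= dot xi (ux t).
Proof.
move=> Sr0.
by case: (@arg_minP _ _ _ r0 (fun r => S \subset fac r) (fun r => dot xi (ux r)) Sr0) => r ? ?; exists r.
Qed.

(** Each facet on the ridge has one further vertex [i]. According to the sign of [xi] on
    [fnormal r i], the facet minimizes [xi] or its opposite, and both minimizers are unique. *)
Lemma even_ridge (S : {set 'I_n}) r0 : S \subset fac r0 -> (#|S|.+1 = d)%N ->
  ~~ odd #|[set r | S \subset fac r]|.
Proof.
move=> Sr0 Sd; have [xi xi_inj] := generic_xi.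
have single r : S \subset fac r -> exists i, [/\ i \in fac r, i \notin S &
    forall k, k \in fac r -> k \notin S -> k = i].
  move=> Sr; have : #|fac r :\: S| = 1%N.
    by rewrite cardsD (setIidPr Sr) fac_card; move: Sd; lia.
  move=> /eqP/cards1P[i iE]; exists i; have := set11 i; rewrite -iE inE => /andP[iS ir].
  by split=> // k kr kS; apply/set1P; rewrite -iE inE kr kS.
have [r1 Sr1 r1min] := argmin_exists xi Sr0.
have [r2 Sr2 r2min] := argmin_exists (- xi) Sr0.
have all12 r : S \subset fac r -> r = r1 \/ r = r2.
  move=> Sr; have [i [ir iS ui]] := single r Sr.
  have [a0|/ltW a0] := leP 0 (dot xi (fnormal r i)).
    left; have /(argmin_facP xi Sr) rmin : forall k, k \in fac r -> k \notin S ->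
      0 <= dot xi (fnormal r k) by move=> k kr kS; rewrite (ui k).
    by apply/xi_inj/le_anti; rewrite rmin // r1min.
  right; have /(argmin_facP (- xi) Sr) rmin : forall k, k \in fac r -> k \notin S ->
      0 <= dot (- xi) (fnormal r k) by move=> k kr kS; rewrite (ui k) // dotNl oppr_ge0.
  apply/xi_inj/le_anti; have := rmin r2 Sr2; have := r2min r Sr.
  by rewrite !dotNl !lerN2 => -> ->.
(* Were there a single facet, it would minimize every form, including [- vx i], which is -1 on the
   edge direction of [i]. *)
have r12 : r1 != r2.
  apply/eqP => e; have [i [ir iS _]] := single r1 Sr1.
  have /(argmin_facP (- vx i) Sr1)/(_ i ir iS) : forall t, S \subset fac t ->
      dot (- vx i) (ux r1) <= dot (- vx i) (ux t).
    by move=> t /all12[|]->; rewrite // -e.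
  by rewrite dotNl fnormal_dual // eqxx lerNr oppr0 ler10.
have -> : [set r | S \subset fac r] = [set r1; r2].
  apply/setP => r; rewrite !inE; apply/idP/orP => [/all12[|]->|[]/eqP->//].
    by left.
  by right.
by rewrite cards2 r12.
Qed.

(** [blk S] is the facet through [S] of lowest value of [xi]. By [argmin_facP] this is [r] iff [S]
    contains the vertices whose edge descends, which form [Rs r]; a smaller face has more facets to
    minimize over. *)
Lemma shelling_data : exists (Rs : 'I_(size U) -> {set 'I_n}) (rk : 'I_(size U) -> nat)
    (blk : {set 'I_n} -> 'I_(size U)),
  [/\ injective rk,
    forall (S : {set 'I_n}) r, [exists t, S \subset fac t] ->
      (blk S == r) = (Rs r \subset S) && (S \subset fac r)
    & forall S S' : {set 'I_n}, [exists t, S \subset fac t] -> S' \subset S ->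
      (rk (blk S') <= rk (blk S))%N].
Proof.
have [xi xi_inj] := generic_xi.
have [r0 _] : exists r : 'I_(size U), true.
  have [|a [_ a1 _]] := @polar_hull 0; first by apply/polarP => i; rewrite dot0r oppr_le0.
  apply: contrapT => no; have : (1 : R) = 0 by rewrite -a1 big1 // => r _; case: no; exists r.
  by move/eqP; rewrite oner_eq0.
pose rk r := #|[set t | dot xi (ux t) < dot xi (ux r)]|.
have rk_le r t : dot xi (ux r) <= dot xi (ux t) -> (rk r <= rk t)%N.
  move=> le; apply: subset_leq_card; apply/subsetP => l; rewrite !inE => h.
  exact: lt_le_trans h le.
have rk_lt r t : dot xi (ux r) < dot xi (ux t) -> (rk r < rk t)%N.
  move=> lt; apply: proper_card; apply/properP; split.
    by apply/subsetP => l; rewrite !inE => h; exact: lt_trans h lt.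
  by exists r; rewrite !inE ?ltxx.
have ex (S : {set 'I_n}) : exists r, (exists t, S \subset fac t) ->
    S \subset fac r /\ forall t, S \subset fac t -> dot xi (ux r) <= dot xi (ux t).
  have [[t St]|no] := pselect (exists t, S \subset fac t); last by exists r0.
  by have [r Sr rmin] := argmin_exists xi St; exists r.
have [blk blkP] := choice ex.
exists (fun r => [set i in fac r | dot xi (fnormal r i) < 0]), rk, blk; split.
- move=> r t e; apply: xi_inj; apply/eqP; case: ltgtP => // /rk_lt; by rewrite e ltnn.
- move=> S r /existsP[t St]; have [|Sb bmin] := blkP S; first by exists t.
  apply/eqP/andP => [<-|[RS Sr]].
    split=> //; apply/subsetP => i; rewrite !inE => /andP[ir lt0].
    apply: contraT => iS; have := (argmin_facP xi Sb).1 bmin i _ iS.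
    by rewrite !inE ir leNgt lt0 => /(_ isT).
  apply/xi_inj/le_anti; rewrite bmin //=.
  apply: (argmin_facP xi Sr).2 => // i ir iS; rewrite leNgt; apply: contra iS => lt0.
  by apply: (subsetP RS); rewrite inE ir lt0.
move=> S S' /existsP[t St] SS.
have [|Sb bmin] := blkP S; first by exists t.
have [|Sb' bmin'] := blkP S'; first by exists t; exact: subset_trans SS St.
by apply/rk_le/bmin'; exact: subset_trans SS Sb.
Qed.

Lemma mod2_dot (v w : 'rV[int]_d) : dot (mod2 v) (mod2 w) = (dot v w)%:~R.
Proof. exact: dot_map. Qed.

(** Reduction mod 2 gives one inclusion. Dimensions agree because the differences of vertices are
    independent mod 2. *)
Lemma lat2_nc F i0 y : nface F -> F <> Delta -> i0 \in vset F ->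
  y \in lat2 (nc F) <->
  forall i, i \in vset F -> dot (mod2 (vint i)) y = dot (mod2 (vint i0)) y.
Proof.
move=> nF FD i0F.
have [X XP] := perp_exists (fun i => mod2 (vint i) - mod2 (vint i0)) (vset F).
have X' z : z \in X <-> forall i, i \in vset F -> dot (mod2 (vint i)) z = dot (mod2 (vint i0)) z.
  rewrite XP; split=> h i /h; rewrite dotBl; first by move/eqP; rewrite subr_eq0 => /eqP.
  by move=> ->; rewrite subrr.
rewrite -X'; suff -> : lat2 (nc F) = X by [].
apply/eqP; rewrite eqEdim; apply/andP; split.
  apply/subvP => _ /lat2P[v vF ->]; apply/X' => i iF; rewrite !mod2_dot.
  have := (lspan_nc _ nF i0F).1 vF i iF; rewrite dotBl => /eqP; rewrite subr_eq0 => /eqP e.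
  congr (_%:~R); apply/eqP; rewrite -(eqr_int R); apply/eqP.
  by rewrite -!(dot_map (intr : int -> R)).
have ind := independent_sub i0F (regular_independent nF FD).
have e1 : (\dim X + #|vset F :\ i0| = d)%N.
  apply: perp_dim ind _ => x; rewrite XP; split=> h i; last first.
    have [->|ii0 iF] := eqVneq i i0; first by rewrite subrr dot0l.
    by apply: h; rewrite in_setD1 ii0.
  by rewrite in_setD1 => /andP[_ iF]; exact: h.
rewrite (lat2_nc_dim nF); have := card_vset nF FD; rewrite (cardsD1 i0) i0F.
by rewrite add1n addSn => -[e2]; rewrite -(leq_add2r #|vset F :\ i0|) e1 addnC e2.
Qed.

Lemma aff_dim_lt F : nface F -> F <> Delta -> (aff_dim F < d)%N.
Proof.
move=> nF FD; have [r /subset_leq_card] := vset_fac nF FD; rewrite fac_card.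
by have := card_vset nF FD; have := cone_dim_nc nF; lia.
Qed.

(** * The cells of the normal fan and their Hodge ranks *)

Hypothesis D_aff : aff_dim Delta = d.

Local Notation Sigma := (normal_fan Delta).

(** Faces are values of this map on a finite type, hence finitely many. *)
Definition hull_of (S : {set 'I_n}) : set 'rV[R]_d := [set x | exists a : 'I_n -> R,
  [/\ forall i, 0 <= a i, \sum_i a i = 1, x = \sum_i a i *: vx i &
      forall i, a i != 0 -> i \in S]]%classic.

Lemma nface_hull F : nface F -> F = hull_of (vset F).
Proof. by move=> nF; apply/seteqP; split=> x /(nfaceP x nF). Qed.

Lemma finite_nface : finite_set nface.
Proof.
apply: (@sub_finite_set _ _ (range hull_of)%classic).
  by move=> F nF; exists (vset F) => //; rewrite -nface_hull.
by apply: finite_image; exact: finite_finset.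
Qed.

Lemma finite_normal_fan : finite_set Sigma.
Proof.
apply: (@sub_finite_set _ _ (nc @` nface)%classic).
  by move=> C [F [fF Fne ->]]; exists F.
exact/finite_image/finite_nface.
Qed.

Local Notation I := (fset_set Sigma).
Implicit Types s : I.

Fact cell_face_exists s : exists F, nface F /\ val s = nc F.
Proof.
have := valP s; rewrite in_fset_set; last exact: finite_normal_fan.
by move=> /set_mem[F [fF Fne sE]]; exists F.
Qed.

Definition cell_face s : set 'rV[R]_d := sval (cid (cell_face_exists s)).

Lemma nface_cell s : nface (cell_face s).
Proof. exact: (svalP (cid (cell_face_exists s))).1. Qed.

Lemma cell_faceE s : val s = nc (cell_face s).
Proof. exact: (svalP (cid (cell_face_exists s))).2. Qed.

Lemma cell_of_face F : nface F -> exists s, cell_face s = F.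
Proof.
move=> nF; have sF : nc F \in I.
  rewrite in_fset_set; last exact: finite_normal_fan.
  by apply: mem_set; exists F; case: nF.
exists (FSetSub sF); apply: nc_inj => //; first exact: nface_cell.
by rewrite -cell_faceE.
Qed.

Definition vs s := vset (cell_face s).

Lemma cell_face_inj : injective cell_face.
Proof. by move=> s s' e; apply: val_inj; rewrite !cell_faceE e. Qed.

Lemma vs_inj : injective vs.
Proof. by move=> s s' /vset_inj e; apply/cell_face_inj/e; exact: nface_cell. Qed.

Lemma fan_faceE s s' : fan_face s s' = (vs s' \subset vs s).
Proof.
rewrite /fan_face !cell_faceE; apply/asboolP/idP.
  by move/(nc_face (nface_cell _) (nface_cell _)) => h; apply/nface_subset; try exact: nface_cell.
move=> h; apply/nc_face; try exact: nface_cell.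
by apply/nface_subset; try exact: nface_cell.
Qed.

Lemma vs_neq0 s : vs s != set0.
Proof. by have [i iF] := vset_neq0 (nface_cell s); apply/set0Pn; exists i. Qed.

Lemma fan_dimE s : (fan_dim s + aff_dim (cell_face s) = d)%N.
Proof. by rewrite /fan_dim cell_faceE; exact/cone_dim_nc/nface_cell. Qed.

Lemma fan_dim_gt0 s : (0 < fan_dim s)%N <-> cell_face s <> Delta.
Proof.
split=> [s0 e|h]; first by have := fan_dimE s; rewrite e D_aff; lia.
by have := fan_dimE s; have := aff_dim_lt (nface_cell s) h; lia.
Qed.

Lemma card_vs s : (0 < fan_dim s)%N -> (#|vs s| + fan_dim s = d.+1)%N.
Proof.
move=> /fan_dim_gt0 sD; rewrite /fan_dim cell_faceE; apply: card_vset => //.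
exact: nface_cell.
Qed.

Lemma fan_dim_eq0 s : fan_dim s = 0%N -> cell_face s = Delta.
Proof. by move=> s0; apply: contrapT => /fan_dim_gt0; rewrite s0. Qed.

Lemma vs_top s : fan_dim s = 0%N -> vs s = setT.
Proof. by move=> /fan_dim_eq0 e; rewrite /vs e vset_Delta. Qed.

Lemma dim_lat2_cell s : \dim (lat2 (val s)) = fan_dim s.
Proof. by rewrite /fan_dim cell_faceE; exact/lat2_nc_dim/nface_cell. Qed.

Lemma dim_E_stalk s : (dim (E_stalk s) + fan_dim s = d)%N.
Proof.
rewrite /E_stalk dim_quo dim_lat2_cell (_ : dim _ = d); last exact: mul1n.
by rewrite subnK //; have := fan_dimE s; lia.
Qed.

Fact dual_vector_exists s (a : 'I_n) : exists y : 'rV['F_2]_d, (0 < fan_dim s)%N ->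
  forall i, i \in vs s -> dot (mod2 (vint i)) y = (i == a)%:R.
Proof.
(* At the zero cone, where the vertices may be dependent, 0 is a default value. *)
have [s0|] := posnP (fan_dim s); first by exists 0.
move/fan_dim_gt0 => sD.
have [y yP] := dot_dual (fun i => (i == a)%:R : 'F_2) (regular_independent (nface_cell s) sD).
by exists y.
Qed.

Definition dual_vector s a := sval (cid (dual_vector_exists s a)).

Lemma dual_vectorE s a i : (0 < fan_dim s)%N -> i \in vs s ->
  dot (mod2 (vint i)) (dual_vector s a) = (i == a)%:R.
Proof. by move=> s0; exact: (svalP (cid (dual_vector_exists s a))). Qed.

(** For a cone of positive dimension the choice of vector is immaterial: two choices differ by a
    vector pairing to 0 with the vertices of the face, which lies in [lat2]. *)
Definition dual_class s (a : 'I_n) : E_stalk s := quo_pi (lat2 (val s)) (dual_vector s a).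

Lemma lat2_cellP s i0 y : (0 < fan_dim s)%N -> i0 \in vs s -> y \in lat2 (val s) <->
  forall i, i \in vs s -> dot (mod2 (vint i)) y = dot (mod2 (vint i0)) y.
Proof.
move=> /fan_dim_gt0 sD i0s; rewrite cell_faceE; apply: lat2_nc => //.
exact: nface_cell.
Qed.

Lemma dual_class_sum s (A : {set 'I_n}) (c : 'I_n -> 'F_2) :
  \sum_(a in A) c a *: dual_class s a =
  quo_pi (lat2 (val s)) (\sum_(a in A) c a *: dual_vector s a).
Proof. by rewrite linear_sum; apply: eq_bigr => a _; rewrite linearZ. Qed.

Lemma dual_vector_sum s (A : {set 'I_n}) (c : 'I_n -> 'F_2) i :
  (0 < fan_dim s)%N -> i \in vs s ->
  dot (mod2 (vint i)) (\sum_(a in A) c a *: dual_vector s a) = if i \in A then c i else 0.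
Proof.
move=> s0 is_; rewrite dot_sumr; case: ifPn => iA.
  rewrite (bigD1 i) //= big1 => [|a /andP[aA ai]].
    by rewrite dotZr dual_vectorE // eqxx mulr1 addr0.
  by rewrite dotZr dual_vectorE // eq_sym (negPf ai) mulr0.
rewrite big1 // => a aA; rewrite dotZr dual_vectorE //.
by case: eqVneq => [e|_]; [rewrite -e in aA; rewrite aA in iA | rewrite mulr0].
Qed.

(** The sum of the dual vectors pairs to 1 with every vertex of the face, and constant pairing
    characterizes [lat2]. *)
Lemma dual_class_rel s : (0 < fan_dim s)%N -> \sum_(a in vs s) dual_class s a = 0.
Proof.
move=> s0; have /set0Pn[i0 i0s] := vs_neq0 s.
transitivity (\sum_(a in vs s) (1 : 'F_2) *: dual_class s a).
  by apply: eq_bigr => a _; rewrite scale1r.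
rewrite (dual_class_sum s (vs s) (fun=> 1)); apply/eqP; rewrite quo_pi_eq0.
apply/(lat2_cellP _ s0 i0s) => i is_.
by rewrite !(dual_vector_sum _ (fun=> 1) s0) // is_ i0s.
Qed.

Lemma dual_class_basis s : (0 < fan_dim s)%N -> forall a0, a0 \in vs s ->
  exists phi, dualized (vs s :\ a0) (dual_class s) phi /\
    coordinatized (vs s :\ a0) (dual_class s) phi.
Proof.
move=> s0 a0 a0s; apply: independent_coordinatized.
  move=> c; rewrite dual_class_sum => /eqP; rewrite quo_pi_eq0.
  move=> /(lat2_cellP _ s0 a0s) h i iA; have is_ : i \in vs s by move: iA; rewrite !inE => /andP[].
  by have := h i is_; rewrite !dual_vector_sum // iA !inE eqxx.
have := card_vs s0; have := dim_E_stalk s; rewrite (cardsD1 a0 (vs s)) a0s.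
by rewrite add1n addSn => e1 [e2]; apply/eqP; rewrite -(eqn_add2r (fan_dim s)) e1 e2.
Qed.

Lemma dual_class_corestr s s' a : (0 < fan_dim s)%N -> vs s' \subset vs s -> a \in vs s ->
  E_map s s' (dual_class s a) = if a \in vs s' then dual_class s' a else 0.
Proof.
move=> s0 ss as_.
have s'0 : (0 < fan_dim s')%N.
  apply/fan_dim_gt0 => e; have sD := (fan_dim_gt0 s).1 s0; apply: sD.
  apply: vset_inj; [exact: nface_cell|exact: nface_Delta|].
  by apply/eqP; rewrite eqEsubset vset_Delta subsetT /= -vset_Delta -e.
rewrite /E_map /dual_class quo_mapE; last first.
  by rewrite lim1g; apply: fan_face_lat2; rewrite fan_faceE.
rewrite id_lfunE; have /set0Pn[i0 i0s] := vs_neq0 s'.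
case: ifPn => as'; apply/eqP; rewrite ?quo_pi_eq ?quo_pi_eq0; apply/(lat2_cellP _ s'0 i0s) => i is'.
  by rewrite !dotBr !dual_vectorE ?subrr // (subsetP ss).
rewrite !dual_vectorE ?(subsetP ss) //.
have ne k : k \in vs s' -> (k == a) = false by move=> ks; apply: contraNF as' => /eqP <-.
by rewrite !ne.
Qed.

Lemma vs_fac s : (0 < fan_dim s)%N -> exists r, vs s \subset fac r.
Proof. by move=> /fan_dim_gt0; exact: vset_fac (nface_cell s). Qed.

Lemma fac_vs (S : {set 'I_n}) r : S \subset fac r -> S != set0 ->
  exists2 s, (0 < fan_dim s)%N & vs s = S.
Proof.
move=> Sr S0; have [F [nF FD FS]] := simplicial Sr S0.
have [s sF] := cell_of_face nF; exists s; last by rewrite /vs sF.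
by apply/fan_dim_gt0; rewrite sF.
Qed.

Lemma card_cells p : #|{: cells (@fan_dim R d I) d p}| = f_number Delta p.
Proof.
rewrite /f_number; set A := (X in _ = #|` fset_set X|).
have finA : finite_set A.
  by apply: (sub_finite_set _ finite_nface) => F [fF Fne _]; split.
pose f (s : cells (@fan_dim R d I) d p) := cell_face (val s).
have finj : injective f by move=> s s' /cell_face_inj/val_inj.
have -> : fset_set A = [fset f s | s in {: cells (@fan_dim R d I) d p}]%fset.
  apply/fsetP => F; rewrite in_fset_set //; apply/idP/imfsetP => [|[s _ ->]].
    move=> /set_mem[fF Fne Fp]; have [|s sF] := @cell_of_face F; first by split.
    have sp : (fan_dim s + p == d)%N by rewrite -Fp -sF fan_dimE.
    by exists (Sub s sp).
  apply: mem_set; have [fF Fne] := nface_cell (val s); split=> //.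
  by have := eqP (valP s); have := fan_dimE (val s); rewrite /f /=; lia.
by rewrite card_imfset //= -cardE.
Qed.

Lemma mem_K (S : {set 'I_n}) :
  (S \in [set S : {set 'I_n} | [exists r, S \subset fac r]]) = [exists r, S \subset fac r].
Proof. by rewrite inE. Qed.

Let vs_K s : (0 < fan_dim s)%N ->
  vs s \in [set S : {set 'I_n} | [exists r, S \subset fac r]].
Proof. by move=> /vs_fac[r sr]; rewrite inE; apply/existsP; exists r. Qed.

Let K_vs (S : {set 'I_n}) : S \in [set S : {set 'I_n} | [exists r, S \subset fac r]] ->
  S != set0 -> exists2 s, (0 < fan_dim s)%N & vs s = S.
Proof. by rewrite inE => /existsP[r Sr]; exact: fac_vs Sr. Qed.

Let K_ridge (S : {set 'I_n}) : S \in [set S : {set 'I_n} | [exists r, S \subset fac r]] ->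
  S != set0 -> #|S|.+1 = d -> ~~ odd #|[set r | S \subset fac r]|.
Proof. by rewrite inE => /existsP[r Sr] _; exact: even_ridge Sr. Qed.

Lemma hodge_rank_lt p q : (q < p)%N -> (p.+1 < d)%N -> hodge_rank Sigma p q = 0%N.
Proof.
have [Rs [rk [blk [rk_inj blkP rk_blk]]]] := shelling_data.
apply: (homology_rank_lt (E := E_cosheaf I) fan_faceE vs_inj vs_neq0 card_vs vs_top
  dual_class_rel dual_class_basis dual_class_corestr vs_K K_vs rk_inj fac_inj fac_card
  _ _ K_ridge (Rs := Rs) (blk := blk)).
- by move=> S r; rewrite mem_K; exact: blkP.
- by move=> S S'; rewrite mem_K; exact: rk_blk.
Qed.

Lemma hodge_rank_diag q : (q.+1 < d)%N -> hodge_rank Sigma q q = 1%N.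
Proof.
have [Rs [rk [blk [rk_inj blkP rk_blk]]]] := shelling_data.
apply: (homology_rank_eq (E := E_cosheaf I) fan_faceE vs_inj vs_neq0 card_vs vs_top
  dual_class_rel dual_class_basis dual_class_corestr vs_K K_vs rk_inj fac_inj fac_card
  _ _ K_ridge (Rs := Rs) (blk := blk)).
- by move=> S r; rewrite mem_K; exact: blkP.
- by move=> S S'; rewrite mem_K; exact: rk_blk.
Qed.

(** Truncated subtraction in the exponent is harmless: for p < q the binomial vanishes. *)
Lemma h_number_sum q : h_number Delta q =
  \sum_(p < d.+1) (-1) ^+ (p - q) * (f_number Delta p * 'C(p, q))%:R.
Proof.
rewrite /h_number /h_poly coef_sum; apply: eq_bigr => p _.
rewrite coefZ -[('X - 1)]/('X - 1%:P) addrC -rmorphN /= exprDn coef_sum.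
rewrite natrM mulrCA; congr (_ * _).
have [qp|pq] := leqP q p; last first.
  rewrite bin_small // mulr0 big1 // => i _.
  rewrite -rmorphXn /= -mulrnAl -rmorphMn /= coefCM coefXn (negPf (_ : q != i)) ?mulr0 //.
  by rewrite gtn_eqF // (leq_ltn_trans _ pq) // -ltnS.
rewrite (bigD1 (inord q : 'I_p.+1)) //= inordK ?ltnS // big1 ?addr0 => [|i iq].
  rewrite -rmorphXn /= -mulrnAl -rmorphMn /= coefCM coefXn eqxx mulr1.
  by rewrite mulr_natr.
rewrite -rmorphXn /= -mulrnAl -rmorphMn /= coefCM coefXn.
have /negPf-> : q != i; last by rewrite mulr0.
by apply: contraNneq iq => ->; rewrite inord_val.
Qed.

Lemma hodge_euler q : (q <= d)%N ->
  \sum_(q <= p < d.+1) (-1) ^+ p * (hodge_rank Sigma p q)%:R =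
    (-1) ^+ q * h_number Delta q :> int.
Proof.
move=> qd; have [Rs [rk [blk [rk_inj blkP rk_blk]]]] := shelling_data.
rewrite (euler_characteristic (E := E_cosheaf I) fan_faceE vs_inj vs_neq0 card_vs vs_top dim_E_stalk
  dual_class_basis dual_class_corestr vs_K K_vs fac_inj fac_card K_ridge) //.
rewrite h_number_sum big_distrr /= -(big_mkord predT (fun p =>
  (-1) ^+ q * ((-1) ^+ (p - q) * (f_number Delta p * 'C(p, q))%:R : int))).
rewrite [RHS](big_cat_nat (n := q)) //=; last exact: leqW.
rewrite [X in _ = X + _]big_nat_cond [X in _ = X + _]big1 ?add0r.
  apply: eq_big_nat => p /andP[qp _].
  by rewrite card_cells mulrA -exprD subnKC.
by move=> p /andP[/andP[_ pq] _]; rewrite bin_small // muln0 !mulr0.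
Qed.

(** The ray is spanned by a vertex [ux r] of the polar polytope. Its pairing -1 with a lattice
    vertex makes [uint r] primitive and nonzero mod 2. *)
Lemma ray_cell s : fan_dim s = 1%N -> exists2 v, primitive_generator (val s) v &
  lat2 (val s) = <[mod2 v]>%VS /\ mod2 v != 0.
Proof.
move=> s1; have nF := nface_cell s; set F := cell_face s in nF.
have FD : F <> Delta by apply/fan_dim_gt0; rewrite s1.
have [r rP] := facet_functional nF FD.
have [i0 i0F] := vset_neq0 nF.
have i0r : i0 \in fac r by apply/facP/rP/vsetP.
have rF i : i \in vset F -> dot (vx i) (ux r) = -1 by move=> /vsetP/rP.
have urF : nc F (ux r) by apply/ncP => // i j iF; rewrite rF // ux_ge.
have ur0 : ux r != 0.
  apply/eqP => ur0; move/facP: i0r; rewrite ur0 dot0r => /esym/eqP.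
  by rewrite oppr_eq0 oner_eq0.
have sF : val s = nc F := cell_faceE s.
have line : lspan (val s) = <[ux r]>%VS.
  apply/esym/eqP; rewrite eqEdim dim_vline ur0 -memvE -[\dim _]/(fan_dim s) s1 leqnn andbT.
  by rewrite sF; exact: lspan_mem.
have m20 : mod2 (uint r) != 0.
  apply/eqP => u0; have := mod2_dot (vint i0) (uint r).
  by rewrite u0 dot0r vint_uint // => /esym/eqP; rewrite oppr_eq0 oner_eq0.
exists (uint r); split => //.
- exact: primitive_uint i0r.
- rewrite sF; apply/seteqP; split=> [m mF|_ [c [_ [c0 -> ->]]]].
    have : m \in lspan (val s) by rewrite sF; exact: lspan_mem.
    rewrite line => /vlineP[c mE]; exists c, (ux r); split=> //.
    have := mF (vx i0) 0 ((vsetP _ _).1 i0F) Delta0.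
    rewrite mE [pairing _ _]dotZr [pairing _ _]dot0l rF //; lra.
  apply/ncP => // i j iF; rewrite !dotZr rF //.
  by rewrite ler_wpM2l // ux_ge.
apply/esym/eqP; rewrite eqEdim dim_vline m20 dim_lat2_cell s1 leqnn andbT -memvE.
by apply/lat2P; exists (uint r) => //; apply: lspan_mem; rewrite sF.
Qed.

Lemma ray_rankE : ray_rank Sigma =
  \dim (\sum_(s : I | fan_dim s == 1%N) lat2 (val s))%VS.
Proof.
rewrite /ray_rank; congr (\dim _); apply/eqP; rewrite eqEsubv; apply/andP; split.
  apply/subv_sumP => w /asboolP[v [rho [Srho rho1 [_ vE]]] ->]; rewrite -memvE.
  have rhoI : rho \in I by rewrite in_fset_set; [exact: mem_set|exact: finite_normal_fan].
  apply: (subvP (sumv_sup (FSetSub rhoI) _ (subvv _))); first exact/eqP.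
  apply/lat2P; exists v => //; apply: lspan_mem; rewrite /= vE.
  by exists 1, (lat R v); rewrite scale1r.
apply/subv_sumP => s /eqP s1; have [v vP [-> _]] := ray_cell s1.
apply: (sumv_sup (mod2 v)) => //; apply/asboolP; exists v => //.
exists (val s); split=> //; have := valP s.
by rewrite in_fset_set; [move/set_mem|exact: finite_normal_fan].
Qed.

(** The stalk at the zero cone is N/2N up to a quotient by 0, and its map to the stalk at a ray has
    the class of the generator as kernel, so [ext_kernel_dim] applies. *)
Lemma hodge_rank_top q : hodge_rank Sigma d q =
  let s := ray_rank Sigma in if (s <= q)%N then 'C(d - s, q - s) else 0%N.
Proof.
have [s0 s0D] := cell_of_face nface_Delta.
have s00 : fan_dim s0 = 0%N.
  by apply/eqP; rewrite -leqn0 leqNgt; apply/negP => /fan_dim_gt0; rewrite s0D.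
have [|s|s|Z ZE ZP] := @top_homology _ _ (@fan_dim R d I) d (ext_cosheaf q (E_cosheaf I)) s0 s00.
- by move=> s /fan_dim_eq0 sD; apply: cell_face_inj; rewrite sD s0D.
- by rewrite fan_faceE (vs_top s00) subsetT.
- by have := fan_dimE s; lia.
rewrite /hodge_rank [LHS]ZE.
have lat0 : lat2 (val s0) = 0%VS by apply/eqP; rewrite -dimv_eq0 dim_lat2_cell s00.
have ex s : exists w, fan_dim s = 1%N -> lat2 (val s) = <[w]>%VS /\ w != 0.
  have [s1|/eqP s1] := eqVneq (fan_dim s) 1%N; last by exists 0 => /s1.
  by have [v _ ?] := ray_cell s1; exists (mod2 v).
have [w wP] := choice ex.
pose nu s := quo_pi (lat2 (val s0)) (w s).
have ker0 : lker (quo_pi (lat2 (val s0))) = 0%VS by rewrite lker_quo_pi.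
have kerE s : fan_dim s == 1%N -> lker (E_map s0 s) = <[nu s]>%VS.
  move=> /eqP s1; have [sw _] := wP s s1.
  apply/vspaceP => x; rewrite memv_ker -[x]quo_piK /E_map quo_mapE; last first.
    by rewrite lim1g lat0 sub0v.
  rewrite id_lfunE quo_pi_eq0 sw; apply/vlineP/vlineP => -[k kE]; exists k.
    by rewrite kE linearZ.
  apply/eqP; rewrite -subr_eq0 -memv0 -lat0 -quo_pi_eq0 linearB linearZ /=.
  by rewrite kE subrr.
have nu0 s : fan_dim s == 1%N -> nu s != 0.
  by move=> /eqP s1; rewrite /nu quo_pi_eq0 lat0 memv0 (wP s s1).2.
rewrite (@ext_kernel_dim q _ _ (fun s => fan_dim s == 1%N) _ (fun s => E_map s0 s) nu kerE nu0 Z).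
  have -> : dim (E_stalk s0) = d by have := dim_E_stalk s0; rewrite s00 addn0.
  suff -> : \dim (\sum_(s | fan_dim s == 1%N) <[nu s]>)%VS = ray_rank Sigma by [].
  rewrite ray_rankE -[RHS](@limg_dim_eq _ _ _ (quo_pi (lat2 (val s0)))); last by rewrite ker0 capv0.
  rewrite limg_sum; congr (\dim _); apply: eq_bigr => s /eqP s1.
  by rewrite (wP s s1).1 limg_line.
move=> x; rewrite ZP; split=> h s; first by move/eqP/h.
by move=> s1; apply: h; apply/eqP.
Qed.

End Polytope.

Theorem mainTheorem4 (R : realType) (d : nat) (Delta : set 'rV[R]_d)
    (Delta_reflexive : reflexive_polytope Delta)
    (face_fan_regular : forall C : set 'rV[R]_d,
       face_fan Delta C -> Z2_regular C) :
  let Sigma := normal_fan Delta in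
  let s := ray_rank Sigma in
  [/\ forall q : nat, (q + 2 <= d)%N -> hodge_rank Sigma q q = 1%N,
      forall p q : nat, (q < p)%N -> (p + 2 <= d)%N ->
        hodge_rank Sigma p q = 0%N,
      forall q : nat, (q <= d)%N ->
        hodge_rank Sigma d q =
          if (s <= q)%N then 'C(d - s, q - s) else 0%N
    & forall q : nat, (q <= d)%N ->
        \sum_(q <= p < d.+1) (-1) ^+ p * (hodge_rank Sigma p q)%:R =
          (-1) ^+ q * h_number Delta q :> int].
Proof.
have [[V0 DV0] D_aff D_int [U0 DU0]] := Delta_reflexive.
have [V [V_uniq V_irr DV]] := conv_hull_irredundant R V0.
have [U [U_uniq U_irr DU]] := conv_hull_irredundant R U0.
rewrite -DV0 in DV; rewrite -DU0 in DU.
split=> [q qd|p q qp pd|q _|q qd].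
- by rewrite addn2 in qd; exact: (hodge_rank_diag V_irr DV D_int V_uniq U_uniq U_irr DU face_fan_regular D_aff qd).
- by rewrite addn2 in pd; exact: (hodge_rank_lt V_irr DV D_int V_uniq U_uniq U_irr DU face_fan_regular D_aff qp pd).
- exact: (hodge_rank_top V_irr DV D_int V_uniq U_uniq U_irr DU face_fan_regular D_aff q).
- exact: (hodge_euler V_irr DV D_int V_uniq U_uniq U_irr DU face_fan_regular D_aff qd).
Qed.
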